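(* Let $(R,\mathfrak{m})$ be a commutative noetherian local ring with $\mathfrak m$-adic completion $\widehat R$, $I$ an ideal of $R$, $M$ an artinian $R$-module and $s$ a non-negative integer. If $\mathfrak{F}^I_i(M)$ is a noetherian $\widehat R$-module for all $i<s$, then $\mathfrak{F}^I_s(M)/I\mathfrak{F}^I_s(M)$ is a noetherian $\widehat R$-module.
   Context: For an $R$-module $N$, $H^{\mathfrak m}_i(N)=\varprojlim_s\operatorname{Tor}^R_i(R/\mathfrak m^s,N)$, and the $i$-th $I$-formal local homology module is $\mathfrak{F}^I_i(M)=\varinjlim_t H^{\mathfrak m}_i(0:_M I^t)$, where $0:_M I^t=\{x\in M:I^tx=0\}$ and the transition maps are induced by inclusions. It has a natural structure of $\widehat R$-module, since each $H^{\mathfrak m}_i(0:_MI^t)$ is an inverse limit of modules annihilated by powers of $\mathfrak m$. *)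

(* Defs.v *)
From HB Require Import structures.
From mathcomp Require Import all_boot all_order all_algebra.
From mathcomp Require Import generic_quotient ring_quotient finmap.
From mathcomp Require Import boolp classical_sets functions cardinality fsbigop.

Set Implicit Arguments.
Unset Strict Implicit.
Unset Printing Implicit Defensive.

Import GRing.Theory.
Local Open Scope classical_set_scope.
Local Open Scope ring_scope.
Local Open Scope quotient_scope.

Section Pack.
Variable R : pzRingType.
Implicit Types U V : lmodType R.

Definition pack_linear U V (f : U -> V) (fL : linear f) : {linear U -> V} :=
  HB.pack f (GRing.isLinear.Build R U V *:%R f fL).

Lemma pack_linearE U V (f : U -> V) (fL : linear f) x : pack_linear fL x = f x.
Proof. by []. Qed.

Definition submod_prop V (P : set V) :=
  P 0 /\ forall (a : R) u v, P u -> P v -> P (a *: u + v).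

Lemma submod_propP V (P : set V) :
  submod_prop P -> submod_closed [pred x | `[< P x >]].
Proof.
case=> P0 PD; split; first exact/asboolP.
by move=> a u v /asboolP Pu /asboolP Pv; apply/asboolP/PD.
Qed.

Definition pack_submod V (P : set V) (H : submod_prop P) : submodClosed V :=
  HB.pack (fun x => x \in [pred x | `[< P x >]])
    (GRing.isSubmodClosed.Build R V _ (submod_propP H)).

Lemma pack_submodP V (P : set V) (H : submod_prop P) x :
  reflect (P x) (x \in pack_submod H).
Proof. exact: asboolP. Qed.

End Pack.

Section Submodule.
Variables (R : pzRingType) (V : lmodType R) (S : submodClosed V).

Record submod_of := SubmodOf { submod_val : V ; _ : submod_val \in S }.
HB.instance Definition _ := [isSub for submod_val].
HB.instance Definition _ := [Choice of submod_of by <:].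
HB.instance Definition _ := [SubChoice_isSubLmodule of submod_of by <:].

Lemma submod_valZ a (x : submod_of) : val (a *: x) = a *: val x.
Proof. exact: linearZ. Qed.

Lemma submod_oppr_closed : oppr_closed S.
Proof. by move=> x xS; rewrite -scaleN1r rpredZ. Qed.

Definition submod_zmod : zmodClosed V :=
  HB.pack (S : {pred V}) (GRing.isOppClosed.Build V S submod_oppr_closed) (GRing.SubmodClosed.on S).

Definition quotmod := Quotient.quot submod_zmod.
HB.instance Definition _ := GRing.Zmodule.on quotmod.

Definition quotpi (x : V) : quotmod := \pi_(Quotient.quot submod_zmod) x.
Definition quotrepr (x : quotmod) : V := repr x.

Lemma quotreprK x : quotpi (quotrepr x) = x.
Proof. exact: reprK. Qed.

Lemma quotpi_eq x y : quotpi x = quotpi y <-> x - y \in S.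
Proof.
rewrite (_ : (_ \in S) = (x - y \in submod_zmod)) // Quotient.idealrBE.
by split => [/eqP|/eqP].
Qed.

Lemma quotpiD x y : quotpi (x + y) = quotpi x + quotpi y.
Proof. exact: raddfD. Qed.

Definition quot_scale (a : R) (x : quotmod) := quotpi (a *: quotrepr x).

Lemma quot_scaleE a x : quot_scale a (quotpi x) = quotpi (a *: x).
Proof.
apply/quotpi_eq; rewrite -scalerBr rpredZ //; apply/quotpi_eq.
exact: quotreprK.
Qed.

Lemma quot_scaleA a b x : quot_scale a (quot_scale b x) = quot_scale (a * b) x.
Proof. by rewrite -[x]quotreprK !quot_scaleE scalerA. Qed.

Lemma quot_scale1 : left_id 1 quot_scale.
Proof. by move=> x; rewrite -[x]quotreprK !quot_scaleE scale1r. Qed.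

Lemma quot_scaleDr : right_distributive quot_scale +%R.
Proof.
move=> a x y; rewrite -[x]quotreprK -[y]quotreprK.
by rewrite -quotpiD !quot_scaleE -quotpiD scalerDr.
Qed.

Lemma quot_scaleDl x : {morph quot_scale^~ x : a b / a + b}.
Proof.
by move=> a b; rewrite -[x]quotreprK !quot_scaleE -quotpiD scalerDl.
Qed.

HB.instance Definition _ := GRing.Zmodule_isLmodule.Build R quotmod
  quot_scaleA quot_scale1 quot_scaleDr quot_scaleDl.

Lemma quotpi_is_linear : linear quotpi.
Proof. by move=> a x y; rewrite quotpiD -quot_scaleE. Qed.
HB.instance Definition _ := GRing.isLinear.Build R V quotmod *:%R quotpi
  quotpi_is_linear.

End Submodule.

Section Submodules.
Variable R : pzRingType.
Implicit Types U V : lmodType R.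

Lemma full_submod_prop V : submod_prop [set: V].
Proof. by []. Qed.
Definition fullmod V := pack_submod (full_submod_prop V).

Lemma ker_submod_prop U V (f : {linear U -> V}) :
  submod_prop [set x | f x = 0].
Proof.
split=> [|a u v /= fu fv]; first exact: raddf0.
by rewrite linearP fu fv scaler0 addr0.
Qed.
Definition kermod U V (f : {linear U -> V}) :=
  pack_submod (ker_submod_prop f).

Lemma kermodP U V (f : {linear U -> V}) x :
  reflect (f x = 0) (x \in kermod f).
Proof. exact: pack_submodP. Qed.

Lemma im_submod_prop U V (f : {linear U -> V}) :
  submod_prop (range f).
Proof.
split; first by exists 0 => //; exact: raddf0.
move=> a _ _ [x _ <-] [y _ <-]; exists (a *: x + y) => //.
by rewrite linearP.
Qed.
Definition immod U V (f : {linear U -> V}) := pack_submod (im_submod_prop f).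

Lemma immodP U V (f : {linear U -> V}) y :
  reflect (exists x, f x = y) (y \in immod f).
Proof.
apply: (iffP (pack_submodP _ _)) => [[x _ <-]|[x <-]]; first by exists x.
by exists x.
Qed.

Lemma span_submod_prop V (A : set V) :
  submod_prop
    [set x | forall S : submodClosed V, A `<=` [set` S] -> x \in S].
Proof.
split=> [S _|a u v Hu Hv S AS]; first exact: rpred0.
by apply: rpredD; [apply: rpredZ; exact: Hu | exact: Hv].
Qed.
Definition submod_span V (A : set V) := pack_submod (span_submod_prop A).

Definition noetherian V :=
  forall S : nat -> submodClosed V,
    (forall n, {subset S n <= S n.+1}) ->
    exists n, forall k, (n <= k)%N -> S k =i S n.

Definition artinian V :=
  forall S : nat -> submodClosed V,
    (forall n, {subset S n.+1 <= S n}) ->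
    exists n, forall k, (n <= k)%N -> S k =i S n.

Section SubMap.
Variables (U V : lmodType R) (f : {linear U -> V}).
Variables (S : submodClosed U) (T : submodClosed V).
Hypothesis fST : forall x, x \in S -> f x \in T.

Definition sub_map_fun (x : submod_of S) : submod_of T :=
  SubmodOf (fST (valP x)).

Lemma sub_map_is_linear : linear sub_map_fun.
Proof. by move=> a x y; apply: val_inj; rewrite /= !linearP. Qed.

Definition sub_map := pack_linear sub_map_is_linear.

Definition quot_map_fun (x : quotmod S) : quotmod T :=
  quotpi T (f (quotrepr x)).

Lemma quot_map_funE x : quot_map_fun (quotpi S x) = quotpi T (f x).
Proof.
apply/quotpi_eq; rewrite -raddfB; apply: fST; apply/quotpi_eq.
exact: quotreprK.
Qed.

Lemma quot_map_is_linear : linear quot_map_fun.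
Proof.
move=> a x y; rewrite -[x]quotreprK -[y]quotreprK -linearP.
by rewrite !quot_map_funE !linearP.
Qed.

Definition quot_map := pack_linear quot_map_is_linear.

Lemma quot_mapE x : quot_map (quotpi S x) = quotpi T (f x).
Proof. exact: quot_map_funE. Qed.

End SubMap.

(* [subquot Z B] is Z/(Z ∩ B), with the elements of Z/(Z ∩ B) classes of
   elements of the submodule Z. *)
Lemma pull_submod_prop V (Z B : submodClosed V) :
  submod_prop [set z : submod_of Z | val z \in B].
Proof.
split=> [|a u v /= uB vB]; first exact: rpred0.
by rewrite rpredD ?rpredZ.
Qed.
Definition pullmod V (Z B : submodClosed V) :=
  pack_submod (pull_submod_prop Z B).
Lemma pullmodP V (Z B : submodClosed V) (z : submod_of Z) :
  (z \in pullmod Z B) = (val z \in B).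
Proof. by apply/pack_submodP/idP. Qed.

Definition subquot V (Z B : submodClosed V) : lmodType R :=
  quotmod (pullmod Z B).

Section SubquotMap.
Variables (U V : lmodType R) (f : {linear U -> V}).
Variables (Z B : submodClosed U) (Z' B' : submodClosed V).
Hypothesis fZ : forall x, x \in Z -> f x \in Z'.
Hypothesis fB : forall x, x \in B -> f x \in B'.

Lemma subquot_map_subproof x :
  x \in pullmod Z B -> sub_map fZ x \in pullmod Z' B'.
Proof. by move=> /pack_submodP xB; apply/pack_submodP; exact: fB. Qed.

Definition subquot_map : {linear subquot Z B -> subquot Z' B'} :=
  quot_map subquot_map_subproof.
End SubquotMap.

End Submodules.

Section DirectSum.
Variables (R : pzRingType) (X : choiceType).

Section Prod.
Variable T : X -> lmodType R.

Definition dprod := forall x, T x.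
HB.instance Definition _ := gen_eqMixin dprod.
HB.instance Definition _ := gen_choiceMixin dprod.

Definition dprod_add (f g : dprod) : dprod := fun x => f x + g x.
Definition dprod_opp (f : dprod) : dprod := fun x => - f x.
Definition dprod_scale (a : R) (f : dprod) : dprod := fun x => a *: f x.

Lemma dprod_addA : associative dprod_add.
Proof. by move=> f g h; apply: functional_extensionality_dep => x; exact: addrA. Qed.
Lemma dprod_addC : commutative dprod_add.
Proof. by move=> f g; apply: functional_extensionality_dep => x; exact: addrC. Qed.
Lemma dprod_add0 : left_id ((fun=> 0) : dprod) dprod_add.
Proof. by move=> f; apply: functional_extensionality_dep => x; exact: add0r. Qed.
Lemma dprod_addN : left_inverse ((fun=> 0) : dprod) dprod_opp dprod_add.
Proof. by move=> f; apply: functional_extensionality_dep => x; exact: addNr. Qed.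
HB.instance Definition _ := GRing.isZmodule.Build dprod
  dprod_addA dprod_addC dprod_add0 dprod_addN.

Lemma dprod_scaleA a b f :
  dprod_scale a (dprod_scale b f) = dprod_scale (a * b) f.
Proof. by apply: functional_extensionality_dep => x; exact: scalerA. Qed.
Lemma dprod_scale1 : left_id 1 dprod_scale.
Proof. by move=> f; apply: functional_extensionality_dep => x; exact: scale1r. Qed.
Lemma dprod_scaleDr : right_distributive dprod_scale +%R.
Proof. by move=> a f g; apply: functional_extensionality_dep => x; exact: scalerDr. Qed.
Lemma dprod_scaleDl f : {morph dprod_scale^~ f : a b / a + b}.
Proof. by move=> a b; apply: functional_extensionality_dep => x; exact: scalerDl. Qed.
HB.instance Definition _ := GRing.Zmodule_isLmodule.Build R dprod
  dprod_scaleA dprod_scale1 dprod_scaleDr dprod_scaleDl.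

Lemma finsupp_submod_prop :
  submod_prop [set f : dprod | finite_set [set x | f x != 0]].
Proof.
split=> [|a f g /= ff fg].
  by apply: (sub_finite_set _ (finite_set0 X)) => x /=; rewrite eqxx.
apply: (sub_finite_set (B := [set x | f x != 0] `|` [set x | g x != 0])).
  move=> x /=; have [f0|] := eqVneq (f x) 0; last by left.
  rewrite -[(a *: f + g) x]/(a *: f x + g x) f0 scaler0 add0r; by right.
by rewrite finite_setU.
Qed.

Definition dsum := submod_of (pack_submod finsupp_submod_prop).
HB.instance Definition _ := GRing.Lmodule.on dsum.

Definition dcoef (f : dsum) (x : X) : T x := val f x.

Lemma dcoef_finite (f : dsum) : finite_set [set x | dcoef f x != 0].
Proof. by have /pack_submodP := valP f. Qed.

Lemma dsumP (f g : dsum) : (forall x, dcoef f x = dcoef g x) -> f = g.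
Proof.
by move=> fg; apply: val_inj; apply: functional_extensionality_dep => x; exact: fg.
Qed.

Lemma dsum_mk (f : dprod) (H : finite_set [set x | f x != 0]) :
  f \in pack_submod finsupp_submod_prop.
Proof. exact/pack_submodP. Qed.

Lemma single_finite x (v : T x) :
  finite_set [set y | dfwith ((fun=> 0) : dprod) v y != 0].
Proof.
apply: (sub_finite_set _ (finite_set1 x)) => y /=.
by case: dfwithP => // j _; rewrite eqxx.
Qed.

Definition dsingle_fun x (v : T x) : dsum := SubmodOf (dsum_mk (single_finite v)).

Lemma dsingle_is_linear x : linear (@dsingle_fun x).
Proof.
move=> a u v; apply: dsumP => y; rewrite /dcoef /=.
rewrite [RHS]/(a *: dfwith ((fun=> 0) : dprod) u y + dfwith ((fun=> 0) : dprod) v y).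
have [xy|xy] := eqVneq x y; first by subst y; rewrite !dfwith_in.
rewrite !dfwith_out //; transitivity (a *: (0 : T y) + 0) => //.
by rewrite scaler0 addr0.
Qed.
Definition dsingle x : {linear T x -> dsum} := pack_linear (@dsingle_is_linear x).

Lemma dsingle_in x v : dcoef (dsingle x v) x = v.
Proof. exact: dfwith_in. Qed.
Lemma dsingle_out x v y : x != y -> dcoef (dsingle x v) y = 0.
Proof. exact: dfwith_out. Qed.

Section Lift.
Variables (V : lmodType R) (h : forall x, {linear T x -> V}).

Definition dlift_fun (f : dsum) : V := \sum_(x \in [set: X]) h x (dcoef f x).

Lemma dlift_funE (f : dsum) (A : set X) : finite_set A ->
  (forall x, dcoef f x != 0 -> A x) ->
  dlift_fun f = \sum_(x \in A) h x (dcoef f x).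
Proof.
move=> _ fA; rewrite /dlift_fun; apply/esym; apply: fsbig_widen => // x /= [_ nA].
by have [->|/fA //] := eqVneq (dcoef f x) 0; exact: raddf0.
Qed.

Lemma dlift_is_linear : linear dlift_fun.
Proof.
move=> a f g.
pose A := [set x | dcoef f x != 0] `|` [set x | dcoef g x != 0].
have finA : finite_set A by rewrite finite_setU; split; exact: dcoef_finite.
have fA x : dcoef f x != 0 -> A x by left.
have gA x : dcoef g x != 0 -> A x by right.
have fgA x : dcoef (a *: f + g) x != 0 -> A x.
  have [f0|fx _] := eqVneq (dcoef f x) 0; last exact: fA.
  by rewrite -[dcoef (a *: f + g) x]/(a *: dcoef f x + dcoef g x)
    f0 scaler0 add0r => /gA.
rewrite (dlift_funE finA fgA) (dlift_funE finA fA) (dlift_funE finA gA).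
rewrite !fsbig_finite // scaler_sumr -big_split /=; apply: eq_bigr => x _.
by rewrite -linearP.
Qed.
Definition dlift : {linear dsum -> V} := pack_linear dlift_is_linear.

Lemma dlift_single x v : dlift (dsingle x v) = h x v.
Proof.
rewrite [LHS](@dlift_funE _ [set x]) //; last first.
  move=> y; apply: contra_neqP => /eqP; rewrite eq_sym => xy.
  exact: dsingle_out.
by rewrite fsbig_set1 dsingle_in.
Qed.
End Lift.

Lemma dsum_decomp (f : dsum) : f = dlift dsingle f.
Proof.
apply: dsumP => x.
have finA := dcoef_finite f.
rewrite [dlift _ _](@dlift_funE _ _ _ _ finA) //.
rewrite fsbig_finite //.
have dcoef_sum (s : seq X) (F : X -> dsum) :
    dcoef (\sum_(i <- s) F i) x = \sum_(i <- s) dcoef (F i) x.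
  by elim: s => [|y s IH]; rewrite ?big_nil // !big_cons -IH.
rewrite dcoef_sum; have [fx|fx] := eqVneq (dcoef f x) 0.
  rewrite fx big1 // => y _; have [->|yx] := eqVneq y x.
    by rewrite fx raddf0.
  exact: dsingle_out.
rewrite (big_fsetD1 x) /=; last by rewrite in_fset_set // inE.
rewrite dsingle_in big1_fset ?addr0 // => y; rewrite !inE => /andP[yx _] _.
exact: dsingle_out.
Qed.

Lemma dsum_ext (V : lmodType R) (f g : {linear dsum -> V}) :
  (forall x v, f (dsingle x v) = g (dsingle x v)) -> f =1 g.
Proof.
move=> fg u; rewrite (dsum_decomp u) [dlift _ _](dlift_funE _ (dcoef_finite u)) //.
rewrite fsbig_finite; last exact: dcoef_finite.
by rewrite !raddf_sum; apply: eq_bigr => x _; exact: fg.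
Qed.

Lemma dsum_extl (V : lmodType R) (f g : dsum -> V) : linear f -> linear g ->
  (forall x v, f (dsingle x v) = g (dsingle x v)) -> f =1 g.
Proof.
move=> fL gL; exact: (dsum_ext (f := pack_linear fL) (g := pack_linear gL)).
Qed.

End Prod.

Section CoefMap.
Variables (T T' : X -> lmodType R) (h : forall x, {linear T x -> T' x}).

Lemma dmap_finite (f : dsum T) : finite_set [set x | h x (dcoef f x) != 0].
Proof.
apply: sub_finite_set (dcoef_finite f) => x /=.
by apply: contra_neq => ->; exact: raddf0.
Qed.
Definition dmap_fun (f : dsum T) : dsum T' :=
  SubmodOf (dsum_mk (f := fun x => h x (dcoef f x)) (dmap_finite f)).

Lemma dmap_is_linear : linear dmap_fun.
Proof.
by move=> a f g; apply: dsumP => x; rewrite [LHS]linearP.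
Qed.
Definition dmap : {linear dsum T -> dsum T'} := pack_linear dmap_is_linear.

Lemma dmap_single x v : dmap (dsingle T x v) = dsingle T' x (h x v).
Proof.
apply: dsumP => y; rewrite [LHS]/(h y (dcoef (dsingle T x v) y)).
have [<-|xy] := eqVneq x y; first by rewrite !dsingle_in.
by rewrite !dsingle_out //; exact: (raddf0 (h y)).
Qed.
End CoefMap.

End DirectSum.

Section FreeResolution.
Variable R : comPzRingType.
Implicit Types (A B K L N : lmodType R).

(* [copower K N] is N^(K), the direct sum of copies of N indexed by the set of
   elements of K; it is the tensor product over R of N with the free module
   [free_on K] on the set K. *)
Definition copower K N : lmodType R := dsum (fun _ : K => N).
Definition free_on K : lmodType R := copower K R^o.

Definition csingle K N (x : K) : {linear N -> copower K N} :=
  dsingle (fun _ : K => N) x.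

Lemma scale_csingle K N (x : K) (a : R) (v : N) :
  a *: csingle N x v = csingle N x (a *: v).
Proof. by rewrite linearZ. Qed.

Lemma copower_ext K N (V : lmodType R) (f g : copower K N -> V) : linear f -> linear g ->
  (forall x v, f (csingle N x v) = g (csingle N x v)) -> f =1 g.
Proof. exact: dsum_extl. Qed.

Lemma scale_by_is_linear N (x : N) : linear (fun a : R^o => a *: x).
Proof. by move=> a b c; rewrite scalerDl scalerA. Qed.
Definition scale_by N (x : N) : {linear R^o -> N} :=
  pack_linear (scale_by_is_linear x).

Definition aug K : {linear free_on K -> K} := dlift (fun x : K => scale_by x).

Definition pure_tensor K N (k : free_on K) (v : N) : copower K N :=
  dmap (fun _ : K => scale_by v) k.

Lemma pure_tensor_is_linear K N (k : free_on K) : linear (@pure_tensor K N k).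
Proof.
move=> a v w; apply: dsumP => x.
rewrite -[LHS]/(dcoef k x *: (a *: v + w)).
rewrite -[RHS]/(a *: (dcoef k x *: v) + dcoef k x *: w).
by rewrite scalerDr !scalerA mulrC.
Qed.
Definition tensor_left K N (k : free_on K) : {linear N -> copower K N} :=
  pack_linear (@pure_tensor_is_linear K N k).

Definition push K L N (g : K -> L) : {linear copower K N -> copower L N} :=
  dlift (fun x : K => csingle N (g x)).

Definition coef_map K N N' (h : {linear N -> N'}) :
    {linear copower K N -> copower K N'} :=
  dmap (fun _ : K => h).

Definition syzygy K : lmodType R := submod_of (kermod (aug K)).

(* The functorial free resolution
     ... -> free_on (syz A 1) -> free_on (syz A 0) -> A -> 0
   in which [syz A 0] is A and [syz A n.+1] is the kernel of
   [aug (syz A n) : free_on (syz A n) -> syz A n]. [Tor A N n] is the homology in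
   degree n of this resolution tensored with N. *)
Fixpoint syz A (n : nat) : lmodType R :=
  if n is n'.+1 then syzygy (syz A n') else A.

(* The differential free_on (syzygy K) -> free_on K of that resolution, which sends
   the basis element of x to x, tensored with N. *)
Definition diff K N : {linear copower (syzygy K) N -> copower K N} :=
  dlift (fun x : syzygy K => tensor_left N (val x)).

Definition cycles A N (n : nat) : submodClosed (copower (syz A n) N) :=
  match n with
  | 0 => fullmod (copower (syz A 0) N)
  | n'.+1 => kermod (diff (syz A n') N)
  end.

Definition boundaries A N (n : nat) : submodClosed (copower (syz A n) N) :=
  immod (diff (syz A n) N).

Definition Tor A N (n : nat) : lmodType R :=
  subquot (cycles A N n) (boundaries A N n).

Lemma pure_tensor_single K N x (a : R^o) (v : N) :
  pure_tensor (csingle (K := K) R^o x a) v =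
  csingle (K := K) N x (a *: v).
Proof. exact: dmap_single. Qed.

Lemma push_single K L N (g : K -> L) x (v : N) :
  push N g (csingle (K := K) N x v) = csingle (K := L) N (g x) v.
Proof. exact: dlift_single. Qed.

Lemma aug_single K x (a : R^o) :
  aug K (csingle (K := K) R^o x a) = a *: x.
Proof. exact: dlift_single. Qed.

Lemma diff_single K N x (v : N) :
  diff K N (csingle (K := syzygy K) N x v) = pure_tensor (val x) v.
Proof. exact: dlift_single. Qed.

Lemma coef_map_single K N N' (h : {linear N -> N'}) x (v : N) :
  coef_map K h (csingle (K := K) N x v) =
  csingle (K := K) N' x (h v).
Proof. exact: dmap_single. Qed.

Lemma pure_tensorZl K N a (k : free_on K) (v : N) :
  pure_tensor (a *: k) v = a *: pure_tensor k v.
Proof. by rewrite /pure_tensor linearZ. Qed.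

Lemma diff_tensor K N (k : free_on (syzygy K)) (v : N) :
  diff K N (pure_tensor k v) = pure_tensor (val (aug (syzygy K) k)) v.
Proof.
move: k; apply: copower_ext => [b k l|b k l|x a].
- by rewrite /pure_tensor !linearP.
- by rewrite /pure_tensor !linearP.
rewrite pure_tensor_single diff_single aug_single.
rewrite (_ : val (a *: x) = a *: val x) // pure_tensorZl.
by rewrite -[LHS]/(tensor_left N (val x) (a *: v)) linearZ.
Qed.

Lemma diffK K N (u : copower (syzygy (syzygy K)) N) :
  diff K N (diff (syzygy K) N u) = 0.
Proof.
move: u; apply: copower_ext => [b k l|b k l|x v]; rewrite ?linearP //.
  by rewrite scaler0 addr0.
rewrite diff_single diff_tensor; have /kermodP -> := valP x.
by apply: dsumP => y; rewrite -[LHS]/(0 *: v) scale0r.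
Qed.

Lemma push_tensor K L N (g : K -> L) (k : free_on K) (v : N) :
  push N g (pure_tensor k v) = pure_tensor (push R^o g k) v.
Proof.
move: k; apply: copower_ext => [b k l|b k l|x a]; rewrite /pure_tensor ?linearP //.
by rewrite dmap_single !push_single dmap_single.
Qed.

Lemma aug_push K L (g : {linear K -> L}) (k : free_on K) :
  aug L (push R^o g k) = g (aug K k).
Proof.
move: k; apply: copower_ext => [b k l|b k l|x a]; rewrite ?linearP //.
by rewrite push_single !aug_single linearZ.
Qed.

Lemma syzygy_map_subproof K L (g : {linear K -> L}) (k : free_on K) :
  k \in kermod (aug K) -> push R^o g k \in kermod (aug L).
Proof.
move=> /kermodP k0; apply/kermodP.
by rewrite aug_push k0 raddf0.
Qed.
Definition syzygy_map K L (g : {linear K -> L}) :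
    {linear syzygy K -> syzygy L} :=
  sub_map (@syzygy_map_subproof K L g).

Fixpoint syz_map A B (f : {linear A -> B}) (n : nat) :
    {linear syz A n -> syz B n} :=
  if n is n'.+1 then syzygy_map (syz_map f n') else f.

Lemma diff_push K L N (g : {linear K -> L}) (u : copower (syzygy K) N) :
  diff L N (push N (syzygy_map g) u) = push N g (diff K N u).
Proof.
move: u; apply: copower_ext => [b k l|b k l|x v]; rewrite ?linearP //.
by rewrite push_single !diff_single push_tensor.
Qed.

Lemma diff_coef_map K N N' (h : {linear N -> N'}) (u : copower (syzygy K) N) :
  diff K N' (coef_map _ h u) = coef_map _ h (diff K N u).
Proof.
move: u; apply: copower_ext => [b k l|b k l|x v]; rewrite ?linearP //.
rewrite coef_map_single !diff_single.
apply: dsumP => y; rewrite -[LHS]/(dcoef (val x) y *: h v).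
rewrite -[RHS]/(h (dcoef (val x) y *: v)).
by rewrite linearZ.
Qed.

Lemma push_coef_map K L N N' (g : K -> L) (h : {linear N -> N'}) u :
  push N' g (coef_map _ h u) = coef_map _ h (push N g u).
Proof.
move: u; apply: copower_ext => [b k l|b k l|x v]; rewrite ?linearP //.
by rewrite coef_map_single !push_single coef_map_single.
Qed.

Section TorMapLeft.
Variables (A B N : lmodType R) (f : {linear A -> B}) (n : nat).

Lemma tor_mapl_cycles u :
  u \in cycles A N n -> push N (syz_map f n) u \in cycles B N n.
Proof.
case: n u => [|n'] u; first by move=> _; apply/pack_submodP.
move=> /kermodP u0; apply/kermodP.
by rewrite diff_push u0 raddf0.
Qed.

Lemma tor_mapl_boundaries u :
  u \in boundaries A N n -> push N (syz_map f n) u \in boundaries B N n.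
Proof.
move=> /immodP[w <-]; apply/immodP.
by exists (push N (syz_map f n.+1) w); rewrite diff_push.
Qed.

Definition tor_mapl : {linear Tor A N n -> Tor B N n} :=
  subquot_map tor_mapl_cycles tor_mapl_boundaries.
End TorMapLeft.

Section TorMapRight.
Variables (A N N' : lmodType R) (h : {linear N -> N'}) (n : nat).

Lemma tor_mapr_cycles u :
  u \in cycles A N n -> coef_map _ h u \in cycles A N' n.
Proof.
case: n u => [|n'] u; first by move=> _; apply/pack_submodP.
move=> /kermodP u0; apply/kermodP.
by rewrite diff_coef_map u0 raddf0.
Qed.

Lemma tor_mapr_boundaries u :
  u \in boundaries A N n -> coef_map _ h u \in boundaries A N' n.
Proof.
move=> /immodP[w <-]; apply/immodP.
by exists (coef_map _ h w); rewrite diff_coef_map.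
Qed.

Definition tor_mapr : {linear Tor A N n -> Tor A N' n} :=
  subquot_map tor_mapr_cycles tor_mapr_boundaries.
End TorMapRight.

Lemma tor_map_comm A B N N' (f : {linear A -> B}) (h : {linear N -> N'}) n t :
  tor_mapl N' f n (tor_mapr A h n t) = tor_mapr B h n (tor_mapl N f n t).
Proof.
rewrite -[t]quotreprK /tor_mapl /tor_mapr /subquot_map !quot_mapE.
by congr quotpi; apply: val_inj => /=; exact: push_coef_map.
Qed.

(* An element of R which kills A kills the modules Tor(A, N), because
   multiplication by it on the resolution of A is null-homotopic. *)
Section TorAnn.
Variables (A N : lmodType R) (a : R).
Hypothesis aA : forall x : A, a *: x = 0.

Definition tensor_along K (T : K -> free_on K) :
    {linear copower K N -> copower K N} :=
  dlift (fun x : K => tensor_left N (T x)).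

Lemma sub_scale_is_linear (V : lmodType R) (T : {linear V -> V}) :
  linear (fun k : V => a *: k - T k).
Proof.
move=> b k l; rewrite linearP scalerDr opprD !scalerA mulrC.
by rewrite scalerBr scalerA addrACA.
Qed.

Lemma tensor_along_single K (T : K -> free_on K) x v :
  tensor_along T (csingle (K := K) N x v) = pure_tensor (T x) v.
Proof. exact: dlift_single. Qed.

Lemma homotopy_step_subproof K (T : {linear K -> free_on K}) :
  (forall x, aug K (T x) = a *: x) ->
  forall x, csingle (K := K) R^o x a - T x \in kermod (aug K).
Proof.
move=> TE x; apply/kermodP.
by rewrite linearB TE aug_single subrr.
Qed.

Definition homotopy_step K (T : {linear K -> free_on K})
  (TE : forall x, aug K (T x) = a *: x) (x : K) : syzygy K :=
  SubmodOf (homotopy_step_subproof TE x).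

Lemma tor_homotopy n : exists T : {linear syz A n -> free_on (syz A n)},
  (forall x, aug _ (T x) = a *: x) /\
  (forall z, z \in cycles A N n -> tensor_along T z = 0).
Proof.
elim: n => [|n [T [TE Tz]]].
  exists \0; split => [x|z _]; first by rewrite raddf0 aA.
  move: z; apply: copower_ext => [b k l|b k l|x v]; rewrite ?linearP //.
    by rewrite scaler0 addr0.
  rewrite tensor_along_single; apply: dsumP => y.
  by rewrite -[LHS]/(0 *: v) scale0r.
pose s := homotopy_step TE.
have T'lin : linear (fun x : syzygy (syz A n) => push R^o s (val x)).
  by move=> b x y; rewrite !linearP.
exists (pack_linear T'lin); split => [x|z /kermodP z0].
  rewrite pack_linearE; apply: val_inj.
  have sE : val \o (aug (syzygy (syz A n)) \o push R^o s) =1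
      (fun k : free_on (syz A n) => a *: k - T (aug _ k)).
    apply: copower_ext => [b k l|b k l|y b].
    - by rewrite /comp !linearP.
    - exact: (sub_scale_is_linear (T \o aug _)).
    rewrite /comp push_single !aug_single.
    transitivity (b *: (csingle R^o y a - T y)) => //.
    have -> : T (b *: y) = b *: T y by rewrite linearZ.
    rewrite scalerBr !scale_csingle.
    by have -> : b *: (a : R^o) = a *: b by exact: mulrC.
  have /kermodP xK := valP x.
  have := sE (val x); rewrite xK raddf0 subr0 => sx.
  exact: (etrans sx (esym (submod_valZ (S := kermod _) a x))).
have <- : push N s (diff _ N z) = tensor_along (pack_linear T'lin) z.
  move: z {z0}; apply: copower_ext => [b k l|b k l|x v]; rewrite ?linearP //.
  by rewrite tensor_along_single diff_single push_tensor.
by rewrite z0 raddf0.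
Qed.

Lemma tor_ann n (t : Tor A N n) : a *: t = 0.
Proof.
rewrite -[t]quotreprK -linearZ -(raddf0 (quotpi _)); apply/quotpi_eq.
rewrite subr0 pullmodP; apply/immodP.
set z := quotrepr t.
have [T [TE Tz]] := tor_homotopy n.
exists (push N (homotopy_step TE) (val z)).
have {}Tz := Tz _ (valP z).
rewrite -[RHS]subr0 -Tz.
have sE : diff _ N \o push N (homotopy_step TE) =1
    (fun k : copower (syz A n) N => a *: k - tensor_along T k).
  apply: copower_ext => [b k l|b k l|x v].
  - by rewrite /comp !linearP.
  - exact: sub_scale_is_linear.
  rewrite /comp push_single diff_single tensor_along_single; apply: dsumP => y.
  rewrite -linearZ.
  rewrite -[LHS]/((dcoef (csingle R^o x a) y - dcoef (T x) y) *: v).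
  rewrite scalerBl; congr (_ - _).
  by rewrite -pure_tensor_single.
exact: sE.
Qed.
End TorAnn.

End FreeResolution.

Notation ideal R := (submodClosed R^o).

Section Ideals.
Variable R : comPzRingType.
Implicit Types (I J : ideal R) (M : lmodType R).

Definition ideal_mul I J : ideal R :=
  submod_span [set c : R^o | exists a b : R^o, [/\ a \in I, b \in J & c = a * b]].

Fixpoint ideal_pow I (t : nat) : ideal R :=
  if t is t'.+1 then ideal_mul I (ideal_pow I t') else fullmod R^o.

Lemma ideal_pow_sub I t : {subset ideal_pow I t.+1 <= ideal_pow I t}.
Proof.
move=> x /pack_submodP; apply=> _ /= [a [b [_ bI ->]]].
exact: (rpredZ a bI).
Qed.

Definition maximal_ideal I :=
  (1 : R^o) \notin I /\
  forall J, {subset I <= J} -> (1 : R^o) \notin J -> J =i I.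

Definition is_local I :=
  maximal_ideal I /\ forall J, maximal_ideal J -> J =i I.

Lemma annihilated_submod_prop M I :
  submod_prop [set x : M | forall a : R, a \in I -> a *: x = 0].
Proof.
split=> [a _|b u v /= uI vI a aI]; first exact: scaler0.
by rewrite scalerDr scalerA mulrC -scalerA uI // vI // scaler0 addr0.
Qed.
Definition annihilated M I := pack_submod (annihilated_submod_prop M I).

Lemma annihilatedP M I (x : M) :
  reflect (forall a : R, a \in I -> a *: x = 0) (x \in annihilated M I).
Proof. exact: pack_submodP. Qed.

Lemma annihilated_pow_sub M I t :
  {subset annihilated M (ideal_pow I t) <= annihilated M (ideal_pow I t.+1)}.
Proof.
move=> x /annihilatedP xI; apply/annihilatedP => a aI.
exact/xI/ideal_pow_sub.
Qed.

Definition annihilated_incl M I t :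
    {linear submod_of (annihilated M (ideal_pow I t)) ->
            submod_of (annihilated M (ideal_pow I t.+1))} :=
  sub_map (f := idfun) (@annihilated_pow_sub M I t).

Section QuotientRing.
Variable J : ideal R.

Definition quoring : Type := quotmod J.
HB.instance Definition _ := GRing.Lmodule.on quoring.

Definition quoring_pi (a : R) : quoring := quotpi J a.
Definition quoring_repr (x : quoring) : R := quotrepr x.
Definition quoring_mul (x y : quoring) : quoring :=
  quoring_pi (quoring_repr x * quoring_repr y).

Lemma quoring_reprK x : quoring_pi (quoring_repr x) = x.
Proof. exact: quotreprK. Qed.

Lemma quoring_piD a b : quoring_pi (a + b) = quoring_pi a + quoring_pi b.
Proof. exact: quotpiD. Qed.

Lemma quoring_mulE a b :
  quoring_mul (quoring_pi a) (quoring_pi b) = quoring_pi (a * b).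
Proof.
apply/quotpi_eq; set a' := quoring_repr _; set b' := quoring_repr _.
have aJ : (a' - a : R^o) \in J by apply/quotpi_eq; exact: quotreprK.
have bJ : (b' - b : R^o) \in J by apply/quotpi_eq; exact: quotreprK.
have -> : (a' * b' - a * b : R^o) = b' *: (a' - a : R^o) + a *: (b' - b : R^o).
  by rewrite /GRing.scale /= !mulrBr addrA [b' * a']mulrC [b' * a]mulrC subrK.
by rewrite rpredD // rpredZ.
Qed.

Lemma quoring_mulA : associative quoring_mul.
Proof.
move=> x y z; rewrite -[x]quoring_reprK -[y]quoring_reprK -[z]quoring_reprK.
by rewrite !quoring_mulE mulrA.
Qed.
Lemma quoring_mulC : commutative quoring_mul.
Proof. by move=> x y; rewrite /quoring_mul mulrC. Qed.
Lemma quoring_mul1 : left_id (quoring_pi 1) quoring_mul.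
Proof. by move=> x; rewrite -[x]quoring_reprK quoring_mulE mul1r. Qed.
Lemma quoring_mulDl : left_distributive quoring_mul +%R.
Proof.
move=> x y z; rewrite -[x]quoring_reprK -[y]quoring_reprK -[z]quoring_reprK.
by rewrite -quoring_piD !quoring_mulE -quoring_piD mulrDl.
Qed.
HB.instance Definition _ := GRing.Zmodule_isComPzRing.Build quoring
  quoring_mulA quoring_mulC quoring_mul1 quoring_mulDl.

Lemma quoring_piM a b : quoring_pi (a * b) = quoring_pi a * quoring_pi b.
Proof. by rewrite -quoring_mulE. Qed.

Lemma quoring_ann (a : R) (x : quoring) : (a : R^o) \in J -> a *: x = 0.
Proof.
move=> aJ; rewrite -[x]quotreprK -linearZ -(raddf0 (quotpi J)).
apply/quotpi_eq; rewrite subr0 (_ : a *: _ = quotrepr x *: (a : R^o)) ?rpredZ //.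
exact: mulrC.
Qed.
End QuotientRing.

Definition quoring_proj I J (IJ : {subset I <= J}) :
    {linear quoring I -> quoring J} :=
  quot_map (f := idfun) IJ.

Lemma quoring_projE I J (IJ : {subset I <= J}) a :
  quoring_proj IJ (quoring_pi I a) = quoring_pi J a.
Proof. exact: quot_mapE. Qed.

Lemma quoring_projM I J (IJ : {subset I <= J}) :
  {morph quoring_proj IJ : x y / x * y}.
Proof.
move=> x y; rewrite -[x]quoring_reprK -[y]quoring_reprK -quoring_piM.
by rewrite !quoring_projE quoring_piM.
Qed.
End Ideals.

Section InverseLimit.
Variables (R : pzRingType) (T : nat -> lmodType R).
Variable f : forall s, {linear T s.+1 -> T s}.

Lemma invlim_submod_prop :
  submod_prop [set x : dprod T | forall s, f s (x s.+1) = x s].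
Proof.
split=> [s|a u v /= uP vP s]; first exact: raddf0.
by rewrite -[LHS]/(f s (a *: u s.+1 + v s.+1)) linearP uP vP.
Qed.
Definition invlim := submod_of (pack_submod invlim_submod_prop).
HB.instance Definition _ := GRing.Lmodule.on invlim.

Definition invlim_coord (x : invlim) (s : nat) : T s := val x s.

Lemma invlim_coordP (x : invlim) s :
  f s (invlim_coord x s.+1) = invlim_coord x s.
Proof. by have /pack_submodP := valP x; exact. Qed.

Lemma invlim_mk_subproof (x : dprod T) :
  (forall s, f s (x s.+1) = x s) -> x \in pack_submod invlim_submod_prop.
Proof. by move=> xP; apply/pack_submodP. Qed.
Definition invlim_mk (x : dprod T) (xP : forall s, f s (x s.+1) = x s) :
  invlim := SubmodOf (invlim_mk_subproof xP).

Lemma invlimP (x y : invlim) :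
  (forall s, invlim_coord x s = invlim_coord y s) -> x = y.
Proof.
by move=> xy; apply: val_inj; apply: functional_extensionality_dep => s;
  exact: xy.
Qed.
End InverseLimit.

Section DirectLimit.
Variables (R : pzRingType) (D : nat -> lmodType R).
Variable f : forall t, {linear D t -> D t.+1}.

Definition dirlim : lmodType R :=
  quotmod (submod_span [set z : dsum D | exists t (x : D t),
    z = dsingle D t x - dsingle D t.+1 (f t x)]).
End DirectLimit.

Section Completion.
Variables (R : comPzRingType) (m : ideal R).

Definition adic_proj s :
    {linear quoring (ideal_pow m s.+1) -> quoring (ideal_pow m s)} :=
  quoring_proj (@ideal_pow_sub R m s).

Definition completion : Type :=
  invlim (T := fun s => quoring (ideal_pow m s)) adic_proj.
HB.instance Definition _ := GRing.Zmodule.on completion.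

Definition ccoord (x : completion) s : quoring (ideal_pow m s) :=
  invlim_coord x s.

Lemma ccoordP x s : adic_proj s (ccoord x s.+1) = ccoord x s.
Proof. exact: invlim_coordP. Qed.

Lemma completion_of_subproof (a : R) s :
  adic_proj s (quoring_pi (ideal_pow m s.+1) a) = quoring_pi (ideal_pow m s) a.
Proof. exact: quoring_projE. Qed.
Definition completion_of (a : R) : completion :=
  invlim_mk (completion_of_subproof a).

Lemma completion_mul_subproof (x y : completion) s :
  adic_proj s (ccoord x s.+1 * ccoord y s.+1) = ccoord x s * ccoord y s.
Proof. by rewrite [LHS]quoring_projM !ccoordP. Qed.
Definition completion_mul (x y : completion) : completion :=
  invlim_mk (completion_mul_subproof x y).

Lemma completionP (x y : completion) : (forall s, ccoord x s = ccoord y s) -> x = y.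
Proof. exact: invlimP. Qed.

Lemma completion_mulA : associative completion_mul.
Proof. by move=> x y z; apply: completionP => s; exact: mulrA. Qed.
Lemma completion_mulC : commutative completion_mul.
Proof. by move=> x y; apply: completionP => s; exact: mulrC. Qed.
Lemma completion_mul1 : left_id (completion_of 1) completion_mul.
Proof. by move=> x; apply: completionP => s; exact: mul1r. Qed.
Lemma completion_mulDl : left_distributive completion_mul +%R.
Proof. by move=> x y z; apply: completionP => s; exact: mulrDl. Qed.
HB.instance Definition _ := GRing.Zmodule_isComPzRing.Build completion
  completion_mulA completion_mulC completion_mul1 completion_mulDl.

Section LocalHomology.
Variables (N : lmodType R) (i : nat).

Definition adic_tor s : lmodType R := Tor (quoring (ideal_pow m s)) N i.
Definition adic_tor_proj s : {linear adic_tor s.+1 -> adic_tor s} :=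
  tor_mapl N (adic_proj s) i.

Lemma adic_tor_ann s (a : R) (t : adic_tor s) :
  (a : R^o) \in ideal_pow m s -> a *: t = 0.
Proof. by move=> am; apply: tor_ann => x; exact: quoring_ann. Qed.

Lemma adic_tor_eq s (a b : R) (t : adic_tor s) :
  quoring_pi (ideal_pow m s) a = quoring_pi (ideal_pow m s) b -> a *: t = b *: t.
Proof.
move=> /quotpi_eq ab; apply/eqP; rewrite -subr_eq0 -scalerBl; apply/eqP.
exact: adic_tor_ann.
Qed.

Definition local_homology : Type := invlim adic_tor_proj.
HB.instance Definition _ := GRing.Zmodule.on local_homology.

Definition lcoord (x : local_homology) s : adic_tor s := invlim_coord x s.

Lemma lcoordP x s : adic_tor_proj s (lcoord x s.+1) = lcoord x s.
Proof. exact: invlim_coordP. Qed.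

Lemma local_homologyP (x y : local_homology) :
  (forall s, lcoord x s = lcoord y s) -> x = y.
Proof. exact: invlimP. Qed.

(* The element r of the completion acts on the s-th component, which is
   annihilated by m^s, through any representative in R of the class of r
   modulo m^s. *)
Lemma local_homology_scale_subproof (r : completion) (x : local_homology) s :
  adic_tor_proj s (quoring_repr (ccoord r s.+1) *: lcoord x s.+1) =
  quoring_repr (ccoord r s) *: lcoord x s.
Proof.
rewrite linearZ lcoordP; apply: adic_tor_eq.
rewrite quoring_reprK -[ccoord r s]ccoordP.
by rewrite -[X in adic_proj s X]quoring_reprK [RHS]quoring_projE.
Qed.
Definition local_homology_scale (r : completion) (x : local_homology) :
  local_homology := invlim_mk (local_homology_scale_subproof r x).

Lemma local_homology_scaleE (a : R) r x s :
  quoring_pi (ideal_pow m s) a = ccoord r s ->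
  lcoord (local_homology_scale r x) s = a *: lcoord x s.
Proof. by move=> ar; apply: adic_tor_eq; rewrite quoring_reprK. Qed.

Lemma local_homology_scaleA a b x :
  local_homology_scale a (local_homology_scale b x) =
  local_homology_scale (a * b) x.
Proof.
apply: local_homologyP => s.
by rewrite [RHS](@local_homology_scaleE
  (quoring_repr (ccoord a s) * quoring_repr (ccoord b s))) -?scalerA //.
Qed.

Lemma local_homology_scale1 : left_id 1 local_homology_scale.
Proof.
move=> x; apply: local_homologyP => s.
by rewrite (@local_homology_scaleE 1) // scale1r.
Qed.

Lemma local_homology_scaleDr : right_distributive local_homology_scale +%R.
Proof. by move=> a x y; apply: local_homologyP => s; exact: scalerDr. Qed.

Lemma local_homology_scaleDl x :
  {morph local_homology_scale^~ x : a b / a + b}.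
Proof.
move=> a b; apply: local_homologyP => s.
rewrite (@local_homology_scaleE
  (quoring_repr (ccoord a s) + quoring_repr (ccoord b s))) ?scalerDl //.
by rewrite quoring_piD !quoring_reprK.
Qed.

HB.instance Definition _ := GRing.Zmodule_isLmodule.Build completion
  local_homology local_homology_scaleA local_homology_scale1
  local_homology_scaleDr local_homology_scaleDl.
End LocalHomology.

Section LocalHomologyMap.
Variables (N N' : lmodType R) (h : {linear N -> N'}) (i : nat).

Lemma local_homology_map_subproof (x : local_homology N i) s :
  adic_tor_proj N' i s (tor_mapr _ h i (lcoord x s.+1)) =
  tor_mapr _ h i (lcoord x s).
Proof.
by rewrite [LHS]tor_map_comm lcoordP.
Qed.
Definition local_homology_map_fun (x : local_homology N i) :
  local_homology N' i := invlim_mk (local_homology_map_subproof x).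

Lemma local_homology_map_is_linear : linear local_homology_map_fun.
Proof.
move=> r x y; apply: local_homologyP => s.
exact: (linearP (tor_mapr _ h i)).
Qed.
Definition local_homology_map :
    {linear local_homology N i -> local_homology N' i} :=
  pack_linear local_homology_map_is_linear.
End LocalHomologyMap.

Definition formal_local_homology (I : ideal R) (M : lmodType R) (i : nat) :
    lmodType completion :=
  dirlim (fun t => local_homology_map (annihilated_incl M I t) i).

Definition ideal_smul (I : ideal R) (V : lmodType completion) :
    submodClosed V :=
  submod_span [set y : V | exists (a : R) (x : V),
    (a : R^o) \in I /\ y = completion_of a *: x].
End Completion.

(* Main.v *)
From mathcomp Require Import all_boot all_order all_algebra.
From mathcomp Require Import boolp classical_sets cardinality.
Require Import Defs.

Set Implicit Arguments.
Unset Strict Implicit.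
Unset Printing Implicit Defensive.

Import GRing.Theory.
Local Open Scope classical_set_scope.
Local Open Scope ring_scope.

(* Let H_i be the local homology modules, F_i their formal versions, and let
   a_1, ..., a_r generate I. The map (x_j) |-> sum_j a_j x_j gives short exact sequences
     0 -> K -> M^r -> IM -> 0   and   0 -> IM -> M -> M/IM -> 0.
   As I kills M/IM, F_i(M/IM) = H_i(M/IM), which is noetherian, so it suffices that the
   cokernel A of F_s(M^r) -> F_s(IM) is noetherian. It embeds in F_(s-1)(K), is killed
   by I, and the quotient of F_(s-1)(K) by A embeds in F_(s-1)(M^r), which is noetherian.
   Since F_(s-1)(K)/I F_(s-1)(K) is noetherian by induction on s, so is A: the
   intersection of A with I F_(s-1)(K) is a quotient of a submodule of a power of
   F_(s-1)(K)/A.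

   The long exact sequence of F needs the inverse limits to be exact, which is
   Mittag-Leffler for artinian modules (Tor_i(R/m^t, N) is artinian when N is), and the
   dual Artin-Rees property of the submodules 0 :_N I^t, which follows from Fitting's
   decomposition X = y^n X + (0 :_X y^n).

   That H_i(N) is noetherian over the completion for N artinian is proved without
   Matlis duality or noetherianity of the completion. By Fitting, N is filtered by
   modules on which a generator y of m acts surjectively and by modules killed by m. In
   the first case H_i(N)/y H_i(N) embeds in H_(i-1)(0 :_N y), and a y-adically separated
   module over the completion is noetherian as soon as its quotient by y is (Hilbert's
   basis argument for power series). In the second case N is noetherian, so H_i(N) = 0
   for i > 0 by dimension shifting and Artin-Rees. *)


(** * Noetherian and artinian modules *)

Section LinearRelation.
Variables (R : pzRingType) (U V : lmodType R) (D : U -> V -> Prop).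
Hypothesis D_total : forall u, exists v, D u v.
Hypothesis D_lin : forall a u v u' v', D u v -> D u' v' ->
  D (a *: u + u') (a *: v + v').
Hypothesis D_fun0 : forall v, D 0 v -> v = 0.

Lemma linear_rel_uniq u v v' : D u v -> D u v' -> v = v'.
Proof.
move=> uv uv'; apply/eqP; rewrite -subr_eq0; apply/eqP/D_fun0.
by have := D_lin (-1) uv' uv; rewrite !scaleN1r addNr addrC.
Qed.

(** Diagram chases give connecting maps only as relations. Any choice of values is linear, because
    [D] is closed under linear combinations and [D_fun0] makes it single-valued. *)
Lemma linear_of_rel : exists f : {linear U -> V}, forall u, D u (f u).
Proof.
have [f fD] := choice D_total.
suff fL : linear f by exists (pack_linear fL).
by move=> a u v; apply: linear_rel_uniq (fD _) _; exact: D_lin.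
Qed.
End LinearRelation.

Section Submodules.
Variable R : pzRingType.
Implicit Types U V W : lmodType R.

Lemma image_submod_prop U V (f : {linear U -> V}) (S : submodClosed U) :
  submod_prop [set y | exists2 x, x \in S & f x = y].
Proof.
split; first by exists 0; rewrite ?rpred0 ?raddf0.
move=> a _ _ [x xS <-] [y yS <-]; exists (a *: x + y); last exact: linearP.
by rewrite rpredD ?rpredZ.
Qed.
Definition imagemod U V (f : {linear U -> V}) (S : submodClosed U) :=
  pack_submod (image_submod_prop f S).

Lemma imagemodP U V (f : {linear U -> V}) (S : submodClosed U) y :
  reflect (exists2 x, x \in S & f x = y) (y \in imagemod f S).
Proof. exact: pack_submodP. Qed.

Lemma preimage_submod_prop U V (f : {linear U -> V}) (T : submodClosed V) :
  submod_prop [set x | f x \in T].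
Proof.
split=> [|a u v /= uT vT]; first by rewrite /= raddf0 rpred0.
by rewrite linearP rpredD ?rpredZ.
Qed.
Definition premod U V (f : {linear U -> V}) (T : submodClosed V) :=
  pack_submod (preimage_submod_prop f T).

Lemma premodE U V (f : {linear U -> V}) (T : submodClosed V) x :
  (x \in premod f T) = (f x \in T).
Proof. by apply/pack_submodP/idP. Qed.

Lemma add_submod_prop V (S T : submodClosed V) :
  submod_prop [set z | exists x y, [/\ x \in S, y \in T & x + y = z]].
Proof.
split; first by exists 0, 0; rewrite !rpred0 addr0.
move=> a _ _ [x [y [xS yT <-]]] [x' [y' [xS' yT' <-]]].
exists (a *: x + x'), (a *: y + y').
by rewrite scalerDr addrACA !rpredD ?rpredZ.
Qed.
Definition addmod V (S T : submodClosed V) := pack_submod (add_submod_prop S T).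

Lemma addmodP V (S T : submodClosed V) z :
  reflect (exists x y, [/\ x \in S, y \in T & x + y = z]) (z \in addmod S T).
Proof. exact: pack_submodP. Qed.

Lemma addmodl V (S T : submodClosed V) x : x \in S -> x \in addmod S T.
Proof. by move=> xS; apply/addmodP; exists x, 0; rewrite rpred0 addr0. Qed.

Lemma addmodr V (S T : submodClosed V) x : x \in T -> x \in addmod S T.
Proof. by move=> xS; apply/addmodP; exists 0, x; rewrite rpred0 add0r. Qed.

Lemma cap_submod_prop V (S T : submodClosed V) :
  submod_prop [set z | z \in S /\ z \in T].
Proof.
split; first by rewrite /= !rpred0.
by move=> a u v [uS uT] [vS vT]; rewrite /= !rpredD ?rpredZ.
Qed.
Definition capmod V (S T : submodClosed V) := pack_submod (cap_submod_prop S T).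

Lemma capmodP V (S T : submodClosed V) z :
  reflect (z \in S /\ z \in T) (z \in capmod S T).
Proof. exact: pack_submodP. Qed.

Lemma mem_span V (A : set V) x : A x -> x \in submod_span A.
Proof. by move=> Ax; apply/pack_submodP => S; exact. Qed.

Lemma span_sub V (A : set V) (S : submodClosed V) :
  (forall x, A x -> x \in S) -> {subset submod_span A <= S}.
Proof. by move=> AS x /pack_submodP; apply. Qed.

Definition spanl V (l : seq V) := submod_span [set x | x \in l].

Lemma spanl_cons V (x : V) l z :
  z \in spanl (x :: l) -> exists a y, y \in spanl l /\ z = a *: x + y.
Proof.
pose P := [set z : V | exists a y, y \in spanl l /\ z = a *: x + y].
have PP : submod_prop P.
  split; first by exists 0, 0; rewrite rpred0 scale0r addr0.
  move=> a _ _ [b [y [yl ->]]] [c [y' [yl' ->]]].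
  exists (a * b + c), (a *: y + y'); rewrite rpredD ?rpredZ //; split=> //.
  by rewrite scalerDr scalerA scalerDl addrACA.
suff sub : {subset spanl (x :: l) <= pack_submod PP}.
  by move/sub/pack_submodP.
apply: span_sub => {}z zl; apply/(pack_submodP PP).
have {zl} : z \in x :: l by []; rewrite in_cons => /predU1P[->|zl].
  by exists 1, 0; rewrite rpred0 scale1r addr0.
by exists 0, z; rewrite scale0r add0r; split => //; exact: mem_span.
Qed.

Lemma spanl_sum V (l : seq V) z : z \in spanl l ->
  exists c : nat -> R, z = \sum_(j < size l) c j *: l`_j.
Proof.
elim: l z => [|x l IHl] z.
  move=> zn; exists (fun=> 0); rewrite big_ord0.
  have : z \in kermod (idfun : {linear V -> V}).
    by move: z zn; apply: span_sub.
  by move/kermodP.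
case/spanl_cons => a [y [/IHl[c ->] ->]].
exists (fun j => if j is j'.+1 then c j' else a).
by rewrite /= big_ord_recl.
Qed.

Lemma chain_le V (S : nat -> submodClosed V) :
  (forall n, {subset S n <= S n.+1}) ->
  forall n k, (n <= k)%N -> {subset S n <= S k}.
Proof.
move=> SS n k nk x; rewrite -(subnKC nk).
by elim: (k - n)%N => [|j IH] xS; rewrite ?addn0 // addnS; exact/SS/IH.
Qed.

Lemma chain_ge V (S : nat -> submodClosed V) :
  (forall n, {subset S n.+1 <= S n}) ->
  forall n k, (n <= k)%N -> {subset S k <= S n}.
Proof.
move=> SS n k nk x; rewrite -(subnKC nk).
by elim: (k - n)%N => [|j IH]; rewrite ?addn0 // addnS => /SS/IH.
Qed.

(** The common core of both chain conditions for extensions: an element of [B] is corrected by an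
    element of [A] with the same image in [W], and the difference comes from [U]. *)
Lemma exact_sub U V W (f : {linear U -> V}) (g : {linear V -> W})
    (A B : submodClosed V) :
  (forall v, g v = 0 -> exists u, f u = v) ->
  {subset A <= B} -> (forall u, f u \in B -> f u \in A) ->
  (forall b, b \in B -> exists2 a, a \in A & g a = g b) ->
  {subset B <= A}.
Proof.
move=> ex AB fBA gBA b bB; have [a aA gab] := gBA b bB.
have [u fu] : exists u, f u = b - a by apply: ex; rewrite linearB gab subrr.
have fuB : f u \in B by rewrite fu -scaleN1r rpredD // rpredZ // AB.
by rewrite -(subrK a b) -fu rpredD // fBA.
Qed.

(** Encodes that V/T is noetherian through chains of V above T, which spares computing in quotients;
    [noeth_mod_quot] and [quot_noeth_mod] give the equivalence. *)
Definition noeth_mod V (T : submodClosed V) :=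
  forall S : nat -> submodClosed V,
    (forall n, {subset S n <= S n.+1}) -> {subset T <= S 0%N} ->
    exists n, forall k, (n <= k)%N -> {subset S k <= S n}.

Lemma noetherian_noeth_mod V (T : submodClosed V) : noetherian V -> noeth_mod T.
Proof.
move=> nV S SS _; have [n Sn] := nV S SS.
by exists n => k /Sn Sk x; rewrite Sk.
Qed.

Lemma noeth_mod_sub V (T T' : submodClosed V) :
  {subset T <= T'} -> noeth_mod T -> noeth_mod T'.
Proof. by move=> TT nT S SS TS; apply: nT => // x /TT/TS. Qed.

Lemma noeth_modW V (T : submodClosed V) :
  noeth_mod T -> (forall x, x \in T -> x = 0) -> noetherian V.
Proof.
move=> nT T0 S SS; have [x /T0 ->|n nS] := nT S SS; first exact: rpred0.
exists n => k nk x; apply/idP/idP; first exact: nS.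
exact: (chain_le SS).
Qed.

(** A chain above [T] pulls back along [f] to a chain above [T'] and pushes forward to a chain in
    [W]; once both have stopped, [exact_sub] applies. *)
Lemma exact_noeth_mod U V W (f : {linear U -> V}) (g : {linear V -> W})
    (T' : submodClosed U) (T : submodClosed V) :
  (forall v, g v = 0 -> exists u, f u = v) ->
  noeth_mod T' -> noetherian W -> (forall u, u \in T' -> f u \in T) ->
  noeth_mod T.
Proof.
move=> ex nU nW fT S SS TS.
have [n1 S1] : exists n, forall k, (n <= k)%N ->
    {subset premod f (S k) <= premod f (S n)}.
  apply: nU => [n x|x /fT/TS]; rewrite !premodE //; exact: SS.
have [n2 S2] : exists n, forall k, (n <= k)%N ->
    imagemod g (S k) =i imagemod g (S n).
  apply: nW => n _ /imagemodP[x xS <-]; apply/imagemodP.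
  by exists x => //; exact: SS.
exists (maxn n1 n2) => k; rewrite geq_max => /andP[n1k n2k].
have le1 := leq_maxl n1 n2; have le2 := leq_maxr n1 n2.
case: (leqP (maxn n1 n2) k) => [nk|/ltnW kn]; last first.
  exact: (chain_le SS).
apply: (exact_sub ex (chain_le SS nk)) => [u uk|b bk].
  have /S1 : u \in premod f (S k) by rewrite premodE.
  by rewrite premodE => /(_ n1k); exact: (chain_le SS).
have /imagemodP[x xS xb] : g b \in imagemod g (S n2).
  by rewrite -(S2 _ n2k); apply/imagemodP; exists b.
by exists x => //; exact: (chain_le SS le2).
Qed.

Lemma exact_noetherian U V W (f : {linear U -> V}) (g : {linear V -> W}) :
  (forall v, g v = 0 -> exists u, f u = v) ->
  noetherian U -> noetherian W -> noetherian V.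
Proof.
move=> ex nU nW.
apply: (@noeth_modW _ (kermod (idfun : {linear V -> V}))); last first.
  by move=> x /kermodP.
apply: (exact_noeth_mod (T' := kermod f) ex) => //.
exact: noetherian_noeth_mod.
Qed.

Lemma surj_noetherian U V (f : {linear U -> V}) :
  (forall v, exists u, f u = v) -> noetherian U -> noetherian V.
Proof.
move=> fs nU S SS; have [|n nS] := nU (fun n => premod f (S n)).
  by move=> n x; rewrite !premodE; exact: SS.
by exists n => k /nS kS v; have [u <-] := fs v; rewrite -!premodE.
Qed.

Lemma inj_noetherian U V (f : {linear U -> V}) :
  (forall u, f u = 0 -> u = 0) -> noetherian V -> noetherian U.
Proof.
move=> fi nV S SS; have [|n nS] := nV (fun n => imagemod f (S n)).
  by move=> n _ /imagemodP[x xS <-]; apply/imagemodP; exists x => //; exact: SS.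
exists n => k nk x; apply/idP/idP => [xk|]; last exact: (chain_le SS).
have /imagemodP[y yS fyx] : f x \in imagemod f (S n).
  by rewrite -(nS k) //; apply/imagemodP; exists x.
by rewrite -(subrK y x) (fi (x - y)) ?add0r // linearB fyx subrr.
Qed.

Lemma quotpi0 V (T : submodClosed V) x : x \in T -> quotpi T x = 0.
Proof.
by move=> xT; rewrite -(raddf0 (quotpi T)); apply/quotpi_eq; rewrite subr0.
Qed.

Lemma noeth_mod_quot V (T : submodClosed V) :
  noeth_mod T -> noetherian (quotmod T).
Proof.
move=> nT S SS; have [||n nS] := nT (fun n => premod (quotpi T) (S n)).
- by move=> n x; rewrite !premodE; exact: SS.
- move=> x xT; rewrite premodE -[X in X \in _]/(quotpi T x).
  by rewrite (quotpi0 xT) rpred0.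
exists n => k nk v; apply/idP/idP; last exact: (chain_le SS).
by rewrite -(quotreprK v) -!premodE; exact: nS.
Qed.

Lemma quot_noeth_mod V (T : submodClosed V) :
  noetherian (quotmod T) -> noeth_mod T.
Proof.
move=> nT S SS TS; have [|n nS] := nT (fun n => imagemod (quotpi T) (S n)).
  by move=> n _ /imagemodP[x xS <-]; apply/imagemodP; exists x => //; exact: SS.
exists n => k nk x xk.
have /imagemodP[y yS /quotpi_eq yx] : quotpi T x \in imagemod (quotpi T) (S n).
  by rewrite -(nS k) //; apply/imagemodP; exists x.
rewrite -(subKr y x) -scaleN1r rpredD // rpredZ //.
exact: (chain_le SS (leq0n n)) _ (TS _ yx).
Qed.

Lemma exact_artinian U V W (f : {linear U -> V}) (g : {linear V -> W}) :
  (forall v, g v = 0 -> exists u, f u = v) ->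
  artinian U -> artinian W -> artinian V.
Proof.
move=> ex aU aW S SS.
have [|n1 S1] := aU (fun n => premod f (S n)).
  by move=> n x; rewrite !premodE; exact: SS.
have [|n2 S2] := aW (fun n => imagemod g (S n)).
  by move=> n _ /imagemodP[x xS <-]; apply/imagemodP; exists x => //; exact: SS.
have le1 := leq_maxl n1 n2; have le2 := leq_maxr n1 n2.
exists (maxn n1 n2) => k nk x; apply/idP/idP; first exact: (chain_ge SS).
move: x; apply: (exact_sub ex (chain_ge SS nk)) => [u uk|b bk].
  rewrite -premodE (S1 k) ?(leq_trans le1 nk) // premodE.
  exact: (chain_ge SS le1).
have /imagemodP[x xS xb] : g b \in imagemod g (S k).
  rewrite (S2 k) ?(leq_trans le2 nk) //; apply/imagemodP; exists b => //.
  exact: (chain_ge SS le2).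
by exists x.
Qed.

Lemma surj_artinian U V (f : {linear U -> V}) :
  (forall v, exists u, f u = v) -> artinian U -> artinian V.
Proof.
move=> fs nU S SS; have [|n nS] := nU (fun n => premod f (S n)).
  by move=> n x; rewrite !premodE; exact: SS.
by exists n => k /nS kS v; have [u <-] := fs v; rewrite -!premodE.
Qed.

Lemma inj_artinian U V (f : {linear U -> V}) :
  (forall u, f u = 0 -> u = 0) -> artinian V -> artinian U.
Proof.
move=> fi nV S SS; have [|n nS] := nV (fun n => imagemod f (S n)).
  by move=> n _ /imagemodP[x xS <-]; apply/imagemodP; exists x => //; exact: SS.
exists n => k nk x; apply/idP/idP => [|xk]; first exact: (chain_ge SS).
have /imagemodP[y yS fyx] : f x \in imagemod f (S k).
  by rewrite (nS k) //; apply/imagemodP; exists x.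
by rewrite -(subrK y x) (fi (x - y)) ?add0r // linearB fyx subrr.
Qed.

Lemma sub_artinian V (S : submodClosed V) :
  artinian V -> artinian (submod_of S).
Proof.
apply: (inj_artinian (f := val : {linear submod_of S -> V})) => u u0.
exact: val_inj.
Qed.

Lemma quot_noetherian V (S : submodClosed V) :
  noetherian V -> noetherian (quotmod S).
Proof.
apply: (surj_noetherian (f := quotpi S)) => v.
by exists (quotrepr v); exact: quotreprK.
Qed.

Lemma quot_artinian V (S : submodClosed V) :
  artinian V -> artinian (quotmod S).
Proof.
apply: (surj_artinian (f := quotpi S)) => v.
by exists (quotrepr v); exact: quotreprK.
Qed.

Lemma noetherian_fg V (S : submodClosed V) : noetherian V ->
  exists2 l : seq V, {subset l <= S} & S =i spanl l.
Proof.
move=> nV; apply: contrapT => no.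
have /choice[c cP] : forall l : seq V, exists x : V, {subset l <= S} ->
    x \in S /\ x \notin spanl l.
  move=> l; apply: contrapT => nol; apply: no; exists l => [|x].
    by apply: contrapT => lS; apply: nol; exists 0.
  apply/idP/idP => [xS|]; last first.
    apply: span_sub => {}x; apply: contrapT => xl; apply: nol.
    by exists 0 => lS; case: xl; exact: lS.
  apply/negPn/negP => xl; apply: nol; exists x => _; split=> //.
pose fix L n := if n is n'.+1 then c (L n') :: L n' else [::].
have LS n : {subset L n <= S}.
  elim: n => [|n IH] x //=; rewrite in_cons => /predU1P[->|/IH//].
  by have [] := cP _ IH.
have LL n : {subset spanl (L n) <= spanl (L n.+1)}.
  by apply: span_sub => x xL; apply: mem_span; rewrite /= in_cons xL orbT.
have [n nS] := nV (fun n => spanl (L n)) LL.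
have [_ /negP[]] := cP _ (LS n).
by rewrite -(nS n.+1) //; apply: mem_span; rewrite /= mem_head.
Qed.

Lemma noetherian_max V (P : submodClosed V -> Prop) S0 : noetherian V -> P S0 ->
  exists2 S, P S & forall S', P S' -> {subset S <= S'} -> {subset S' <= S}.
Proof.
move=> nV P0; apply: contrapT => no.
have /choice[c cP] : forall S, exists S', P S ->
    [/\ P S', {subset S <= S'} & ~ {subset S' <= S}].
  move=> S; apply: contrapT => noS; have PS : P S.
    by apply: contrapT => nP; apply: noS; exists S.
  apply: no; exists S => // S' PS' SS'; apply: contrapT => nS'.
  by apply: noS; exists S'.
pose L n := iter n c S0.
have PL n : P (L n) by elim: n => //= n IH; have [] := cP _ IH.
have [|n nS] := nV L; first by move=> n; have [] := cP _ (PL n).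
by have [_ _] := cP _ (PL n); apply=> x; rewrite -(nS n.+1).
Qed.

End Submodules.

(** * Fitting decompositions and Artin-Rees *)

Section CommutativeAlgebra.
Variable R : comPzRingType.
Implicit Types (I J : ideal R) (V : lmodType R).

Lemma scalar_is_linear V (a : R) : linear (fun v : V => a *: v).
Proof. by move=> b u v; rewrite scalerDr !scalerA mulrC. Qed.
Definition scalar V (a : R) : {linear V -> V} :=
  pack_linear (@scalar_is_linear V a).

(** The chain of the x^n V stops, so x^n V = x^(2n) V. Writing v = (v - x^n w) + x^n w gives V = (0
    :_V x^n) + x^n V; the bound [t] lets n be taken large. *)
Lemma fitting V (x : R) t : artinian V -> exists2 n, (t <= n)%N &
  forall v : V, exists w, x ^+ n *: v = x ^+ n *: (x ^+ n *: w).
Proof.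
move=> aV; have [|n nS] := aV (fun n => immod (scalar V (x ^+ n))).
  move=> n _ /immodP[v <-]; apply/immodP; exists (x *: v).
  by rewrite !pack_linearE scalerA exprSr.
exists (maxn n t) => [|v]; first exact: leq_maxr.
set k := maxn n t; have nk : (n <= k)%N := leq_maxl n t.
have : scalar V (x ^+ k) v \in immod (scalar V (x ^+ (k + k))).
  rewrite (nS _ (leq_trans nk (leq_addl _ _))) -(nS _ nk).
  by apply/immodP; exists v.
by move=> /immodP[w]; rewrite !pack_linearE exprD -scalerA => <-; exists w.
Qed.

Lemma ideal_pow_le I s t : (s <= t)%N -> {subset ideal_pow I t <= ideal_pow I s}.
Proof. exact: (chain_ge (@ideal_pow_sub R I)). Qed.

Lemma ideal_pow_sub1 I t : {subset ideal_pow I t.+1 <= I}.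
Proof.
apply: span_sub => _ [a [b [aI bI ->]]]; rewrite mulrC.
exact: (rpredZ b aI).
Qed.

Lemma ideal_pow_mul I t (a b : R^o) :
  a \in I -> b \in ideal_pow I t -> (a * b : R^o) \in ideal_pow I t.+1.
Proof. by move=> aI bI; apply: mem_span; exists a, b. Qed.

Lemma ideal_pow_exp I (a : R^o) t :
  a \in I -> (a ^+ t : R^o) \in ideal_pow I t.
Proof.
move=> aI; elim: t => [|t IH]; first exact/pack_submodP.
by rewrite exprS ideal_pow_mul.
Qed.

(** Pigeonhole: a product of N + 1 generators contains some generator x at least n(x) times. The
    induction removes one factor x, replacing [J] by the colon ideal (J : x) and lowering n(x) by
    one. *)
Lemma ideal_pow_nil_sub (l : seq R^o) I J N (n : R -> nat) :
  {subset I <= spanl l} -> (\sum_(x <- l) n x <= N)%N ->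
  (forall x : R^o, x \in l -> (x ^+ n x : R^o) \in J) ->
  {subset ideal_pow I N.+1 <= J}.
Proof.
move=> Il; elim: N J n => [|N IH] J n nN nJ; apply: span_sub => _ [a [b [aI bI ->]]].
  suff /(_ a (Il a aI)) : {subset spanl l <= premod (scalar R^o b) J}.
    by rewrite premodE pack_linearE [_ *: _]mulrC.
  apply: span_sub => x xl; rewrite premodE pack_linearE.
  suff J1 : (1 : R^o) \in J by rewrite -[b *: _]mulr1 (rpredZ (b * x) J1).
  move: (nJ x xl) nN; rewrite (big_rem x) //= leqn0 addn_eq0.
  by case: (n x).
suff /(_ a (Il a aI)) : {subset spanl l <= premod (scalar R^o b) J}.
  by rewrite premodE pack_linearE [_ *: _]mulrC.
apply: span_sub => x xl; rewrite premodE pack_linearE.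
case nx : (n x) => [|k].
  have := nJ x xl; rewrite nx => J1.
  by rewrite -[b *: _]mulr1 (rpredZ (b * x) J1).
pose n' y := if y == x then k else n y.
have {}bI : b \in premod (scalar R^o x) J.
  apply: (IH (premod (scalar R^o x) J) n') bI => [|y yl].
    move: nN; rewrite (big_rem x) //= (big_rem x (F := n')) //= /n' eqxx nx.
    rewrite addSn ltnS; apply: leq_trans; rewrite leq_add2l.
    by apply: leq_sum => y _; case: eqP => [->|]; rewrite ?nx.
  rewrite premodE pack_linearE /n'; case: eqP => [->|_].
    by have := nJ x xl; rewrite nx exprS.
  exact: (rpredZ x (nJ y yl)).
by move: bI; rewrite premodE pack_linearE [_ *: _]mulrC.
Qed.

Lemma ideal_pow_nil (l : seq R^o) I J :
  {subset I <= spanl l} ->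
  (forall x : R^o, x \in l -> exists n, (x ^+ n : R^o) \in J) ->
  exists t, {subset ideal_pow I t <= J}.
Proof.
move=> Il lJ; have /choice[n nP] : forall x : R^o, exists n,
    x \in l -> (x ^+ n : R^o) \in J.
  move=> x; case xl: (x \in l); last by exists 0%N.
  by have [n ?] := lJ x xl; exists n.
exists (\sum_(x <- l) n x).+1; exact: (ideal_pow_nil_sub Il (leqnn _) nP).
Qed.

Definition ideal_act I V (U : submodClosed V) : submodClosed V :=
  submod_span [set y | exists a u, [/\ a \in I, u \in U & y = a *: u]].

Lemma mem_ideal_act I V (U : submodClosed V) (a : R^o) u :
  a \in I -> u \in U -> a *: u \in ideal_act I U.
Proof. by move=> aI uU; apply: mem_span; exists a, u. Qed.

(* Artin-Rees in its topological form: if W is maximal with W ∩ U ⊆ I^k U, then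
   x^n V ⊆ W for each x in I as soon as the chain (W : x^n) is stationary at n. *)
Lemma artin_rees (l : seq R^o) I V (U : submodClosed V) k :
  {subset l <= I} -> {subset I <= spanl l} -> noetherian V ->
  exists s, forall u, u \in U -> u \in ideal_act (ideal_pow I s) (fullmod V) ->
    u \in ideal_act (ideal_pow I k) U.
Proof.
move=> lI Il nV; set T := ideal_act (ideal_pow I k) U.
pose P (W : submodClosed V) := {subset T <= W} /\
  forall u, u \in W -> u \in U -> u \in T.
have [|W [TW WU] Wmax] := @noetherian_max _ _ P T nV; first by split.
(* The ideal (W : V); by [ideal_pow_nil] it contains a power of [I] as soon as it contains a power
   of each generator. *)
have ann_prop : submod_prop [set a : R^o | forall v : V, a *: v \in W].
  split=> [v|a b c bP cP v /=]; first by rewrite scale0r rpred0.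
  rewrite scalerDl -[a *: b]/(a * b) -scalerA.
  by apply: rpredD; [apply: rpredZ; exact: bP|exact: cP].
have [x xl|s sP] := @ideal_pow_nil l I (pack_submod ann_prop) Il; last first.
  exists s => u uU us; apply: WU => //; move: u us {uU}; apply: span_sub.
  by move=> _ [a [v [/sP /pack_submodP aW _ ->]]]; exact: aW.
have [|n nW] := nV (fun n => premod (scalar V (x ^+ n)) W).
  by move=> n v; rewrite !premodE !pack_linearE exprS -scalerA; exact: rpredZ.
exists n; apply/pack_submodP => v.
pose W' := addmod W (immod (scalar V (x ^+ n))).
suff PW' : P W'.
  apply: (Wmax _ PW') => [w|]; first exact: addmodl.
  by apply: addmodr; apply/immodP; exists v.
split=> [w /TW|u]; first exact: addmodl.
move=> /addmodP[w [_ [wW /immodP[p <-] <-]]]; rewrite pack_linearE => uU.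
apply: WU => //; apply: rpredD => //.
(* For u = w + x^n p in [U], x^k u lies in I^k U, hence in [W]; so x^(k+n) p lies in [W], and
   stationarity of the chain (W : x^n) puts x^n p there. *)
have xW : x ^+ k *: (w + x ^+ n *: p) \in W.
  by apply: TW; apply: mem_ideal_act => //; apply: ideal_pow_exp; exact: lI.
have := nW (k + n)%N (leq_addl _ _) p.
rewrite !premodE !pack_linearE => <-.
have -> : x ^+ (k + n) *: p = x ^+ k *: (w + x ^+ n *: p) + (- x ^+ k) *: w.
  by rewrite scalerDr scalerA -exprD scaleNr addrC addKr.
by apply: rpredD => //; exact: rpredZ.
Qed.

(** V is a vector space over the residue field. Vectors taken from successive gaps of an ascending
    chain that never stops are independent, so the spans of their tails would descend for ever. *)
Lemma artinian_killed_noetherian V I : maximal_ideal I -> artinian V ->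
  (forall a v, (a : R^o) \in I -> a *: v = 0 :> V) -> noetherian V.
Proof.
move=> [I1 Imax] aV IV S SS; apply: contrapT => no.
(* An element outside the maximal ideal [I] is invertible modulo [I], and [I] kills [V]. *)
have unit (c : R^o) v (T : submodClosed V) : c *: v \in T -> c *: v = 0 \/ v \in T.
  move=> cT; have [/IV->|cI] := boolP (c \in I); [by left|right].
  pose J := addmod I (submod_span [set c]).
  have cJ : c \in J by apply: addmodr; exact: mem_span.
  have : (1 : R^o) \in J.
    apply/negPn/negP => J1; move/negP: cI; apply.
    by rewrite -(Imax J) // => x; exact: addmodl.
  move=> /addmodP[a [b [aI bc ab]]].
  have {bc} [r br] : exists r, b = r *: c.
    have bc' : b \in spanl [:: c].
      by move: b bc {ab}; apply: span_sub => _ ->; apply: mem_span; exact: mem_head.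
    have [r ->] := spanl_sum bc'; exists (r 0%N).
    by rewrite big_ord_recl big_ord0 addr0.
  have -> : v = r *: (c *: v).
    by rewrite -[LHS](scale1r v) -ab br scalerDl (IV a) // add0r scalerA.
  exact: rpredZ.
have /choice[f fP] : forall n, exists kv : nat * V,
    [/\ (n <= kv.1)%N, kv.2 \in S kv.1 & kv.2 \notin S n].
  move=> n; apply: contrapT => non; apply: no; exists n => k nk x.
  apply/idP/idP; last exact: (chain_le SS).
  by move=> xk; apply: contrapT => /negP xn; apply: non; exists (k, x).
pose N j := iter j (fun n => (f n).1) 0%N; pose v j := (f (N j)).2.
have vS j : v j \in S (N j.+1) by have [] := fP (N j).
have vN j : v j \notin S (N j) by have [] := fP (N j).
have NS i j : (i <= j)%N -> {subset S (N i) <= S (N j)}.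
  by apply: (@chain_le _ _ (S \o N)) => n; apply: (chain_le SS); have [] := fP (N n).
pose W j := submod_span [set x | exists2 i, (j <= i)%N & x = v i].
have [|j jW] := aV W.
  by move=> j; apply: span_sub => _ [i ji ->]; apply: mem_span; exists i => //; exact: ltnW.
have vW : v j \in W j.+1 by rewrite jW //; apply: mem_span; exists j.
(* [L d] lists v_(j+1), ..., v_(j+d), the latest first; the span of all later vectors is the union
   of the spans of these lists. *)
pose fix L d := if d is d'.+1 then v (j + d'.+1)%N :: L d' else [::].
have LP : submod_prop [set x | exists d, x \in spanl (L d)].
  split=> [|a x y [d xd] [e ye]]; first by exists 0%N; exact: rpred0.
  have LL := @chain_le _ _ (fun d => spanl (L d)).
  exists (maxn d e); rewrite rpredD ?rpredZ //.
    apply: LL (leq_maxl _ _) _ xd => n; apply: span_sub => z zL; apply: mem_span.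
    by rewrite /= in_cons; apply/orP; right.
  apply: LL (leq_maxr _ _) _ ye => n; apply: span_sub => z zL; apply: mem_span.
  by rewrite /= in_cons; apply/orP; right.
have [d vd] : exists d, v j \in spanl (L d).
  apply/(pack_submodP LP); move: vW; move: (v j); apply: span_sub => _ [i ji ->].
  apply/(pack_submodP LP); exists (i - j)%N; move: ji; rewrite -subn_gt0.
  case e: (i - j)%N => [//|d] _; apply: mem_span; rewrite /= -e subnKC ?mem_head //.
  by rewrite ltnW // -subn_gt0 e.
suff nL : v j \notin spanl (L d) by rewrite vd in nL.
have LS e : {subset spanl (L e) <= S (N (j + e).+1)}.
  apply: span_sub => x; elim: e => // e IH.
  rewrite /= in_cons => /predU1P[->|/IH xS]; first exact: vS.
  by apply: (NS (j + e).+1 (j + e.+1).+1 _) xS; rewrite addnS.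
(* The newest vector v_(j+d+1) contributes nothing: a nonzero multiple of it would lie in
   [S (N (j + d.+1))] and pull the vector itself there, against its choice. *)
elim: {vd} d => [|d IH]; apply/negP => vd.
  have [c] := spanl_sum vd; rewrite big_ord0 => v0.
  by move: (vN j); rewrite v0 rpred0.
have [c [y [yL vE]]] := spanl_cons vd; move/negP: IH; apply.
have [|c0|vS'] := unit c (v (j + d.+1)%N) (S (N (j + d.+1)%N)).
- have -> : c *: v (j + d.+1)%N = v j - y by rewrite vE addrK.
  rewrite -scaleN1r rpredD ?rpredZ //; first by apply: NS (vS j); rewrite addnS ltnS leq_addr.
  by have := LS d y yL; rewrite addnS.
- by rewrite vE c0 add0r.
- by move: (vN (j + d.+1)%N); rewrite vS'.
Qed.
End CommutativeAlgebra.

(** * The long exact sequence of Tor *)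

Section Copower.
Variable R : comPzRingType.
Implicit Types (A K N : lmodType R).

Lemma copower_mk K N (u : K -> N) : finite_set [set x | u x != 0] ->
  exists v : copower K N, forall x, dcoef v x = u x.
Proof. by move=> fu; exists (SubmodOf (dsum_mk (T := fun=> N) fu)). Qed.

Lemma coef_map_comp K N1 N2 N3 (h : {linear N1 -> N2}) (h' : {linear N2 -> N3})
  (h'' : {linear N1 -> N3}) : h'' =1 h' \o h ->
  forall u, coef_map K h'' u = coef_map K h' (coef_map K h u).
Proof. by move=> hh' u; apply: dsumP => x; exact: hh'. Qed.

Lemma coef_map_lift K N1 N2 (h : {linear N1 -> N2}) (u : copower K N2) :
  (forall x, exists v, h v = dcoef u x) -> exists v, coef_map K h v = u.
Proof.
(* Zero coefficients are lifted to 0, so that the lift keeps finite support. *)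
move=> hu; have /choice[c cP] : forall x, exists v, h v = dcoef u x /\
    (dcoef u x = 0 -> v = 0).
  move=> x; have [->|ux] := eqVneq (dcoef u x) 0.
    by exists 0; rewrite raddf0.
  by have [v vu] := hu x; exists v; split=> // u0; rewrite u0 eqxx in ux.
have [|v vP] := @copower_mk K N1 c.
  apply: sub_finite_set (dcoef_finite u) => x /=.
  by apply: contra_neq => /(proj2 (cP x)).
by exists v; apply: dsumP => x; rewrite -[LHS]/(h (dcoef v x)) vP; case: (cP x).
Qed.

Lemma coef_map_inj K N1 N2 (h : {linear N1 -> N2}) u :
  (forall x, h x = 0 -> x = 0) -> coef_map K h u = 0 -> u = 0.
Proof.
move=> hi hu; apply: dsumP => x; apply: (hi (dcoef u x)).
by rewrite -[LHS]/(dcoef (coef_map K h u) x) hu.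
Qed.
End Copower.

Section Tor.
Variable R : comPzRingType.
Implicit Types (A B K N M : lmodType R).

Definition torcl A N n z (zc : z \in cycles A N n) : Tor A N n :=
  quotpi (pullmod (cycles A N n) (boundaries A N n)) (SubmodOf zc).

Lemma torclP A N n (t : Tor A N n) : exists z (zc : z \in cycles A N n), t = torcl zc.
Proof. by rewrite -(quotreprK t); case: (quotrepr t) => z zc; exists z, zc. Qed.

Lemma torcl_eq A N n z z' (zc : z \in cycles A N n) (zc' : z' \in cycles A N n) :
  torcl zc = torcl zc' <-> z - z' \in boundaries A N n.
Proof. by rewrite quotpi_eq pullmodP. Qed.

Lemma torcl_eq0 A N n z (zc : z \in cycles A N n) :
  torcl zc = 0 <-> z \in boundaries A N n.
Proof.
have e0 : torcl (rpred0 (cycles A N n)) = 0.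
  by apply: quotpi0; rewrite pullmodP rpred0.
by rewrite -e0 torcl_eq subr0.
Qed.

Lemma torcl_lin A N n a z z' (zc : z \in cycles A N n) (zc' : z' \in cycles A N n)
  (zc'' : a *: z + z' \in cycles A N n) : a *: torcl zc + torcl zc' = torcl zc''.
Proof. by rewrite -linearP; congr quotpi; apply: val_inj. Qed.

Lemma tor_maprE A N N' (h : {linear N -> N'}) n z (zc : z \in cycles A N n)
    (zc' : coef_map _ h z \in cycles A N' n) :
  tor_mapr A h n (torcl zc) = torcl zc'.
Proof. by rewrite [LHS]quot_mapE; congr quotpi; apply: val_inj. Qed.

Lemma tor_maplE A B N (f : {linear A -> B}) n z (zc : z \in cycles A N n)
    (zc' : push N (syz_map f n) z \in cycles B N n) :
  tor_mapl N f n (torcl zc) = torcl zc'.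
Proof. by rewrite [LHS]quot_mapE; congr quotpi; apply: val_inj. Qed.

Lemma tor_mapr_comp A N1 N2 N3 (h : {linear N1 -> N2}) (h' : {linear N2 -> N3})
  (h'' : {linear N1 -> N3}) n : h'' =1 h' \o h ->
  forall t, tor_mapr A h'' n t = tor_mapr A h' n (tor_mapr A h n t).
Proof.
move=> hh' t; have [z [zc ->]] := torclP t.
have c1 := tor_mapr_cycles h zc; have c2 := tor_mapr_cycles h' c1.
rewrite (tor_maprE zc c1) (tor_maprE c1 c2) (tor_maprE zc (tor_mapr_cycles h'' zc)).
by congr quotpi; apply: val_inj; exact: coef_map_comp.
Qed.

Lemma tor_mapr_id A N (h : {linear N -> N}) n : h =1 id ->
  forall t, tor_mapr A h n t = t.
Proof.
move=> hid t; have [z [zc ->]] := torclP t.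
rewrite (tor_maprE zc (tor_mapr_cycles h zc)).
by congr quotpi; apply: val_inj; apply: dsumP => x; exact: hid.
Qed.

Lemma tor_mapr_lin A N N' (h h1 h2 : {linear N -> N'}) a n :
  (forall x, h x = a *: h1 x + h2 x) ->
  forall t, tor_mapr A h n t = a *: tor_mapr A h1 n t + tor_mapr A h2 n t.
Proof.
move=> hh t; have [z [zc ->]] := torclP t.
have c1 := tor_mapr_cycles h1 zc; have c2 := tor_mapr_cycles h2 zc.
have c := tor_mapr_cycles h zc.
rewrite (tor_maprE zc c1) (tor_maprE zc c2) (tor_maprE zc c).
have e : coef_map _ h z = a *: coef_map _ h1 z + coef_map _ h2 z.
  by apply: dsumP => x; exact: hh.
have c' : a *: coef_map _ h1 z + coef_map _ h2 z \in cycles A N' n by rewrite -e.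
by rewrite (torcl_lin c1 c2 c'); congr quotpi; apply: val_inj.
Qed.

Lemma diff_cycle A N n w : diff (syz A n) N w \in cycles A N n.
Proof. by case: n w => [|n] w; [exact/pack_submodP|apply/kermodP; exact: diffK]. Qed.

Section ShortExact.
Variables (N' N N'' : lmodType R) (f : {linear N' -> N}) (g : {linear N -> N''}).

Definition short_exact := [/\ forall x, f x = 0 -> x = 0,
  forall y, exists x, g x = y & forall x, g x = 0 <-> exists y, f y = x].

Hypothesis fg : short_exact.

Lemma short_exact_comp x : g (f x) = 0.
Proof. by have [_ _ ex] := fg; apply/ex; exists x. Qed.

(** Lifting is done coefficient by coefficient, so copowers are exact in the coefficient module: a
    short exact sequence of modules gives one of complexes. *)
Lemma coef_map_exact K (u : copower K N) :
  coef_map K g u = 0 -> exists v, coef_map K f v = u.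
Proof.
move=> gu; apply: coef_map_lift => x; have [_ _ ex] := fg; apply/ex.
by rewrite -[LHS]/(dcoef (coef_map K g u) x) gu.
Qed.

Lemma coef_map_surj K (u : copower K N'') : exists v, coef_map K g v = u.
Proof. by apply: coef_map_lift => x; have [_ gs _] := fg. Qed.

Lemma coef_map_comp0 K (u : copower K N') : coef_map K g (coef_map K f u) = 0.
Proof. by apply: dsumP => x; exact: short_exact_comp. Qed.

Lemma cycle_of_image A n (z : copower (syz A n) N') :
  coef_map _ f z \in cycles A N n -> z \in cycles A N' n.
Proof.
case: n z => [|n] z; first by move=> _; apply/pack_submodP.
move=> /kermodP; rewrite diff_coef_map => fz; apply/kermodP.
by have [fi _ _] := fg; exact: coef_map_inj fz.
Qed.

Lemma tor_exact A n (t : Tor A N n) :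
  tor_mapr A g n t = 0 -> exists t', tor_mapr A f n t' = t.
Proof.
have [z [zc ->]] := torclP t.
rewrite (tor_maprE zc (tor_mapr_cycles g zc)) => /torcl_eq0/immodP[w''].
have [w <-] := coef_map_surj w''; rewrite diff_coef_map => gw.
have [|z' fz'] := @coef_map_exact _ (z - diff _ N w).
  by rewrite linearB gw subrr.
have zc' : z' \in cycles A N' n.
  apply: cycle_of_image; rewrite fz' -scaleN1r rpredD ?rpredZ //.
  exact: diff_cycle.
exists (torcl zc'); rewrite (tor_maprE zc' (tor_mapr_cycles f zc')).
apply/torcl_eq/immodP; exists (- w); rewrite linearN fz'.
by rewrite addrC addKr.
Qed.

Lemma tor0_surj A (t : Tor A N'' 0) : exists t', tor_mapr A g 0 t' = t.
Proof.
have [z [zc ->]] := torclP t; have [w wz] := coef_map_surj z.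
have wc : w \in cycles A N 0 by apply/pack_submodP.
exists (torcl wc); rewrite (tor_maprE wc (tor_mapr_cycles g wc)).
by congr quotpi; apply: val_inj.
Qed.

(* The graph of the connecting map. *)
Definition tor_delta A n (t'' : Tor A N'' n.+1) (t' : Tor A N' n) : Prop :=
  exists w z (wc : coef_map _ g w \in cycles A N'' n.+1) (zc : z \in cycles A N' n),
    [/\ t'' = torcl wc, t' = torcl zc & diff _ N w = coef_map _ f z].

Lemma tor_delta_of A n w (wc : coef_map _ g w \in cycles A N'' n.+1) :
  exists z (zc : z \in cycles A N' n), diff _ N w = coef_map _ f z.
Proof.
have /kermodP := wc; rewrite diff_coef_map => /coef_map_exact[z zw].
have zc : z \in cycles A N' n by apply: cycle_of_image; rewrite zw diff_cycle.
by exists z, zc.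
Qed.

Lemma tor_delta_total A n (t'' : Tor A N'' n.+1) : exists t', tor_delta t'' t'.
Proof.
have [z'' [zc'' ->]] := torclP t''; have [w wz] := coef_map_surj z''.
have wc : coef_map _ g w \in cycles A N'' n.+1 by rewrite wz.
have [z [zc wz']] := tor_delta_of wc; exists (torcl zc), w, z, wc, zc.
by split=> //; congr quotpi; apply: val_inj.
Qed.

Lemma tor_delta_lin A n a (t u : Tor A N'' n.+1) t' u' :
  tor_delta t t' -> tor_delta u u' -> tor_delta (a *: t + u) (a *: t' + u').
Proof.
case=> w [z [wc [zc [-> -> wz]]]] [v [y [vc [yc [-> -> vy]]]]].
have c1 : coef_map _ g (a *: w + v) \in cycles A N'' n.+1.
  by rewrite linearP rpredD ?rpredZ.
have c2 : a *: z + y \in cycles A N' n by rewrite rpredD ?rpredZ.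
exists (a *: w + v), (a *: z + y), c1, c2; split.
- have c1' : a *: coef_map _ g w + coef_map _ g v \in cycles A N'' n.+1.
    by rewrite rpredD ?rpredZ.
  by rewrite (torcl_lin wc vc c1'); congr quotpi; apply: val_inj;
    exact/esym/linearP.
- exact: torcl_lin.
- by rewrite !linearP wz vy.
Qed.

(** If g(w) is the boundary of g(v), then w - dv comes from some u over [N'], and du = z because [f]
    is injective on coefficients and dd = 0. *)
Lemma tor_delta_fun0 A n (t' : Tor A N' n) : tor_delta 0 t' -> t' = 0.
Proof.
case=> w [z [wc [zc [/esym/torcl_eq0/immodP[v'' ] vw -> wz]]]].
move: vw; have [v <-] := coef_map_surj v''; rewrite diff_coef_map => vw.
have [|u uw] := @coef_map_exact _ (w - diff _ N v); first by rewrite linearB vw subrr.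
apply/torcl_eq0/immodP; exists u; have [fi _ _] := fg.
apply/eqP; rewrite -subr_eq0; apply/eqP; apply: (coef_map_inj fi).
by rewrite linearB -diff_coef_map uw linearB diffK subr0 wz subrr.
Qed.

Lemma tor_delta_uniq A n (t'' : Tor A N'' n.+1) (t' u' : Tor A N' n) :
  tor_delta t'' t' -> tor_delta t'' u' -> t' = u'.
Proof.
apply: linear_rel_uniq => [a u v u1 v1|v]; last exact: tor_delta_fun0.
exact: tor_delta_lin.
Qed.

Lemma tor_delta_exactl A n (t'' : Tor A N'' n.+1) :
  tor_delta t'' 0 -> exists t, tor_mapr A g n.+1 t = t''.
Proof.
case=> w [z [wc [zc [-> /esym/torcl_eq0/immodP[u uz] wz]]]].
have vc : w - coef_map _ f u \in cycles A N n.+1.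
  by apply/kermodP; rewrite linearB wz diff_coef_map uz subrr.
exists (torcl vc); rewrite (tor_maprE vc (tor_mapr_cycles g vc)).
congr quotpi; apply: val_inj; rewrite -[LHS]/(coef_map _ g (w - coef_map _ f u)).
by rewrite linearB coef_map_comp0 subr0.
Qed.

Lemma tor_delta_comp A n (t : Tor A N n.+1) : tor_delta (tor_mapr A g n.+1 t) 0.
Proof.
have [w [wc ->]] := torclP t; have gc := tor_mapr_cycles g wc.
have c0 : 0 \in cycles A N' n := rpred0 _.
exists w, 0, gc, c0; split; first exact: tor_maprE.
  by apply/esym/torcl_eq0; exact: rpred0.
by rewrite raddf0; exact/kermodP.
Qed.

Lemma tor_delta_exactr A n (t' : Tor A N' n) :
  tor_mapr A f n t' = 0 -> exists t'', tor_delta (t'' : Tor A N'' n.+1) t'.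
Proof.
have [z [zc ->]] := torclP t'.
rewrite (tor_maprE zc (tor_mapr_cycles f zc)) => /torcl_eq0/immodP[w wz].
have wc : coef_map _ g w \in cycles A N'' n.+1.
  by apply/kermodP; rewrite diff_coef_map wz coef_map_comp0.
by exists (torcl wc), w, z, wc, zc.
Qed.
End ShortExact.

Lemma tor_delta_mapl A B (h : {linear A -> B}) N' N N''
    (f : {linear N' -> N}) (g : {linear N -> N''}) n t'' t' :
  tor_delta f g t'' t' ->
  tor_delta f g (tor_mapl N'' h n.+1 t'') (tor_mapl N' h n t').
Proof.
case=> w [z [wc [zc [-> -> wz]]]].
have c := tor_mapl_cycles h wc; have c' : coef_map _ g (push N (syz_map h n.+1) w)
    \in cycles B N'' n.+1 by rewrite -push_coef_map.
have zc' := tor_mapl_cycles h zc.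
exists (push N (syz_map h n.+1) w), (push N' (syz_map h n) z), c', zc'.
split; last by rewrite diff_push wz push_coef_map.
  by rewrite (tor_maplE wc c); congr quotpi; apply: val_inj; exact: push_coef_map.
exact: tor_maplE.
Qed.

Lemma tor_delta_mapr A N' N N'' (f : {linear N' -> N}) (g : {linear N -> N''})
    M' M M'' (f1 : {linear M' -> M}) (g1 : {linear M -> M''})
    (h' : {linear N' -> M'}) (h : {linear N -> M}) (h'' : {linear N'' -> M''}) n t'' t' :
  h \o f =1 f1 \o h' -> h'' \o g =1 g1 \o h ->
  tor_delta f g t'' t' ->
  tor_delta f1 g1 (tor_mapr A h'' n.+1 t'') (tor_mapr A h' n t').
Proof.
move=> hf hg [w [z [wc [zc [-> -> wz]]]]].
have c := tor_mapr_cycles h'' wc.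
have e : coef_map _ h'' (coef_map _ g w) = coef_map _ g1 (coef_map _ h w).
  by apply: dsumP => x; exact: hg.
have c' : coef_map _ g1 (coef_map _ h w) \in cycles A M'' n.+1 by rewrite -e.
have zc' := tor_mapr_cycles h' zc.
exists (coef_map _ h w), (coef_map _ h' z), c', zc'; split.
- by rewrite (tor_maprE wc c); congr quotpi; exact: val_inj.
- exact: tor_maprE.
- by rewrite diff_coef_map wz; apply: dsumP => x; exact: hf.
Qed.

Lemma pure_tensor_regular K (k : free_on K) (a : R^o) : pure_tensor k a = a *: k.
Proof. by apply: dsumP => y; exact: mulrC. Qed.

Lemma diff_regular K u : diff K R^o u = val (aug (syzygy K) u).
Proof.
move: u; apply: copower_ext => [a u v|a u v|x a].
- exact: linearP.
- by rewrite !linearP.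
rewrite diff_single pure_tensor_regular aug_single.
exact/esym/(submod_valZ (S := kermod (aug K))).
Qed.

(** With coefficients in R the complex is the resolution itself ([diff_regular]): a cycle is an
    element of the next syzygy module, hence the boundary of the basis element that it indexes. *)
Lemma tor_regular A n (t : Tor A R^o n.+1) : t = 0.
Proof.
have [z [zc ->]] := torclP t; apply/torcl_eq0/immodP.
have /kermodP dz := zc.
have zk : z \in kermod (aug (syz A n.+1)).
  by apply/kermodP; apply: val_inj; rewrite -diff_regular.
exists (csingle (K := syzygy _) R^o (SubmodOf zk) 1); rewrite diff_single.
by apply: dsumP => y; exact: mulr1.
Qed.
End Tor.

(** * Finiteness of Tor *)

(** Lets artinian and noetherian coefficients share one proof of the finiteness of Tor. *)
Definition serre_class (R : pzRingType) (P : lmodType R -> Prop) := [/\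
  forall (U V W : lmodType R) (f : {linear U -> V}) (g : {linear V -> W}),
    (forall v, g v = 0 -> exists u, f u = v) -> P U -> P W -> P V,
  forall (U V : lmodType R) (f : {linear U -> V}),
    (forall u, f u = 0 -> u = 0) -> P V -> P U &
  forall (U V : lmodType R) (f : {linear U -> V}),
    (forall v, exists u, f u = v) -> P U -> P V].

Lemma artinian_serre (R : pzRingType) : serre_class (@artinian R).
Proof.
split=> [U V W f g ex|U V f fi|U V f fs].
- exact: exact_artinian ex.
- exact: inj_artinian fi.
- exact: surj_artinian fs.
Qed.

Lemma noetherian_serre (R : pzRingType) : serre_class (@noetherian R).
Proof.
split=> [U V W f g ex|U V f fi|U V f fs].
- exact: exact_noetherian ex.
- exact: inj_noetherian fi.
- exact: surj_noetherian fs.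
Qed.

Lemma spanl_map (R : pzRingType) (U V : lmodType R) (f : {linear U -> V}) l x :
  x \in spanl l -> f x \in spanl (map f l).
Proof.
rewrite -premodE; move: x; apply: span_sub => x xl; rewrite premodE.
by apply: mem_span; exact: map_f.
Qed.

Section FiniteSupport.
Variable R : comPzRingType.
Implicit Types (A K N : lmodType R).

Lemma dcoef_is_linear K N (y : K) : linear (fun u : copower K N => dcoef u y).
Proof. by []. Qed.
Definition coefmap K N (y : K) : {linear copower K N -> N} :=
  pack_linear (@dcoef_is_linear K N y).

Lemma supp_submod_prop K N (F : seq K) :
  submod_prop [set u : copower K N | forall y, y \notin F -> dcoef u y = 0].
Proof.
split=> // a u v uF vF y yF; rewrite -[LHS]/(coefmap N y _) linearP.
by rewrite !pack_linearE uF // vF // scaler0 addr0.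
Qed.
Definition suppmod K N (F : seq K) := pack_submod (supp_submod_prop N F).

Lemma suppmodP K N (F : seq K) (u : copower K N) :
  reflect (forall y, y \notin F -> dcoef u y = 0) (u \in suppmod N F).
Proof. exact: pack_submodP. Qed.

Lemma suppmod_serre (P : lmodType R -> Prop) K N (F : seq K) :
  serre_class P -> P N -> P (submod_of (suppmod N F)).
Proof.
move=> [Pex Pinj _] PN; elim: F => [|x F IH].
  apply: (Pinj _ _ \0 _ PN) => u _; apply: val_inj; apply: dsumP => y.
  by have /suppmodP := valP u; exact.
have sub (u : copower K N) : u \in suppmod N F -> idfun u \in suppmod N (x :: F).
  move=> /suppmodP uF; apply/suppmodP => y; rewrite in_cons negb_or => /andP[_].
  exact: uF.
apply: (Pex _ _ _ (sub_map sub) (coefmap N x \o val) _ IH PN) => v vx.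
have vF : val v \in suppmod N F.
  apply/suppmodP => y yF; have [->//|yx] := eqVneq y x.
  by have /suppmodP := valP v; apply; rewrite in_cons negb_or yx.
by exists (SubmodOf vF); exact: val_inj.
Qed.

Lemma spanl_lift K (l : seq K) x : x \in spanl l ->
  exists2 k, k \in suppmod R^o l & aug K k = x.
Proof.
move=> /spanl_sum[c ->].
exists (\sum_(j < size l) csingle (K := K) R^o l`_j (c j)).
  apply: rpred_sum => j _; apply/suppmodP => y yl; apply: dsingle_out.
  by apply: contraNneq yl => <-; exact: mem_nth.
by rewrite raddf_sum; apply: eq_bigr => j _; exact: aug_single.
Qed.

Lemma tensor_along_supp K N (T : K -> free_on K) F (u : copower K N) :
  (forall x, T x \in suppmod R^o F) -> tensor_along N T u \in suppmod N F.
Proof.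
move=> TF; apply/suppmodP => y yF; rewrite -[LHS]/((coefmap N y \o tensor_along N T) u).
transitivity ((\0 : {linear copower K N -> N}) u) => //.
move: u; apply: copower_ext => [a u v|a u v|x v]; rewrite ?linearP //.
rewrite /comp tensor_along_single -[LHS]/(dcoef (T x) y *: v).
by have /suppmodP -> := TF x; rewrite // scale0r.
Qed.

(* [tau] and [e] are the homotopic parts of the identity of a resolution: the first
   has finite support and the second is null-homotopic. *)
Definition finite_step A N n (F : seq (syz A n)) (tau : syz A n -> free_on (syz A n))
    (e : {linear syz A n -> free_on (syz A n)}) :=
  [/\ forall x, aug _ (tau x) + aug _ (e x) = x,
      forall z, z \in cycles A N n -> tensor_along N e z = 0 &
      forall x, tau x \in suppmod R^o F].

Arguments finite_step : clear implicits.

Section Step.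
Variables (K N : lmodType R) (tau : K -> free_on K) (e : {linear K -> free_on K}).
Hypothesis te : forall x, aug _ (tau x) + aug _ (e x) = x.

Lemma finite_step_homotopy_subproof x :
  csingle (K := K) R^o x 1 - tau x - e x \in kermod (aug K).
Proof. by apply/kermodP; rewrite !linearB aug_single scale1r -addrA -opprD te subrr. Qed.
Definition finite_step_homotopy x : syzygy K :=
  SubmodOf (finite_step_homotopy_subproof x).

Lemma finite_step_diff (u : copower K N) :
  diff K N (push N finite_step_homotopy u) = u - tensor_along N tau u - tensor_along N e u.
Proof.
move: u; apply: copower_ext => [a u v||x v]; [by rewrite !linearP| |].
  exact: (linearP (idfun \- tensor_along N tau \- tensor_along N e)).
rewrite push_single diff_single !tensor_along_single; apply: dsumP => y.
rewrite -[LHS]/((dcoef (csingle (K := K) R^o x 1) y - dcoef (tau x) y - dcoef (e x) y) *: v).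
rewrite !scalerBl; congr (_ - _ - _).
by rewrite -[v in RHS]scale1r -pure_tensor_single.
Qed.

Lemma finite_step_aug (k : free_on K) : aug K k = 0 ->
  aug K (tensor_along R^o tau k) = 0.
Proof.
move=> k0; have sE : aug K \o tensor_along R^o tau =1
    (fun k => aug K k - aug K (e (aug K k))).
  apply: copower_ext => [a u v|a u v|x a]; first by rewrite /comp !linearP.
    exact: (linearP (aug K \- (aug K \o e \o aug K))).
  rewrite /comp tensor_along_single pure_tensor_regular aug_single !linearZZ -scalerDr.
  by congr (_ *: _); apply/esym/eqP; rewrite subr_eq te.
by rewrite -[LHS]/((aug K \o tensor_along R^o tau) k) sE k0 !raddf0 addr0.
Qed.

Lemma finite_step_push (k : free_on K) : aug K k = 0 ->
  val (aug _ (push R^o finite_step_homotopy k)) = k - tensor_along R^o tau k.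
Proof.
move=> k0; have sE : val \o (aug (syzygy K) \o push R^o finite_step_homotopy) =1
    (fun k : free_on K => k - tensor_along R^o tau k - e (aug K k)).
  apply: copower_ext => [a u v||x a]; [by rewrite /comp !linearP| |].
    exact: (linearP (idfun \- tensor_along R^o tau \- (e \o aug K))).
  rewrite /comp push_single !aug_single tensor_along_single pure_tensor_regular.
  transitivity (a *: (csingle R^o x 1 - tau x - e x)).
    exact: (submod_valZ (S := kermod _)).
  rewrite !scalerBr scale_csingle (linearZZ e).
  by rewrite (_ : a *: (1 : R^o) = a) //; exact: mulr1.
by rewrite -[LHS]/((val \o (aug _ \o push R^o _)) k) sE k0 (raddf0 e) subr0.
Qed.
End Step.

Hypothesis noethR : noetherian (R^o : lmodType R).

(** The elements [x] - tau(x) - e(x) are syzygies, and pushing along them gives the new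
    null-homotopic part. What remains, tau applied to syzygies, lies among the syzygies supported in
    [F]; these form a noetherian module, and finitely many generators of it serve as the new
    support. *)
Lemma finite_stepS A N n F tau e : finite_step A N n F tau e ->
  exists F' tau' e', finite_step A N n.+1 F' tau' e'.
Proof.
move=> [te ez tF]; set K := syz A n in F tau e te ez tF *.
pose s := finite_step_homotopy te.
have e'L : linear (fun x : syzygy K => push R^o s (val x)).
  by move=> b x y; rewrite !linearP.
pose B := premod (val : {linear syzygy K -> free_on K}) (suppmod R^o F).
have [l lP] : exists l : seq (syzygy K), forall x, x \in B -> x \in spanl l.
  have BF (x : syzygy K) : x \in B -> val x \in suppmod R^o F by rewrite premodE.
  have nB : noetherian (submod_of B).
    have := suppmod_serre F (@noetherian_serre R) noethR.
    apply: (inj_noetherian (f := sub_map BF)) => x /(congr1 val)/= x0.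
    by apply: val_inj; apply: val_inj.
  have [l _ lB] := noetherian_fg (fullmod (submod_of B)) nB.
  exists (map val l) => x xB.
  apply: (@spanl_map _ _ _ (val : {linear submod_of B -> _}) l (SubmodOf xB)).
  by rewrite -lB; exact/pack_submodP.
have /choice[tau' tP'] : forall x : syzygy K, exists k,
    k \in suppmod R^o l /\ val (aug (syzygy K) k) = tensor_along R^o tau (val x).
  move=> x; have /kermodP x0 := valP x.
  have wK : tensor_along R^o tau (val x) \in kermod (aug K).
    by apply/kermodP; exact: (finite_step_aug te).
  have [|k kl kw] := @spanl_lift _ l (SubmodOf wK).
    by apply: lP; rewrite premodE; exact: tensor_along_supp.
  by exists k; rewrite kw.
exists l, tau', (pack_linear e'L); split=> [x|z /kermodP z0|x]; last by case: (tP' x).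
- apply: val_inj; have /kermodP x0 := valP x.
  transitivity (val (aug (syzygy K) (tau' x)) + val (aug (syzygy K) (push R^o s (val x)))).
    by [].
  by have [_ ->] := tP' x; rewrite finite_step_push // addrC subrK.
have <- : push N s (diff _ N z) = tensor_along N (pack_linear e'L) z.
  move: z {z0}; apply: copower_ext => [b k k'|b k k'|x v]; rewrite ?linearP //.
  by rewrite tensor_along_single diff_single push_tensor.
by rewrite z0 raddf0.
Qed.

Lemma finite_step_exists A N n : noetherian A ->
  exists F tau e, finite_step A N n F tau e.
Proof.
move=> nA; elim: n => [|n [F [tau [e]]]]; last exact: finite_stepS.
have [l _ lA] := noetherian_fg (fullmod A) nA.
have /choice[tau tP] : forall x : A, exists k, k \in suppmod R^o l /\ aug A k = x.
  move=> x; have [|k kl kx] := @spanl_lift _ l x; last by exists k.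
  by rewrite -lA; exact/pack_submodP.
exists l, tau, \0; split=> [x|z _|x]; last by case: (tP x).
  by rewrite raddf0 addr0; case: (tP x).
move: z; apply: copower_ext => [b k l'|b k l'|x v]; rewrite ?linearP //.
  by rewrite scaler0 addr0.
rewrite tensor_along_single; apply: dsumP => y.
by rewrite -[LHS]/(0 *: v) scale0r.
Qed.

(** The functorial resolution has far too many basis elements, but each cycle is homologous to its
    image under [tau], which is supported in the finite [F]. Hence Tor is a quotient of a submodule
    of a finite power of [N]. *)
Lemma tor_serre (P : lmodType R -> Prop) A N n :
  serre_class P -> noetherian A -> P N -> P (Tor A N n).
Proof.
move=> sP nA PN; have [F [tau [e [te ez tF]]]] := @finite_step_exists A N n nA.
have [_ Pinj Psurj] := sP.
pose S := premod (val : {linear submod_of (cycles A N n) -> _}) (suppmod N F).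
have SF x : x \in S -> val x \in suppmod N F by rewrite premodE.
apply: (Psurj _ _ (quotpi (pullmod (cycles A N n) (boundaries A N n)) \o
  (val : {linear submod_of S -> _}))) => [t|]; last first.
  apply: (Pinj _ _ (sub_map SF)) (suppmod_serre F sP PN) => x /(congr1 val)/= x0.
  by apply: val_inj; apply: val_inj.
have [z [zc ->]] := torclP t.
have dz := finite_step_diff te z; rewrite ez // subr0 in dz.
have tc : tensor_along N tau z \in cycles A N n.
  have -> : tensor_along N tau z = z - diff _ N (push N (finite_step_homotopy te) z).
    by rewrite dz opprB addrC subrK.
  by rewrite -scaleN1r rpredD ?rpredZ // diff_cycle.
have tS : SubmodOf tc \in S by rewrite premodE; exact: tensor_along_supp.
exists (SubmodOf tS); apply/(torcl_eq tc zc)/immodP.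
by exists (- push N (finite_step_homotopy te) z); rewrite linearN dz opprB.
Qed.
End FiniteSupport.

(** * Exactness of inverse limits and local homology *)

Section MittagLeffler.
Variables (R : pzRingType) (T : nat -> lmodType R).
Variable p : forall s, {linear T s.+1 -> T s}.
Variable E : forall s, T s -> Prop.
Hypothesis T_artinian : forall s, artinian (T s).
Hypothesis E_ex : forall s, exists x, E (s := s) x.
Hypothesis E_affine : forall s a (x y z : T s),
  E x -> E y -> E z -> E (x + a *: (y - z)).
Hypothesis E_p : forall s (x : T s.+1), E x -> E (p s x).

Fixpoint iter_image (k s : nat) : T s -> Prop :=
  if k is k'.+1 then fun x => exists2 y, iter_image k' (s := s.+1) y & p s y = x
  else E (s := s).

Lemma iter_image_affine k s a (x y z : T s) : iter_image k x ->
  iter_image k y -> iter_image k z -> iter_image k (x + a *: (y - z)).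
Proof.
elim: k s x y z => [|k IH] s x y z /=; first exact: E_affine.
move=> [x' xE <-] [y' yE <-] [z' zE <-]; exists (x' + a *: (y' - z')).
  exact: IH.
by rewrite linearD linearZ linearB.
Qed.

Lemma iter_image_ex k s : exists x : T s, iter_image k x.
Proof.
elim: k s => [|k IH] s; first exact: E_ex.
by have [x xE] := IH s.+1; exists (p s x), x.
Qed.

Lemma iter_image_sub k s (x : T s) : iter_image k.+1 x -> iter_image k x.
Proof.
elim: k s x => [|k IH] s x /= [y]; first by move=> /E_p yE <-.
by move=> /IH yE <-; exists y.
Qed.

Lemma iter_image_le k k' s (x : T s) : (k <= k')%N -> iter_image k' x -> iter_image k x.
Proof.
move=> kk; rewrite -(subnKC kk); elim: (k' - k)%N => [|j IH]; rewrite ?addn0 //.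
by rewrite addnS => /iter_image_sub.
Qed.

Lemma direction_submod_prop k s :
  submod_prop [set d : T s | exists x y, [/\ iter_image k x, iter_image k y & d = x - y]].
Proof.
split=> [|a _ _ [x [y [xE yE ->]]] [z [t [zE tE ->]]]].
  by have [x xE] := iter_image_ex k s; exists x, x; rewrite subrr.
exists (z + a *: (x - y)), t; split=> //; first exact: iter_image_affine.
by rewrite addrA [a *: _ + z]addrC.
Qed.

(** The directions of these affine subsets are descending submodules of the artinian [T s], and
    nested nonempty affine subsets with equal direction coincide. *)
Lemma iter_image_stable s : exists k, forall k' (x : T s), iter_image k x -> iter_image k' x.
Proof.
have [|k kP] := @T_artinian s (fun k => pack_submod (direction_submod_prop k s)).
  move=> k _ /pack_submodP[x [y [/iter_image_sub xE /iter_image_sub yE ->]]].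
  by apply/pack_submodP; exists x, y.
exists k => k' x xE; have [|/iter_image_le] := leqP k' k; first by move/iter_image_le; apply.
move=> _; have kk : (k <= maxn k k')%N := leq_maxl k k'.
apply: (iter_image_le (leq_maxr k k')).
have [y yE] := iter_image_ex (maxn k k') s.
have /pack_submodP[z [t [zE tE xy]]] : x - y \in
    pack_submod (direction_submod_prop (maxn k k') s).
  rewrite kP //; apply/pack_submodP; exists x, y; split=> //.
  exact: iter_image_le yE.
by rewrite -(subrK y x) addrC xy -[z - t]scale1r; exact: iter_image_affine.
Qed.

(** An element lying in all iterated images at level s lifts to such an element at level s + 1,
    because there one iterated image is already the intersection of all. Taking for [E] the fibres
    of a map yields exactness of inverse limits. *)
Lemma mittag_leffler : exists x : invlim p, forall s, E (invlim_coord x s).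
Proof.
pose Einf s (x : T s) := forall k, iter_image k x.
have Einf_surj s (x : T s) : exists y : T s.+1, Einf s x -> Einf s.+1 y /\ p s y = x.
  have [k kP] := iter_image_stable s.+1.
  (* Index k + 1 at level s means index k at level s + 1, where membership is already stable. The
     value 0 is a default outside [Einf]. *)
  have [/(_ k.+1) /= [y yE yx]|nx] := pselect (Einf s x); last by exists 0.
  by exists y => _; split=> // k'; exact: kP.
have [x0 x0E] : exists x : T 0%N, Einf 0%N x.
  have [k kP] := iter_image_stable 0%N; have [x xE] := iter_image_ex k 0%N.
  by exists x => k'; exact: kP.
pose fix x s : T s := if s is s'.+1 then sval (cid (Einf_surj s' (x s'))) else x0.
have xE s : Einf s (x s).
  elim: s => //= s IH; case: (cid _) => y /= yP; by case: (yP IH).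
have xp s : p s (x s.+1) = x s.
  by rewrite /=; case: (cid _) => y /= yP; case: (yP (xE s)).
by exists (invlim_mk xp) => s; exact: (xE s 0%N).
Qed.
End MittagLeffler.

(** * The long exact sequence of local homology *)

Section LocalHomology.
Variables (R : comPzRingType) (m : ideal R).
Implicit Types N M : lmodType R.
Local Notation H := (local_homology m).
Local Notation Hmap := (local_homology_map m).

Lemma lh_map_coord N N' (h : {linear N -> N'}) i (x : H N i) s :
  lcoord (Hmap h i x) s = tor_mapr _ h i (lcoord x s).
Proof. by []. Qed.

Lemma lh_map_comp N1 N2 N3 (h : {linear N1 -> N2}) (h' : {linear N2 -> N3})
  (h'' : {linear N1 -> N3}) i : h'' =1 h' \o h ->
  forall x, Hmap h'' i x = Hmap h' i (Hmap h i x).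
Proof. by move=> hh' x; apply: local_homologyP => s; exact: tor_mapr_comp. Qed.

Lemma lh_map_id N (h : {linear N -> N}) i : h =1 id -> forall x, Hmap h i x = x.
Proof. by move=> hid x; apply: local_homologyP => s; exact: tor_mapr_id. Qed.

Lemma lh_map_eq N N' (h h' : {linear N -> N'}) i : h =1 h' ->
  forall x, Hmap h i x = Hmap h' i x.
Proof. by move=> hh x; rewrite (@lh_map_comp _ _ _ idfun h' h i) // lh_map_id. Qed.

Lemma lh_map_square N1 N2 N3 N4 (h1 : {linear N1 -> N2}) (h2 : {linear N2 -> N4})
  (h3 : {linear N1 -> N3}) (h4 : {linear N3 -> N4}) i : h2 \o h1 =1 h4 \o h3 ->
  forall x, Hmap h2 i (Hmap h1 i x) = Hmap h4 i (Hmap h3 i x).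
Proof.
move=> hh x; rewrite -(lh_map_comp (h'' := h2 \o h1)) //.
exact: lh_map_comp.
Qed.

Lemma lh_map_lin N N' (h h1 h2 : {linear N -> N'}) (a : R) i :
  (forall x, h x = a *: h1 x + h2 x) ->
  forall x, Hmap h i x = completion_of m a *: Hmap h1 i x + Hmap h2 i x.
Proof.
move=> hh x; apply: local_homologyP => s.
transitivity (a *: lcoord (Hmap h1 i x) s + lcoord (Hmap h2 i x) s).
  by rewrite !lh_map_coord; exact: tor_mapr_lin.
congr (_ + _); exact/esym/local_homology_scaleE.
Qed.

Hypothesis noethR : noetherian (R^o : lmodType R).

Lemma adic_tor_artinian N i s : artinian N -> artinian (adic_tor m N i s).
Proof.
apply: (tor_serre noethR (P := @artinian R)); first exact: artinian_serre.
exact: quot_noetherian.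
Qed.

Section ShortExact.
Variables (N' N N'' : lmodType R) (f : {linear N' -> N}) (g : {linear N -> N''}).

Definition lh_delta i (x'' : H N'' i.+1) (x' : H N' i) :=
  forall s, tor_delta f g (lcoord x'' s) (lcoord x' s).

Hypothesis fg : short_exact f g.

Lemma lh_delta_total i (x'' : H N'' i.+1) : exists x', lh_delta x'' x'.
Proof.
have ex s : exists t', tor_delta f g (lcoord x'' s) t' by exact: tor_delta_total.
pose t' s := sval (cid (ex s)); have tP s : tor_delta f g (lcoord x'' s) (t' s).
  exact: svalP (cid (ex s)).
have tp s : adic_tor_proj m N' i s (t' s.+1) = t' s.
  apply: (tor_delta_uniq fg _ (tP s)).
  by rewrite -lcoordP; exact: tor_delta_mapl.
by exists (invlim_mk tp).
Qed.

Lemma lh_delta_lin i a (x y : H N'' i.+1) x' y' :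
  lh_delta x x' -> lh_delta y y' -> lh_delta (a *: x + y) (a *: x' + y').
Proof. by move=> xx yy s; exact: (tor_delta_lin _ (xx s) (yy s)). Qed.

Lemma lh_delta_fun0 i (x' : H N' i) : lh_delta 0 x' -> x' = 0.
Proof. by move=> xx; apply: local_homologyP => s; exact: tor_delta_fun0 (xx s). Qed.

Lemma lh_delta_comp i (x : H N i.+1) : lh_delta (Hmap g i.+1 x) 0.
Proof. by move=> s; exact: tor_delta_comp. Qed.

(** At each level the preimages of x form a nonempty affine subset of an artinian Tor, and
    [mittag_leffler] chooses them compatibly. The next exactness lemmas follow this pattern with the
    fibres of the relevant map or relation. *)
Lemma lh_exact i (x : H N i) : artinian N' ->
  Hmap g i x = 0 -> exists x', Hmap f i x' = x.
Proof.
move=> aN gx; have [|s|s a t u v tE uE vE|s t tE|x' xP] :=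
  @mittag_leffler _ _ (adic_tor_proj m N' i)
    (fun s t => tor_mapr _ f i t = lcoord x s).
- by move=> s; exact: adic_tor_artinian.
- by apply: (tor_exact fg); rewrite -lh_map_coord gx.
- by rewrite linearD linearZZ linearB tE uE vE subrr scaler0 addr0.
- by rewrite -[LHS]tor_map_comm tE lcoordP.
by exists x'; apply: local_homologyP.
Qed.

Lemma lh_delta_exactl i (x'' : H N'' i.+1) : artinian N ->
  lh_delta x'' 0 -> exists x, Hmap g i.+1 x = x''.
Proof.
move=> aN xd; have [|s|s a t u v tE uE vE|s t tE|x xP] :=
  @mittag_leffler _ _ (adic_tor_proj m N i.+1)
    (fun s t => tor_mapr _ g i.+1 t = lcoord x'' s).
- by move=> s; exact: adic_tor_artinian.
- exact: (tor_delta_exactl fg (xd s)).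
- by rewrite linearD linearZZ linearB tE uE vE subrr scaler0 addr0.
- by rewrite -[LHS]tor_map_comm tE lcoordP.
by exists x; apply: local_homologyP.
Qed.

Lemma lh_delta_exactr i (x' : H N' i) : artinian N'' ->
  Hmap f i x' = 0 -> exists x'', lh_delta x'' x'.
Proof.
move=> aN fx; have [|s|s a t u v tE uE vE|s t tE|x xP] :=
  @mittag_leffler _ _ (adic_tor_proj m N'' i.+1)
    (fun s t => tor_delta f g t (lcoord x' s)).
- by move=> s; exact: adic_tor_artinian.
- by apply: (tor_delta_exactr fg); rewrite -lh_map_coord fx.
- have := tor_delta_lin a (tor_delta_lin (-1) vE uE) tE.
  by rewrite !scaleN1r addNr scaler0 add0r [- v + u]addrC [_ + t]addrC.
- by rewrite -lcoordP; exact: tor_delta_mapl.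
by exists x.
Qed.

Lemma lh0_surj (x'' : H N'' 0) : artinian N -> exists x, Hmap g 0 x = x''.
Proof.
move=> aN; have [|s|s a t u v tE uE vE|s t tE|x xP] :=
  @mittag_leffler _ _ (adic_tor_proj m N 0)
    (fun s t => tor_mapr _ g 0 t = lcoord x'' s).
- by move=> s; exact: adic_tor_artinian.
- exact: (tor0_surj fg).
- by rewrite linearD linearZZ linearB tE uE vE subrr scaler0 addr0.
- by rewrite -[LHS]tor_map_comm tE lcoordP.
by exists x; apply: local_homologyP.
Qed.
End ShortExact.

Lemma lh_delta_map N' N N'' (f : {linear N' -> N}) (g : {linear N -> N''})
    M' M M'' (f1 : {linear M' -> M}) (g1 : {linear M -> M''})
    (h' : {linear N' -> M'}) (h : {linear N -> M}) (h'' : {linear N'' -> M''}) i x'' x' :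
  h \o f =1 f1 \o h' -> h'' \o g =1 g1 \o h ->
  @lh_delta _ _ _ f g i x'' x' ->
  lh_delta f1 g1 (Hmap h'' i.+1 x'') (Hmap h' i x').
Proof. by move=> hf hg xd s; exact: tor_delta_mapr hf hg (xd s). Qed.
End LocalHomology.

(** * Free covers and tensor products with cyclic modules *)

Section FreeCover.
Variable R : comPzRingType.
Implicit Types (A K N U V W : lmodType R).

Lemma add_map_is_linear U V W (f : {linear U -> W}) (g : {linear V -> W}) :
  linear (fun x : U * V => f x.1 + g x.2).
Proof. by move=> a x y; rewrite !linearP addrACA scalerDr. Qed.
Definition add_map U V W (f : {linear U -> W}) (g : {linear V -> W}) :
    {linear (U * V)%type -> W} := pack_linear (add_map_is_linear f g).

Lemma inl_is_linear U V : linear (fun u : U => (u, 0 : V)).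
Proof. by move=> a u v; congr pair; rewrite /= scaler0 addr0. Qed.
Definition inl_map U V : {linear U -> (U * V)%type} := pack_linear (@inl_is_linear U V).

Lemma inr_is_linear U V : linear (fun v : V => (0 : U, v)).
Proof. by move=> a u v; congr pair; rewrite /= scaler0 addr0. Qed.
Definition inr_map U V : {linear V -> (U * V)%type} := pack_linear (@inr_is_linear U V).

Lemma snd_is_linear U V : linear (fun x : U * V => x.2).
Proof. by []. Qed.
Definition snd_map U V : {linear (U * V)%type -> V} := pack_linear (@snd_is_linear U V).

Lemma prod_short_exact U V : short_exact (inl_map U V) (snd_map U V).
Proof.
split=> [x [->]//|y|[x y]]; first by exists (0, y).
by rewrite pack_linearE /=; split=> [->|[x' [_ <-]]//]; exists x.
Qed.

Lemma sub_short_exact V (S : submodClosed V) :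
  short_exact (val : {linear submod_of S -> V}) (quotpi S).
Proof.
split=> [x x0|y|x]; first exact: val_inj.
  by exists (quotrepr y); exact: quotreprK.
split=> [|[y <-]]; last by apply: quotpi0; exact: valP.
rewrite -[X in _ = X](raddf0 (quotpi S)) => /quotpi_eq; rewrite subr0 => xS.
by exists (SubmodOf xS).
Qed.

Lemma ker_short_exact U V (g : {linear U -> V}) : (forall y, exists x, g x = y) ->
  short_exact (val : {linear submod_of (kermod g) -> U}) g.
Proof.
move=> gs; split=> // [x x0|x]; first exact: val_inj.
split=> [/kermodP xk|[y <-]]; last exact/kermodP/valP.
by exists (SubmodOf xk).
Qed.

(* [power V n] is V^(n+1). *)
Fixpoint power V n : lmodType R := if n is n'.+1 then (V * power V n')%type else V.

(** The index list [t :: l] is nonempty because [power V n] has n + 1 factors; for a list [l] of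
    generators, 0 is taken as the extra index [t]. *)
Fixpoint power_sum (T : eqType) V W (h : T -> {linear V -> W}) (t : T) (l : seq T) :
    {linear power V (size l) -> W} :=
  match l return {linear power V (size l) -> W} with
  | [::] => h t
  | t' :: l' => add_map (h t) (power_sum h t' l')
  end.

Lemma power_sum_inj (T : eqType) V W (h : T -> {linear V -> W}) t l t' :
  t' \in t :: l -> exists e : {linear V -> power V (size l)},
    forall x, power_sum h t l (e x) = h t' x.
Proof.
elim: l t => [|u l IH] t; first by rewrite inE => /eqP ->; exists idfun.
rewrite in_cons => /predU1P[->|/IH[e eP]].
  exists (inl_map V _) => x.
  by transitivity (h t x + power_sum h u l 0) => //; rewrite raddf0 addr0.
exists (inr_map V _ \o e) => x.
by transitivity (h t 0 + power_sum h u l (e x)) => //; rewrite raddf0 add0r.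
Qed.

Lemma power_serre (P : lmodType R -> Prop) V n :
  serre_class P -> P V -> P (power V n).
Proof.
move=> [Pex Pi Ps] PV; elim: n => //= n IH.
apply: (Pex _ _ _ (inl_map _ _) (snd_map _ _) _ PV IH).
by have [_ _ ex] := prod_short_exact V (power V n) => v /ex.
Qed.

Definition tor_acyclic V := forall A n (t : Tor A V n.+1), t = 0.

Lemma power_acyclic V n : tor_acyclic V -> tor_acyclic (power V n).
Proof.
move=> V0; elim: n => //= n IH A k t.
have [|t' <-] := tor_exact (prod_short_exact V (power V n)) (t := t).
  exact: IH.
by rewrite (V0 _ _ t') raddf0.
Qed.

Lemma free_cover N : noetherian (R^o : lmodType R) -> noetherian N ->
  exists (P : lmodType R) (g : {linear P -> N}),
    [/\ noetherian P, tor_acyclic P & forall y, exists x, g x = y].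
Proof.
move=> nR nN; have [l _ lN] := noetherian_fg (fullmod N) nN.
exists (power R^o (size l)), (power_sum (@scale_by R N) 0 l); split=> [||y].
- exact: power_serre (@noetherian_serre R) nR.
- by apply: power_acyclic => A n; exact: tor_regular.
have : y \in spanl l by rewrite -lN; exact/pack_submodP.
suff sub : {subset spanl l <= immod (power_sum (@scale_by R N) 0 l)}.
  by move=> /sub/immodP.
apply: span_sub => z zl; apply/immodP.
have [|e eP] := @power_sum_inj _ _ _ (@scale_by R N) 0 l z.
  by rewrite in_cons; apply/orP; right.
by exists (e 1); rewrite eP; exact: scale1r.
Qed.
End FreeCover.

Lemma quotpi_eq0 (R : pzRingType) (V : lmodType R) (T : submodClosed V) x :
  quotpi T x = 0 <-> x \in T.
Proof.
split; last exact: quotpi0.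
by rewrite -[X in _ = X](raddf0 (quotpi T)) => /quotpi_eq; rewrite subr0.
Qed.

(** * Identification of Tor_0(R/J, P) with P/JP *)

Section TensorQuotient.
Variables (R : comPzRingType) (J : ideal R).
Implicit Types (P : lmodType R).
Local Notation A := (quoring J : lmodType R).

Lemma tensor1_subproof P (p : P) :
  csingle (K := A) P (quoring_pi J 1) p \in cycles A P 0.
Proof. exact/pack_submodP. Qed.

Lemma tensor1_is_linear P : linear (fun p : P => torcl (tensor1_subproof p)).
Proof.
move=> a p q; have c : a *: csingle (K := A) P (quoring_pi J 1) p +
  csingle (K := A) P (quoring_pi J 1) q \in cycles A P 0 by apply/pack_submodP.
rewrite (torcl_lin _ _ c); congr quotpi; apply: val_inj.
exact: (linearP (csingle (K := A) P (quoring_pi J 1))).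
Qed.
Definition tensor1 P : {linear P -> Tor A P 0} := pack_linear (@tensor1_is_linear P).

(** An inverse of [tensor1] modulo JP, built from chosen representatives in R of the elements of
    R/J. *)
Definition repr_eval P : {linear copower A P -> P} :=
  dlift (fun x : A => scalar P (quoring_repr x)).

Lemma repr_eval_single P x (v : P) :
  repr_eval P (csingle (K := A) P x v) = quoring_repr x *: v.
Proof. exact: dlift_single. Qed.

Lemma repr_eval_tensor P (k : free_on A) (v : P) :
  repr_eval P (pure_tensor k v) = (repr_eval R^o k : R) *: v.
Proof.
move: k; apply: copower_ext => [a k l|a k l|x a].
- by rewrite /pure_tensor !linearP.
- rewrite linearP scalerDl scalerA; congr (_ + _).
by rewrite pure_tensor_single !repr_eval_single scalerA.
Qed.

Lemma repr_eval_aug (k : free_on A) : quoring_pi J (repr_eval R^o k) = aug A k.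
Proof.
move: k; apply: copower_ext => [a k l|a k l|x a].
- by rewrite linearP; exact: (linearP (quotpi J)).
- exact: linearP.
rewrite repr_eval_single aug_single -{2}[x]quoring_reprK.
rewrite -[RHS](linearZZ (quotpi J)); congr quotpi.
exact: mulrC.
Qed.

Lemma tensor1_repr P (u : copower A P) (uc : u \in cycles A P 0) :
  torcl uc = tensor1 P (repr_eval P u).
Proof.
have uP (w : copower A P) : w \in cycles A P 0 by apply/pack_submodP.
have clL : linear (fun w : copower A P => torcl (uP w)).
  move=> a v w; rewrite (torcl_lin _ _ (uP _)).
  by congr quotpi; exact: val_inj.
rewrite (bool_irrelevance uc (uP u)); move: u {uc}.
apply: copower_ext => [//|a v w|x v]; first exact: (linearP (tensor1 P \o repr_eval P)).
rewrite repr_eval_single; apply/torcl_eq/immodP.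
(* [x] and r [1], with r representing x, have the same augmentation; their difference is a syzygy,
   whose basis element bounds what is needed. *)
pose k : free_on A := csingle (K := A) R^o x 1 -
  csingle (K := A) R^o (quoring_pi J 1) (quoring_repr x).
have kK : k \in kermod (aug A).
  apply/kermodP; rewrite linearB !aug_single scale1r; apply/eqP; rewrite subr_eq0.
  apply/eqP; rewrite -{1}[x]quoring_reprK -[RHS](linearZZ (quotpi J)).
  by congr quotpi; rewrite /GRing.scale /= mulr1.
exists (csingle (K := syzygy A) P (SubmodOf kK) v); rewrite diff_single.
apply: dsumP => y.
rewrite -[LHS]/((dcoef (csingle (K := A) R^o x 1) y -
  dcoef (csingle (K := A) R^o (quoring_pi J 1) (quoring_repr x)) y) *: v).
rewrite scalerBl; congr (_ - _).
  by rewrite -[v in RHS]scale1r -pure_tensor_single.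
by rewrite -pure_tensor_single.
Qed.

Lemma tensor1_surj P (t : Tor A P 0) : exists p, t = tensor1 P p.
Proof. by have [u [uc ->]] := torclP t; exists (repr_eval P u); exact: tensor1_repr. Qed.

Lemma tensor1_act P p : p \in ideal_act J (fullmod P) -> tensor1 P p = 0.
Proof.
move=> pJ; apply/kermodP; move: p pJ; apply: span_sub => _ [a [u [aJ _ ->]]].
apply/kermodP; rewrite linearZ; apply: tor_ann => x; exact: quoring_ann.
Qed.

(** [repr_eval] carries boundaries into JP, because with coefficients in R it sends a syzygy of R/J
    into [J]. *)
Lemma tensor1_eq0 P p : tensor1 P p = 0 -> p \in ideal_act J (fullmod P).
Proof.
set T := ideal_act J (fullmod P); move=> /torcl_eq0/immodP[w dw].
have bd (u : copower (syzygy A) P) : repr_eval P (diff A P u) \in T.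
  apply/quotpi_eq0; rewrite -[LHS]/((quotpi T \o repr_eval P \o diff A P) u).
  transitivity ((\0 : {linear copower (syzygy A) P -> quotmod T}) u) => //.
  move: u; apply: copower_ext => [a u v|a u v|x v]; rewrite ?linearP //.
  rewrite /comp diff_single repr_eval_tensor; apply: quotpi0.
  apply: mem_ideal_act; last exact/pack_submodP.
  apply/quotpi_eq0; rewrite [LHS]repr_eval_aug; exact/kermodP/valP.
have := bd w; rewrite dw repr_eval_single => rT.
(* The chosen representative of 1 is only congruent to 1 modulo [J]. *)
have -> : p = quoring_repr (quoring_pi J 1) *: p + (1 - quoring_repr (quoring_pi J 1)) *: p.
  by rewrite -scalerDl addrC subrK scale1r.
apply: rpredD => //; apply: mem_ideal_act; last exact/pack_submodP.
by apply/quotpi_eq; rewrite quotreprK.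
Qed.

Lemma tensor1_mapr P P' (h : {linear P -> P'}) p :
  tor_mapr A h 0 (tensor1 P p) = tensor1 P' (h p).
Proof.
have c := tor_mapr_cycles h (tensor1_subproof p).
rewrite [LHS](tor_maprE _ c); congr quotpi; apply: val_inj.
exact: coef_map_single.
Qed.
End TensorQuotient.

Lemma tensor1_mapl (R : comPzRingType) (J J' : ideal R) (JJ : {subset J <= J'})
    (P : lmodType R) p :
  tor_mapl P (quoring_proj JJ) 0 (tensor1 J P p) = tensor1 J' P p.
Proof.
have c := tor_mapl_cycles (quoring_proj JJ) (tensor1_subproof J p).
rewrite [LHS](tor_maplE _ c); congr quotpi; apply: val_inj.
apply: (etrans (push_single _ _ _)).
exact: (congr1 (fun x => csingle P x p) (quoring_projE JJ 1)).
Qed.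

(** * Separated modules over the completion *)

Lemma noeth_mod_full (R : pzRingType) (V : lmodType R) (T : submodClosed V) :
  (forall v, v \in T) -> noeth_mod T.
Proof. by move=> fT S SS TS; exists 0%N => k _ v _; apply: TS. Qed.

Section CompletionSeries.
Variables (R : comPzRingType) (m : ideal R) (x : R).
Hypothesis xm : (x : R^o) \in m.
Local Notation C := (completion m).
Local Notation x' := (completion_of m x).

(** Level s of the power series with terms x^k c_k: those with k >= s vanish there because x^s lies
    in m^s. *)
Definition series_coord (c : nat -> C) s : quoring (ideal_pow m s) :=
  \sum_(k < s) quoring_pi _ x ^+ k * ccoord (c k) s.

Lemma quoring_expr0 s : quoring_pi (ideal_pow m s) x ^+ s = 0.
Proof.
have -> k : quoring_pi (ideal_pow m s) x ^+ k = quoring_pi (ideal_pow m s) (x ^+ k).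
  by elim: k => // k IH; rewrite !exprS IH quoring_piM.
by apply: quotpi0; exact: ideal_pow_exp.
Qed.

Lemma adic_projX s k : adic_proj m s (quoring_pi _ x ^+ k) = quoring_pi _ x ^+ k.
Proof.
elim: k => [|k IH]; first exact: quoring_projE.
by rewrite !exprS [LHS]quoring_projM IH; congr (_ * _); exact: quoring_projE.
Qed.

Lemma series_coordP c s : adic_proj m s (series_coord c s.+1) = series_coord c s.
Proof.
have projE k : adic_proj m s (quoring_pi _ x ^+ k * ccoord (c k) s.+1) =
    quoring_pi _ x ^+ k * ccoord (c k) s.
  by rewrite [LHS]quoring_projM; congr (_ * _); [exact: adic_projX|exact: ccoordP].
transitivity (\sum_(k < s.+1) quoring_pi (ideal_pow m s) x ^+ k * ccoord (c k) s).
  by rewrite /series_coord raddf_sum; apply: eq_bigr => k _; exact: projE.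
by rewrite big_ord_recr /= quoring_expr0 mul0r addr0.
Qed.

Definition series (c : nat -> C) : C := invlim_mk (series_coordP c).

Lemma seriesS c : series c = c 0%N + x' * series (c \o succn).
Proof.
apply: completionP => s.
rewrite -[RHS]/(ccoord (c 0%N) s + quoring_pi _ x * series_coord (c \o succn) s).
rewrite -[LHS]addr0 -[X in _ + X](mul0r (ccoord (c s) s)) -(quoring_expr0 s).
rewrite -[LHS]/(\sum_(k < s) quoring_pi _ x ^+ k * ccoord (c k) s +
  quoring_pi _ x ^+ s * ccoord (c s) s).
rewrite -(big_ord_recr s (fun k : 'I_s.+1 => quoring_pi _ x ^+ k * ccoord (c k) s)) /=.
rewrite big_ord_recl expr0 mul1r /series_coord mulr_sumr; congr (_ + _).
by apply: eq_bigr => k _; rewrite exprS mulrA.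
Qed.

Lemma series_tail c n :
  series c = \sum_(k < n) x' ^+ k * c k + x' ^+ n * series (fun k => c (n + k)%N).
Proof.
elim: n c => [|n IH] c; first by rewrite big_ord0 add0r mul1r.
rewrite IH (seriesS (fun k => c (n + k)%N)) big_ord_recr /= addn0 mulrDr addrA.
rewrite mulrA -exprSr; congr (_ + _ * _); congr series.
by apply: functional_extensionality_dep => k; rewrite /= addnS addSn.
Qed.

Section Noetherian.
Variable V : lmodType C.
Hypothesis separated : forall v : V, (forall n, exists w, v = x' ^+ n *: w) -> v = 0.
Hypothesis noethV : noetherian (quotmod (immod (scalar V x'))).
Variable S : nat -> submodClosed V.
Hypothesis S_incr : forall n, {subset S n <= S n.+1}.

Lemma lead_submod_prop n k :
  submod_prop [set v | exists w, x' ^+ k *: v + x' ^+ k.+1 *: w \in S n].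
Proof.
split=> [|a u v [w uw] [t vt]]; first by exists 0; rewrite !scaler0 addr0 rpred0.
exists (a *: w + t); have := rpredD (rpredZ a uw) vt.
rewrite !scalerDr !scalerA [a * x' ^+ k]mulrC [a * x' ^+ k.+1]mulrC -!scalerA.
by rewrite addrACA.
Qed.
(** Leading coefficients of the elements of [S n] of x-order at least k. They contain xV, so they
    amount to submodules of V/xV, and they grow with both n and k. *)
Definition lead n k := pack_submod (lead_submod_prop n k).

Lemma leadP n k v :
  reflect (exists w, x' ^+ k *: v + x' ^+ k.+1 *: w \in S n) (v \in lead n k).
Proof. exact: pack_submodP. Qed.

Lemma lead_im n k : {subset immod (scalar V x') <= lead n k}.
Proof.
move=> _ /immodP[v <-]; apply/leadP; exists (- v).
by rewrite pack_linearE scalerA -exprSr scalerN subrr rpred0.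
Qed.

Lemma lead_lel n n' k : (n <= n')%N -> {subset lead n k <= lead n' k}.
Proof. by move=> nn v /leadP[w vw]; apply/leadP; exists w; exact: (chain_le S_incr nn). Qed.

Lemma lead_ler n k k' : (k <= k')%N -> {subset lead n k <= lead n k'}.
Proof.
apply: (@chain_le _ _ (lead n)) => {k'}k' v /leadP[w vw]; apply/leadP; exists w.
have := rpredZ x' vw; rewrite scalerDr !scalerA -!exprS.
by [].
Qed.

(** The diagonal chain [lead n n] stops at some n0, which by monotonicity settles all orders k >= n0
    at once; the finitely many chains with k < n0 stop before a common N. *)
Lemma lead_stable : exists n0 N, [/\ (n0 <= N)%N,
  forall n k, (n0 <= k)%N -> {subset lead n k <= lead n0 n0} &
  forall n k, (k < n0)%N -> {subset lead n k <= lead N k}].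
Proof.
have nV := quot_noeth_mod noethV.
have [n v|v /lead_im//|n0 n0P] := nV (fun n => lead n n).
  by move=> /(lead_lel (leqnSn n))/(lead_ler (leqnSn n)).
have /choice[f fP] : forall k, exists nk, forall n, (nk <= n)%N ->
    {subset lead n k <= lead nk k}.
  move=> k; apply: (nV (fun n => lead n k)) => [n|v /lead_im//].
  exact: lead_lel.
exists n0, (n0 + \sum_(k < n0) f k)%N; split=> [|n k nk v vL|n k kn v vL].
- exact: leq_addr.
- apply: (n0P (maxn n k)); first by rewrite (leq_trans nk) ?leq_maxr.
  by apply: (lead_ler (leq_maxr n k)); exact: (lead_lel (leq_maxl n k)).
apply: (lead_lel (n := f k)).
  by rewrite (bigD1 (Ordinal kn)) //= addnCA leq_addr.
by apply: (fP k (maxn (f k) n)); rewrite ?leq_maxl //; exact: (lead_lel (leq_maxr _ _)).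
Qed.

Lemma lead_generators n0 : exists p (g : nat -> V),
  (forall j, (j < p)%N -> g j \in lead n0 n0) /\
  forall v, v \in lead n0 n0 -> exists (c : nat -> C) u,
    v = \sum_(j < p) c j *: g j + x' *: u.
Proof.
have [l lL Ll] := noetherian_fg (imagemod (quotpi (immod (scalar V x'))) (lead n0 n0)) noethV.
exists (size l), (fun j => quotrepr l`_j); split=> [j jl|v vL].
  have /lL/imagemodP[y yL yl] := mem_nth 0 jl.
  rewrite -(subrK y (quotrepr _)); apply: rpredD => //.
  by apply: (lead_im n0 n0); apply/quotpi_eq; rewrite quotreprK.
have : quotpi (immod (scalar V x')) v \in spanl l.
  by rewrite -Ll; apply/imagemodP; exists v.
move=> /spanl_sum[c cv]; exists c.
have /immodP[u uE] : v - \sum_(j < size l) c j *: quotrepr l`_j \in immod (scalar V x').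
  apply/quotpi_eq; rewrite cv raddf_sum; apply: eq_bigr => j _.
  by rewrite -[LHS]/(c j *: l`_j) -{1}[l`_j]quotreprK; exact/esym/linearZ.
by exists u; rewrite -[x' *: u]/(scalar V x' u) uE addrC subrK.
Qed.

(* Successive approximation: the quotients of an element of S n lying in x^n0 V by
   the leading generators are summed as power series in x. *)
Lemma deep_stable n0 n : (forall k, (n0 <= k)%N -> {subset lead n k <= lead n0 n0}) ->
  (n0 <= n)%N -> forall v, x' ^+ n0 *: v \in S n -> x' ^+ n0 *: v \in S n0.
Proof.
move=> nP n0n v vS; have [p [g [gL Lg]]] := lead_generators n0.
have /choice[w wP] : forall j, exists w, (j < p)%N ->
    x' ^+ n0 *: g j + x' ^+ n0.+1 *: w \in S n0.
  move=> j; case: (ltnP j p) => jp; last by exists 0.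
  by have /leadP[w ?] := gL j jp; exists w.
pose sg j := x' ^+ n0 *: g j + x' ^+ n0.+1 *: w j.
(* One division: the leading coefficient of an element of [S n] of order i + n0 lies in
   [lead n0 n0], so a combination of the x^i [sg j] removes it and leaves a remainder of order i + 1
   + n0. *)
have step (iu : nat * V) : exists cu : (nat -> C) * V,
    x' ^+ (iu.1 + n0) *: iu.2 \in S n ->
    x' ^+ (iu.1 + n0) *: iu.2 =
      x' ^+ iu.1 *: (\sum_(j < p) cu.1 j *: sg j) + x' ^+ (iu.1.+1 + n0) *: cu.2.
  have [uS|] := boolP (x' ^+ (iu.1 + n0) *: iu.2 \in S n); last by exists (fun=> 0, 0).
  have /Lg[c [u uE]] : iu.2 \in lead n0 n0.
    apply: (nP (iu.1 + n0)%N (leq_addl _ _)); apply/leadP; exists 0.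
    by rewrite scaler0 addr0.
  exists (c, u - \sum_(j < p) c j *: w j) => _.
  rewrite addSnnS /= !exprD -!scalerA -scalerDr; congr (_ *: _).
  have -> : \sum_(j < p) c j *: sg j = x' ^+ n0 *: (\sum_(j < p) c j *: g j) +
      x' ^+ n0.+1 *: (\sum_(j < p) c j *: w j).
    rewrite !scaler_sumr -big_split; apply: eq_bigr => j _.
    by rewrite scalerDr !scalerA mulrC [c j * _]mulrC.
  by rewrite uE scalerDr scalerA -exprSr scalerBr -addrA [X in _ = _ + X]addrC subrK.
have /choice[F FP] := step.
pose fix vs i := if i is i'.+1 then (F (i', vs i')).2 else v.
pose cs i := (F (i, vs i)).1.
have sgS j : (j < p)%N -> sg j \in S n0 by exact: wP.
have vsS i : x' ^+ (i + n0) *: vs i \in S n.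
  elim: i => // i IH.
  have e : x' ^+ (i + n0) *: vs i =
    x' ^+ i *: (\sum_(j < p) cs i j *: sg j) + x' ^+ (i.+1 + n0) *: vs i.+1.
    exact: FP (i, vs i) IH.
  have -> : x' ^+ (i.+1 + n0) *: vs i.+1 =
    x' ^+ (i + n0) *: vs i + -1 *: (x' ^+ i *: (\sum_(j < p) cs i j *: sg j)).
    by rewrite e scaleN1r addrC addKr.
  apply: (rpredD IH); apply/rpredZ/rpredZ.
  by apply: rpred_sum => j _; rewrite rpredZ // (chain_le S_incr n0n) // sgS.
have sumE q : x' ^+ n0 *: v =
    \sum_(j < p) (\sum_(i < q) x' ^+ i * cs i j) *: sg j + x' ^+ (q + n0) *: vs q.
  elim: q => [|q IH].
    by rewrite big1 ?add0r // => j _; rewrite big_ord0 scale0r.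
  rewrite [LHS]IH (FP (q, vs q) (vsS q)) addrA; congr (_ + _).
  rewrite scaler_sumr -big_split; apply: eq_bigr => j _ /=.
  by rewrite scalerA -scalerDl big_ord_recr.
suff -> : x' ^+ n0 *: v = \sum_(j < p) series (cs^~ j) *: sg j.
  by apply: rpred_sum => j _; rewrite rpredZ // sgS.
(* For every q, stopping after q divisions shows that the two sides differ by a multiple of x^q. *)
apply/eqP; rewrite -subr_eq0; apply/eqP; apply: separated => q.
exists (x' ^+ n0 *: vs q - \sum_(j < p) series (fun i => cs (q + i)%N j) *: sg j).
have -> : \sum_(j < p) series (cs^~ j) *: sg j =
    \sum_(j < p) (\sum_(i < q) x' ^+ i * cs i j) *: sg j +
    x' ^+ q *: (\sum_(j < p) series (fun i => cs (q + i)%N j) *: sg j).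
  rewrite scaler_sumr -big_split; apply: eq_bigr => j _ /=.
  by rewrite (series_tail _ q) scalerDl scalerA.
rewrite (sumE q) opprD addrACA subrr add0r exprD -scalerA.
by rewrite scalerBr.
Qed.

(** Descending induction on the order n0 - d. Order n0 is [deep_stable]; below it, an element of
    [S n] shares its leading coefficient with one of [S N], and the difference has higher order. *)
Lemma noetherian_chain : exists n, forall k, (n <= k)%N -> S k =i S n.
Proof.
have [n0 [N [n0N hi lo]]] := lead_stable.
exists N => n Nn; suff sub d : (d <= n0)%N -> forall v,
    x' ^+ (n0 - d) *: v \in S n -> x' ^+ (n0 - d) *: v \in S N.
  move=> v; apply/idP/idP => [vS|]; last exact: (chain_le S_incr).
  by have := sub n0 (leqnn _) v; rewrite subnn expr0 scale1r; apply.
elim: d => [|d IH] dn v; rewrite ?subn0 => vS.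
  by apply: (chain_le S_incr n0N); apply: deep_stable (hi n) (leq_trans n0N Nn) _ vS.
have dE : (n0 - d = (n0 - d.+1).+1)%N by rewrite subnSK.
have /leadP[w wS] : v \in lead N (n0 - d.+1).
  apply: (lo n); first by rewrite ltn_subrL (leq_trans _ dn).
  by apply/leadP; exists 0; rewrite scaler0 addr0.
have wS' : x' ^+ (n0 - d) *: w \in S N.
  apply: (IH (ltnW dn)); rewrite dE -[X in X \in _](addKr (x' ^+ (n0 - d.+1) *: v)).
  apply: rpredD; last exact: (chain_le S_incr Nn).
  by rewrite -scaleN1r rpredZ.
rewrite -[X in X \in _](addrK (x' ^+ (n0 - d.+1).+1 *: w)).
by apply: rpredD => //; rewrite -dE -scaleN1r rpredZ.
Qed.
End Noetherian.

Lemma separated_noetherian (V : lmodType C) :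
  (forall v : V, (forall n, exists w, v = x' ^+ n *: w) -> v = 0) ->
  noetherian (quotmod (immod (scalar V x'))) -> noetherian V.
Proof. by move=> sV nV S SS; exact: noetherian_chain. Qed.
End CompletionSeries.

(** * Local homology of artinian modules *)

Lemma tor_delta_im (R : comPzRingType) (A N' N N'' : lmodType R)
    (f : {linear N' -> N}) (g : {linear N -> N''}) n t'' t' :
  tor_delta (A := A) (n := n) f g t'' t' -> tor_mapr A f n t' = 0.
Proof.
case=> w [z [wc [zc [_ -> wz]]]].
rewrite (tor_maprE zc (tor_mapr_cycles f zc)); apply/torcl_eq0/immodP.
by exists w.
Qed.

Section NoetherianVanishing.
Variables (R : comPzRingType) (m : ideal R).
Hypothesis noethR : noetherian (R^o : lmodType R).
Implicit Types N L P : lmodType R.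
Local Notation H := (local_homology m).
Local Notation Hmap := (local_homology_map m).

Lemma lcoord0_le N (x : H N 0) k s p : (k <= s)%N ->
  lcoord x s = tensor1 _ N p -> lcoord x k = tensor1 _ N p.
Proof.
move=> ks; rewrite -(subnKC ks); elim: (s - k)%N => [|j IH]; first by rewrite addn0.
rewrite addnS => xp; apply: IH; rewrite -lcoordP xp; exact: tensor1_mapl.
Qed.

(** H_0 is the m-adic completion, and by Artin-Rees the elements of [L] sent into m^s P lie in m^k L
    for s large. *)
Lemma lh0_inj L P (f : {linear L -> P}) (x : H L 0) : noetherian P ->
  (forall x, f x = 0 -> x = 0) -> Hmap f 0 x = 0 -> x = 0.
Proof.
move=> nP fi fx; apply: local_homologyP => k.
have [l lm ml] := noetherian_fg m noethR.
have ml' : {subset m <= spanl l} by move=> y; rewrite ml.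
have [s sP] := artin_rees (immod f) k lm ml' nP.
have [p xp] := tensor1_surj (lcoord x (maxn s k)).
rewrite (lcoord0_le (leq_maxr s k) xp); apply: tensor1_act.
have fp : tensor1 (ideal_pow m (maxn s k)) P (f p) = 0.
  by rewrite -tensor1_mapr -xp -lh_map_coord fx.
have {}fp : f p \in ideal_act (ideal_pow m s) (fullmod P).
  move: (tensor1_eq0 fp); apply: span_sub => _ [a [u [am uP ->]]].
  by apply: mem_ideal_act => //; exact: (ideal_pow_le (leq_maxl s k)).
have fpi : f p \in immod f by apply/immodP; exists p.
have /imagemodP[q qL /eqP] : f p \in imagemod f (ideal_act (ideal_pow m k) (fullmod L)).
  move: (sP _ fpi fp); apply: span_sub => _ [a [_ [am /immodP[q <-] ->]]].
  apply/imagemodP; exists (a *: q); last exact: linearZ.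
  by apply: mem_ideal_act => //; exact/pack_submodP.
by rewrite -subr_eq0 -linearB => /eqP/fi/eqP; rewrite subr_eq0 => /eqP <-.
Qed.

(** Dimension shifting: cover [N] by an acyclic noetherian [P] with kernel [L]. The connecting map
    from H_(i+1)(N) to H_i(L) is injective, and its values die in H_i(P). *)
Lemma lh_shift i :
  (forall L P (f : {linear L -> P}) (x : H L i), noetherian P ->
    (forall x, f x = 0 -> x = 0) -> Hmap f i x = 0 -> x = 0) ->
  forall N (x : H N i.+1), noetherian N -> x = 0.
Proof.
move=> inj N x nN; have [P [g [nP aP gs]]] := free_cover noethR nN.
have fg := ker_short_exact gs; have [fi _ _] := fg.
have [x' xd] := lh_delta_total fg x.
have x'0 : x' = 0.
  apply: (inj _ _ _ _ nP fi).
  by apply: local_homologyP => s; exact: tor_delta_im (xd s).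
apply: local_homologyP => s; have := xd s; rewrite x'0.
by move=> /(tor_delta_exactl fg)[t <-]; rewrite (aP _ _ t) raddf0.
Qed.

Lemma lh_noetherian_eq0 i N (x : H N i.+1) : noetherian N -> x = 0.
Proof.
elim: i N x => [|i IH]; apply: lh_shift => L P f x nP fi.
  exact: (lh0_inj nP fi).
by move=> _; apply: IH; exact: (inj_noetherian fi nP).
Qed.

(** As mN = 0, all N/m^s N with s >= 1 are N, so H_0(N) embeds in its coordinate at s = 1, which is
    noetherian over R. *)
Lemma lh0_killed_noetherian N : noetherian N ->
  (forall (a : R^o) (x : N), a \in m -> a *: x = 0) -> noetherian (H N 0).
Proof.
move=> nN mN; have inj (x : H N 0) : lcoord x 1 = 0 -> x = 0.
  move=> x1; apply: local_homologyP => s.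
  have [p xp] := tensor1_surj (lcoord x s.+1).
  rewrite (lcoord0_le (leqnSn s) xp).
  suff -> : p = 0 by rewrite raddf0.
  have p0 : tensor1 (ideal_pow m 1) N p = 0 by rewrite -(lcoord0_le _ xp).
  have /kermodP : p \in kermod (idfun : {linear N -> N}); last by [].
  move: (tensor1_eq0 p0); apply: span_sub => _ [a [u [am _ ->]]].
  by apply/kermodP; apply: mN; exact: ideal_pow_sub1 am.
have nT : noetherian (adic_tor m N 0 1).
  apply: (tor_serre noethR (P := @noetherian R)) nN; first exact: noetherian_serre.
  exact: quot_noetherian.
move=> S SS.
(* Submodules over the completion have R-submodules as images, since [completion_of m a] acts on
   coordinates as [a]. *)
have TP n : submod_prop [set t : adic_tor m N 0 1 | exists2 x, x \in S n & lcoord x 1 = t].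
  split; first by exists 0; rewrite ?rpred0.
  move=> a _ _ [x xS <-] [y yS <-]; exists (completion_of m a *: x + y).
    by rewrite rpredD ?rpredZ.
  by congr (_ + _); exact: local_homology_scaleE.
have [|n nS] := nT (fun n => pack_submod (TP n)).
  by move=> n t /pack_submodP[x xS <-]; apply/pack_submodP; exists x => //; exact: SS.
exists n => k nk x; apply/idP/idP => [xk|]; last exact: (chain_le SS).
have : lcoord x 1 \in pack_submod (TP k) by apply/pack_submodP; exists x.
rewrite nS // => /pack_submodP[y yS yx].
rewrite -(subrK y x) (inj (x - y)) ?add0r // -[LHS]/(lcoord x 1 - lcoord y 1).
by rewrite yx subrr.
Qed.

Hypothesis m_max : maximal_ideal m.

Lemma lh_killed_noetherian i N : artinian N ->
  (forall (a : R^o) (x : N), a \in m -> a *: x = 0) -> noetherian (H N i).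
Proof.
move=> aN mN; have nN : noetherian N.
  by apply: (artinian_killed_noetherian m_max aN) => a v /mN.
case: i => [|i]; first exact: lh0_killed_noetherian.
move=> S SS; exists 0%N => k _ x.
by rewrite (lh_noetherian_eq0 x nN) !rpred0.
Qed.

Lemma lh_scalar N y i (x : H N i) :
  Hmap (scalar N y) i x = completion_of m y *: x.
Proof.
apply: local_homologyP => s.
rewrite [RHS](@local_homology_scaleE _ _ _ _ y) // lh_map_coord.
have [z [zc ->]] := torclP (lcoord x s).
rewrite (tor_maprE zc (tor_mapr_cycles _ zc)) -[RHS]linearZ; congr quotpi.
by apply: val_inj; apply: dsumP.
Qed.

(** H_i(N) is y-adically separated because y^s kills level s, and its quotient by y embeds in
    H_(i-1)(0 :_N y). For i = 0 multiplication by y is already onto. *)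
Lemma lh_div_noetherian i N (y : R^o) : y \in m -> artinian N ->
  (forall v : N, exists w, v = y *: w) ->
  (forall j, i = j.+1 -> forall K, artinian K -> noetherian (H K j)) ->
  noetherian (H N i).
Proof.
move=> ym aN yN IH; apply: (separated_noetherian ym) => [v vy|].
  apply: local_homologyP => s; have [w ->] := vy s.
  have -> : completion_of m y ^+ s = completion_of m (y ^+ s).
    elim: s => // s IHs; rewrite !exprS IHs.
    by apply: completionP => k; exact/esym/quoring_piM.
  transitivity ((y ^+ s : R) *: lcoord w s); first exact: local_homology_scaleE.
  by apply: adic_tor_ann; exact: ideal_pow_exp.
have ys (v : N) : exists w, scalar N y w = v.
  by have [w ->] := yN v; exists w.
have fg := ker_short_exact ys.
apply: noeth_mod_quot; case: i IH => [_|i IH].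
  apply: noeth_mod_full => v; apply/immodP.
  have [w wv] := lh0_surj noethR fg v aN; exists w.
  by rewrite pack_linearE -lh_scalar.
have [d dP] := linear_of_rel (lh_delta_total fg (i := i))
  (fun a u v u' v' => @lh_delta_lin _ m _ _ _ _ _ i a u u' v v')
  (@lh_delta_fun0 _ m _ _ _ _ _ fg i).
apply: (exact_noeth_mod (f := scalar (H N i.+1) (completion_of m y)) (g := d)
  (T' := fullmod (H N i.+1))) => [v dv|||u _].
- have := dP v; rewrite dv => /(lh_delta_exactl noethR fg aN)[w <-].
  by exists w; rewrite pack_linearE -lh_scalar.
- by apply: noeth_mod_full => v; exact/pack_submodP.
- by apply: IH => //; exact: sub_artinian.
- by apply/immodP; exists u.
Qed.

Lemma lh_exact_noetherian i N' N N'' (f : {linear N' -> N}) (g : {linear N -> N''}) :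
  short_exact f g -> artinian N' -> noetherian (H N' i) -> noetherian (H N'' i) ->
  noetherian (H N i).
Proof.
move=> fg aN; apply: (exact_noetherian (f := Hmap f i) (g := Hmap g i)) => v.
exact: lh_exact.
Qed.

Lemma lh_artinian_noetherian i N : artinian N -> noetherian (H N i).
Proof.
elim/ltn_ind: i N => i IHi N.
have [l lm ml] := noetherian_fg m noethR.
(* [l'] holds the generators of [m] that may still act nontrivially; when it is empty, [m] kills
   [N]. *)
suff: forall (l' : seq R^o) N, artinian N -> {subset l' <= l} ->
    (forall y : R^o, y \in l -> y \notin l' -> forall x : N, y *: x = 0) -> noetherian (H N i).
  by move=> /(_ l N) + aN; apply=> // y yl /negP.
elim=> [|y l' IH] {}N aN ll lN.
  apply: lh_killed_noetherian => // a x; rewrite ml.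
  suff sub : {subset spanl l <= kermod (scale_by x)} by move/sub/kermodP.
  by apply: span_sub => z zl; apply/kermodP; exact: lN.
have yl : y \in l by apply: ll; rewrite mem_head.
have l'l : {subset l' <= l} by move=> z zl; apply: ll; rewrite in_cons zl orbT.
(* Modules killed by a power of [y]: yM is killed by one power less, and M/yM falls under the case
   of [l']. *)
have nil n M : artinian M -> (forall x : M, y ^+ n *: x = 0) ->
    (forall z : R^o, z \in l -> z \notin y :: l' -> forall x : M, z *: x = 0) ->
    noetherian (H M i).
  elim: n M => [|n IHn] M aM yM lM.
    by apply: IH => // z zl zl' x; move: (yM (z *: x)); rewrite expr0 scale1r.
  apply: (lh_exact_noetherian (sub_short_exact (immod (scalar M y)))).
  - exact: sub_artinian.
  - apply: IHn => [|x|z zl zl' x]; first exact: sub_artinian.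
      apply: val_inj; have /immodP[v vx] := valP x.
      by rewrite submod_valZ -vx pack_linearE scalerA -exprSr yM.
    by apply: val_inj; rewrite submod_valZ lM.
  - apply: IH => [||z zl zl' x] //; first exact: quot_artinian.
    rewrite -(quotreprK x) -linearZ; apply: quotpi0; apply/immodP.
    have [->|zy] := eqVneq z y; first by exists (quotrepr x).
    exists 0; rewrite raddf0; apply/esym/lM => //.
    by rewrite in_cons negb_or zy.
(* Now [y] acts surjectively on y^n N, and y^n kills N/y^n N. That n >= 1 allows a factor [y] to be
   split off y^n. *)
have [n n1 nP] := fitting y 1 aN.
apply: (lh_exact_noetherian (sub_short_exact (immod (scalar N (y ^+ n))))).
- exact: sub_artinian.
- apply: (@lh_div_noetherian _ _ y); first exact: lm.
  + exact: sub_artinian.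
  + move=> v; have /immodP[u uv] := valP v.
    have [w wE] := nP u.
    have wS : y ^+ n *: (y ^+ n.-1 *: w) \in immod (scalar N (y ^+ n)).
      by apply/immodP; exists (y ^+ n.-1 *: w).
    exists (SubmodOf wS); apply: val_inj; rewrite submod_valZ -uv pack_linearE wE /=.
    rewrite !scalerA; congr (_ *: _).
    by rewrite -?mulrA [RHS]mulrCA -exprS prednK.
  + by move=> j ij K aK; apply: IHi => //; rewrite ij.
- apply: (nil n); first exact: quot_artinian.
  + move=> x; rewrite -(quotreprK x) -linearZ; apply: quotpi0.
    by apply/immodP; exists (quotrepr x).
  + move=> z zl zl' x; rewrite -(quotreprK x) -linearZ lN //; exact: raddf0.
Qed.
End NoetherianVanishing.

(** * Formal local homology *)

Section DirectLimit.
Variables (R : pzRingType) (D : nat -> lmodType R).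
Variable f : forall t, {linear D t -> D t.+1}.

Definition dirlim_in t : {linear D t -> dirlim f} := quotpi _ \o dsingle D t.

Lemma dirlim_inS t x : dirlim_in t.+1 (f t x) = dirlim_in t x.
Proof.
apply/esym/quotpi_eq; by apply: mem_span; exists t, x.
Qed.

Lemma dirlim_in_le t u x : (t <= u)%N -> exists y, dirlim_in t x = dirlim_in u y.
Proof.
move=> tu; rewrite -(subnKC tu); elim: (u - t)%N => [|k [y ->]].
  by rewrite addn0; exists x.
by rewrite addnS; exists (f _ y); rewrite dirlim_inS.
Qed.

Lemma dirlim_surj (y : dirlim f) : exists t x, y = dirlim_in t x.
Proof.
have SP : submod_prop [set y | exists t x, y = dirlim_in t x].
  split; first by exists 0%N, 0; rewrite raddf0.
  move=> a _ _ [t [x ->]] [u [y0 ->]].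
  have [x' ->] := dirlim_in_le x (leq_maxl t u).
  have [y' ->] := dirlim_in_le y0 (leq_maxr t u).
  by exists (maxn t u), (a *: x' + y'); rewrite linearP.
apply/(pack_submodP SP); rewrite -(quotreprK y); apply/quotpi_eq0.
rewrite -[LHS]/((quotpi (pack_submod SP) \o quotpi _) (quotrepr y)).
transitivity ((\0 : {linear dsum D -> quotmod (pack_submod SP)}) (quotrepr y)) => //.
apply: dsum_ext => t x; apply: quotpi0; apply/pack_submodP.
by exists t, x.
Qed.

Lemma dcoef_map_is_linear t : linear (fun z : dsum D => dcoef z t).
Proof. by []. Qed.
Definition dcoef_map t : {linear dsum D -> D t} := pack_linear (@dcoef_map_is_linear t).

(* The image in D u of the components of index at most u. *)
Fixpoint collect u : {linear dsum D -> D u} :=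
  if u is u'.+1 return {linear dsum D -> D u}
  then f u' \o collect u' \+ dcoef_map u'.+1 else dcoef_map 0%N.

Lemma collectS u z : collect u.+1 z = f u (collect u z) + dcoef z u.+1.
Proof. by []. Qed.

Lemma collect_lt t u x : (u < t)%N -> collect u (dsingle D t x) = 0.
Proof.
elim: u => [|u IH] ut; first by apply: dsingle_out; rewrite gtn_eqF.
by rewrite collectS IH ?raddf0 ?add0r 1?ltnW // dsingle_out // gtn_eqF.
Qed.

Lemma collect_eq t x : collect t (dsingle D t x) = x.
Proof.
case: t x => [|t] x; first exact: dsingle_in.
by rewrite collectS collect_lt // raddf0 add0r; exact: dsingle_in.
Qed.

Lemma collect_gt t u x : (t <= u)%N ->
  collect u.+1 (dsingle D t x) = f u (collect u (dsingle D t x)).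
Proof. by move=> tu; rewrite collectS dsingle_out ?addr0 // ltn_eqF. Qed.

(** The z for which [collect u z] vanishes for all large u form a submodule containing the defining
    relations, so a class that is zero in the limit is zero at a finite stage. *)
Lemma dirlim_eq0 t x : dirlim_in t x = 0 ->
  exists2 u, (t <= u)%N & collect u (dsingle D t x) = 0.
Proof.
pose P (z : dsum D) := exists N, forall u, (N <= u)%N -> collect u z = 0.
have PP : submod_prop [set z | P z].
  split; first by exists 0%N => u _; exact: raddf0.
  move=> a z z' [n nP] [n' nP']; exists (maxn n n') => u.
  by rewrite geq_max => /andP[nu nu']; rewrite linearP nP // nP' // scaler0 addr0.
move=> /quotpi_eq0 xs; have : dsingle D t x \in pack_submod PP.
  move: xs; move: (dsingle D t x); apply: span_sub => _ [s [y ->]].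
  apply/pack_submodP; exists s.+1 => u; rewrite linearB => su.
  apply/eqP; rewrite subr_eq0; apply/eqP; rewrite -(subnKC su).
  elim: (u - s.+1)%N => [|k IH]; rewrite ?addn0.
    by rewrite collect_gt // !collect_eq.
  have sk : (s < s.+1 + k)%N by rewrite leq_addr.
  by rewrite addnS [LHS]collect_gt ?(ltnW sk) // IH [RHS]collect_gt.
move=> /pack_submodP[n nP]; exists (maxn n t); first exact: leq_maxr.
by apply: nP; exact: leq_maxl.
Qed.
End DirectLimit.

(** * The long exact sequence of formal local homology *)

Section Formal.
Variables (R : comPzRingType) (m I : ideal R).
Implicit Types N M : lmodType R.
Local Notation H := (local_homology m).
Local Notation Hmap := (local_homology_map m).
Local Notation F := (formal_local_homology m I).
Local Notation ann M t := (annihilated M (ideal_pow I t)).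

Lemma ann_map_sub M M2 (g : {linear M -> M2}) t u (tu : (t <= u)%N) x :
  x \in ann M t -> g x \in ann M2 u.
Proof.
move=> /annihilatedP xt; apply/annihilatedP => a au.
by rewrite -linearZZ xt ?raddf0 //; exact: ideal_pow_le au.
Qed.

Definition ann_map M M2 (g : {linear M -> M2}) t u (tu : (t <= u)%N) :
    {linear submod_of (ann M t) -> submod_of (ann M2 u)} :=
  sub_map (@ann_map_sub _ _ g t u tu).
Local Notation inc M tu := (ann_map (idfun : {linear M -> M}) tu).

Definition fcl M i t : {linear H (submod_of (ann M t)) i -> F M i} :=
  dirlim_in (fun t => local_homology_map m (annihilated_incl M I t) i) t.

Lemma fcl_surj M i (y : F M i) : exists t x, y = fcl M i t x.
Proof. exact: dirlim_surj. Qed.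

Lemma fcl_up M i t u (tu : (t <= u)%N) x : fcl M i t x = fcl M i u (Hmap (inc M tu) i x).
Proof.
move: (tu); rewrite -(subnKC tu); elim: (u - t)%N => [|k IH] tk.
  move: tk; rewrite addn0 => tk; rewrite lh_map_id // => z.
  exact: val_inj.
have tk' : (t <= t + k)%N by exact: leq_addr.
rewrite (IH tk'); move: tk; rewrite addnS => tk.
rewrite -[LHS](@dirlim_inS _ _ (fun t => local_homology_map m (annihilated_incl M I t) i)).
congr (fcl _ _ _ _); apply/esym/lh_map_comp => z.
exact: val_inj.
Qed.

Lemma fcl_eq0 M i t x : fcl M i t x = 0 ->
  exists u (tu : (t <= u)%N), Hmap (inc M tu) i x = 0.
Proof.
move=> /dirlim_eq0[u tu cx]; exists u, tu; rewrite -cx {cx}.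
elim: u tu => [|u IH] tu.
  have t0 : t = 0%N by apply/eqP; rewrite -leqn0.
  subst t; rewrite collect_eq lh_map_id // => z; exact: val_inj.
case: (ltnP t u.+1) => [tu'|ut]; last first.
  have tE : t = u.+1 by apply/eqP; rewrite eqn_leq tu ut.
  subst t; rewrite collect_eq lh_map_id // => z; exact: val_inj.
rewrite collect_gt // -(IH tu'); apply: lh_map_comp => z.
exact: val_inj.
Qed.

Lemma fmap_subproof M M2 (g : {linear M -> M2}) i z :
  z \in submod_span [set z : dsum (fun t => H (submod_of (ann M t)) i) | exists t x,
    z = dsingle _ t x - dsingle _ t.+1 (local_homology_map m (annihilated_incl M I t) i x)] ->
  dmap (fun t => Hmap (ann_map g (leqnn t)) i) z \in
  submod_span [set z : dsum (fun t => H (submod_of (ann M2 t)) i) | exists t x,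
    z = dsingle _ t x - dsingle _ t.+1 (local_homology_map m (annihilated_incl M2 I t) i x)].
Proof.
rewrite -premodE; move: z; apply: span_sub => _ [t [x ->]].
rewrite premodE linearB !dmap_single; apply: mem_span.
exists t, (Hmap (ann_map g (leqnn t)) i x); congr (_ - dsingle _ _ _).
by apply: lh_map_square => z; exact: val_inj.
Qed.

Definition fmap M M2 (g : {linear M -> M2}) i : {linear F M i -> F M2 i} :=
  quot_map (@fmap_subproof M M2 g i).

Lemma fmap_fcl M M2 (g : {linear M -> M2}) i t x :
  fmap g i (fcl M i t x) = fcl M2 i t (Hmap (ann_map g (leqnn t)) i x).
Proof. by rewrite [LHS]quot_mapE; congr quotpi; exact: dmap_single. Qed.

Lemma fmap_comp M1 M2 M3 (h : {linear M1 -> M2}) (h' : {linear M2 -> M3})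
  (h'' : {linear M1 -> M3}) i : h'' =1 h' \o h ->
  forall y : F M1 i, fmap h'' i y = fmap h' i (fmap h i y).
Proof.
move=> hh y; have [t [x ->]] := @fcl_surj M1 i y.
rewrite (fmap_fcl h'') (fmap_fcl h) (fmap_fcl h'); congr (fcl _ _ _ _).
by apply: lh_map_comp => z; apply: val_inj; exact: hh.
Qed.

Lemma fmap_lin M M2 (h h1 h2 : {linear M -> M2}) (a : R) i :
  (forall x, h x = a *: h1 x + h2 x) ->
  forall y, fmap h i y = completion_of m a *: fmap h1 i y + fmap h2 i y.
Proof.
move=> hh y; have [t [x ->]] := fcl_surj y.
rewrite (fmap_fcl h) (fmap_fcl h1) (fmap_fcl h2).
transitivity (fcl M2 i t (completion_of m a *: Hmap (ann_map h1 (leqnn t)) i x +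
  Hmap (ann_map h2 (leqnn t)) i x)); last exact: linearP.
congr (fcl _ _ _ _).
by apply: lh_map_lin => z; apply: val_inj; exact: hh.
Qed.

Lemma fmap_scalar M (a : R) i y : fmap (scalar M a) i y = completion_of m a *: y.
Proof.
have [t [x ->]] := fcl_surj y; rewrite fmap_fcl -linearZZ; congr (fcl _ _ _ _).
rewrite -lh_scalar; apply: lh_map_eq => z.
exact: val_inj.
Qed.

Section ShortExact.
Variables (M' M M'' : lmodType R) (f : {linear M' -> M}) (g : {linear M -> M''}).
Hypothesis fg : short_exact f g.
Hypothesis noethR : noetherian (R^o : lmodType R).
Hypothesis aM' : artinian M'.
Hypothesis aM : artinian M.
Hypothesis aM'' : artinian M''.

(** (0 :_M I^t) need not map onto (0 :_M'' I^t). Replacing the latter by the image makes the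
    sequence exact at each t, and by [annim_cofinal] the limit is unchanged. *)
Definition annim t := imagemod g (ann M t).
Local Notation Q t := (submod_of (annim t)).

Lemma annim_sub t : {subset annim t <= ann M'' t}.
Proof. by move=> _ /imagemodP[x xt <-]; exact: ann_map_sub (leqnn t) x xt. Qed.

Lemma annim_le t u : (t <= u)%N -> {subset annim t <= annim u}.
Proof.
move=> tu _ /imagemodP[x xt <-]; apply/imagemodP; exists x => //.
exact: (@ann_map_sub _ _ idfun _ _ tu).
Qed.

(* Dual Artin-Rees: Fitting's decomposition X = y^n X + (0 :_X y^n) is applied
   successively to the generators y of I. *)
Lemma annim_cofinal t : exists2 u, (t <= u)%N & {subset ann M'' t <= annim u}.
Proof.
have [l lI Il] := noetherian_fg I noethR.
(* Each x in [X] is moved within its fibre of [g] to an element killed by a power of every generator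
   in [l']. *)
have kill (l' : seq R^o) (X : submodClosed M) : {subset l' <= I} ->
    (forall x, x \in X -> g x \in ann M'' t) ->
    exists k, forall x, x \in X -> exists x', [/\ x' \in X, g x' = g x &
      forall y : R^o, y \in l' -> y ^+ k *: x' = 0].
  elim: l' X => [|y l' IH] X l'I Xt; first by exists 0%N => x xX; exists x.
  have [n tn nP] := fitting y t (sub_artinian (S := X) aM).
  have [x xl'|x /capmodP[/Xt]//|k kP] := IH (capmod X (kermod (scalar M (y ^+ n)))).
    by apply: l'I; rewrite in_cons xl' orbT.
  exists (maxn n k) => x xX; have [w wE] := nP (SubmodOf xX).
  have {}wE : y ^+ n *: x = y ^+ n *: (y ^+ n *: val w).
    by have /(congr1 val) := wE; rewrite !submod_valZ.
  (* x - y^n w is killed by y^n, and has the same image as x because n >= t and I^t kills g(w). *)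
  have [|x' [/capmodP[x'X /kermodP]]] := kP (x - y ^+ n *: val w).
    apply/capmodP; split; last by apply/kermodP; rewrite pack_linearE scalerBr wE subrr.
    by rewrite -scaleN1r rpredD // rpredZ // rpredZ //; exact: valP.
  rewrite pack_linearE => x'n gx' x'k; exists x'; split=> // [|z].
    rewrite gx' linearB [g (_ *: _)]linearZZ.
    have /Xt/annihilatedP -> := valP w; first by rewrite subr0.
    apply: (ideal_pow_le tn); apply: ideal_pow_exp; apply: l'I; exact: mem_head.
  rewrite in_cons => /predU1P[->|zl'].
    by rewrite -(subnKC (leq_maxl n k)) exprD mulrC -scalerA x'n scaler0.
  by rewrite -(subnKC (leq_maxr n k)) exprD mulrC -scalerA x'k // scaler0.
have [x|k kP] := kill l (premod g (ann M'' t)) lI; first by rewrite premodE.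
pose u := (\sum_(y <- l) k).+1; exists (maxn t u); first exact: leq_maxl.
move=> z zt; have [_ gs _] := fg; have [x xz] := gs z.
have [|x' [_ gx' x'k]] := kP x; first by rewrite premodE xz.
apply/imagemodP; exists x'; last by rewrite gx'.
apply: (@ann_map_sub _ _ idfun _ _ (leq_maxr t u)).
apply/annihilatedP => a au.
have Il' : {subset I <= spanl l} by move=> y; rewrite Il.
have x'k' (y : R^o) : y \in l -> (y ^+ k : R^o) \in kermod (scale_by x').
  by move=> yl; apply/kermodP; exact: x'k.
by have /kermodP := ideal_pow_nil_sub Il' (leqnn _) x'k' au.
Qed.

Definition annim_in t : {linear Q t -> submod_of (ann M'' t)} :=
  sub_map (f := idfun) (@annim_sub t).
Definition annim_lift t u (tu : {subset ann M'' t <= annim u}) :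
  {linear submod_of (ann M'' t) -> Q u} := sub_map (f := idfun) tu.
Definition annim_inc t u (tu : (t <= u)%N) : {linear Q t -> Q u} :=
  sub_map (f := idfun) (annim_le tu).

Lemma annim_map_subproof t x : x \in ann M t -> g x \in annim t.
Proof. by move=> xt; apply/imagemodP; exists x. Qed.
Definition annim_map t : {linear submod_of (ann M t) -> Q t} :=
  sub_map (@annim_map_subproof t).
Local Notation fann t := (ann_map f (leqnn t)).

Lemma annim_short_exact t : short_exact (fann t) (annim_map t).
Proof.
have [fi gs ex] := fg; split=> [x /(congr1 val)/fi x0|y|x].
- exact: val_inj.
- by have /imagemodP[x xt xy] := valP y; exists (SubmodOf xt); exact: val_inj.
split=> [/(congr1 val)/ex[y yx]|[y <-]]; last first.
  by apply: val_inj; exact: (short_exact_comp fg).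
have yt : y \in ann M' t.
  apply/annihilatedP => a au; apply: fi; rewrite linearZZ yx.
  by have /annihilatedP := valP x; exact.
by exists (SubmodOf yt); exact: val_inj.
Qed.

(** A class that dies in (0 :_M'' I^u) also dies in a later [annim v], since (0 :_M'' I^u) is
    contained in it: the two systems are cofinal. *)
Lemma annim_in_eq0 i t (x : H (Q t) i) : fcl M'' i t (Hmap (annim_in t) i x) = 0 ->
  exists u (tu : (t <= u)%N), Hmap (annim_inc tu) i x = 0.
Proof.
move=> /fcl_eq0[u [tu xu]]; have [v uv uP] := annim_cofinal u.
exists v, (leq_trans tu uv).
rewrite (lh_map_comp (h := inc M'' tu \o annim_in t) (h' := annim_lift uP)).
  rewrite (lh_map_comp (h := annim_in t) (h' := inc M'' tu)) // xu; exact: raddf0.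
by move=> z; exact: val_inj.
Qed.

Lemma annim_surj i (y : F M'' i) : exists t x, y = fcl M'' i t (Hmap (annim_in t) i x).
Proof.
have [t [x ->]] := fcl_surj y; have [u tu uP] := annim_cofinal t.
exists u, (Hmap (annim_lift uP) i x); rewrite (fcl_up tu); congr (fcl _ _ _ _).
by apply: lh_map_comp => z; exact: val_inj.
Qed.

Lemma fmap_annim i t x : fmap g i (fcl M i t x) =
  fcl M'' i t (Hmap (annim_in t) i (Hmap (annim_map t) i x)).
Proof.
rewrite fmap_fcl; congr (fcl _ _ _ _); apply: lh_map_comp => z.
exact: val_inj.
Qed.

Lemma formal_exact i (y : F M i) : fmap g i y = 0 -> exists y', fmap f i y' = y.
Proof.
have [t [x ->]] := fcl_surj y; rewrite fmap_annim => /annim_in_eq0[u [tu xu]].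
have [||x' x'E] := lh_exact noethR (annim_short_exact u) (x := Hmap (inc M tu) i x).
- exact: sub_artinian.
- rewrite -[RHS]xu; apply: lh_map_square => z; exact: val_inj.
by exists (fcl M' i u x'); rewrite fmap_fcl x'E -fcl_up.
Qed.

Lemma formal0_surj (y : F M'' 0) : exists x, fmap g 0 x = y.
Proof.
have [t [x ->]] := annim_surj y.
have [|z zx] := lh0_surj noethR (annim_short_exact t) x; first exact: sub_artinian.
by exists (fcl M 0 t z); rewrite fmap_annim zx.
Qed.

(* The graph of the connecting map. *)
Definition formal_delta i (y'' : F M'' i.+1) (y' : F M' i) := exists t x'' x',
  [/\ lh_delta (fann t) (annim_map t) x'' x',
      y'' = fcl M'' i.+1 t (Hmap (annim_in t) i.+1 x'') & y' = fcl M' i t x'].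

Lemma lh_delta_inc i t u (tu : (t <= u)%N) x'' x' :
  lh_delta (i := i) (fann t) (annim_map t) x'' x' ->
  lh_delta (fann u) (annim_map u) (Hmap (annim_inc tu) i.+1 x'')
    (Hmap (inc M' tu) i x').
Proof.
by apply: (@lh_delta_map _ m _ _ _ _ _ _ _ _ _ _ _ (inc M tu)) => z; exact: val_inj.
Qed.

Lemma fcl_inc i t u (tu : (t <= u)%N) x'' :
  fcl M'' i u (Hmap (annim_in u) i (Hmap (annim_inc tu) i x'')) =
  fcl M'' i t (Hmap (annim_in t) i x'').
Proof.
rewrite [RHS](fcl_up tu); congr (fcl _ _ _ _); apply: lh_map_square => z.
exact: val_inj.
Qed.

Lemma formal_delta_total i (y'' : F M'' i.+1) : exists y', formal_delta y'' y'.
Proof.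
have [t [x ->]] := annim_surj y''.
have [x' xx'] := lh_delta_total (annim_short_exact t) x.
by exists (fcl M' i t x'), t, x, x'.
Qed.

Lemma formal_delta_lin i a (y1 : F M'' i.+1) y1' y2 y2' :
  formal_delta y1 y1' -> formal_delta y2 y2' ->
  formal_delta (a *: y1 + y2) (a *: y1' + y2').
Proof.
move=> [t [x1 [x1' [d1 -> ->]]]] [u [x2 [x2' [d2 -> ->]]]].
have d1' := lh_delta_inc (leq_maxl t u) d1; have d2' := lh_delta_inc (leq_maxr t u) d2.
have d := lh_delta_lin a d1' d2'.
exists (maxn t u); eexists; eexists; split; first exact: d.
  rewrite -(fcl_inc (leq_maxl t u)) -(fcl_inc (leq_maxr t u)) -[LHS]linearP.
  by congr (fcl _ _ _ _); exact/esym/linearP.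
by rewrite linearP -!fcl_up.
Qed.

Lemma formal_delta_fun0 i (y' : F M' i) : formal_delta 0 y' -> y' = 0.
Proof.
move=> [t [x'' [x' [d /esym/annim_in_eq0[u [tu x0]] ->]]]].
have := lh_delta_inc tu d; rewrite x0 => /(lh_delta_fun0 (annim_short_exact u)) x'0.
by rewrite (fcl_up tu) x'0 raddf0.
Qed.

Lemma formal_delta_exactl i (y'' : F M'' i.+1) : formal_delta y'' 0 ->
  exists y, fmap g i.+1 y = y''.
Proof.
move=> [t [x'' [x' [d -> /esym/fcl_eq0[u [tu x0]]]]]].
have := lh_delta_inc tu d; rewrite x0.
move=> /(lh_delta_exactl noethR (annim_short_exact u) (sub_artinian aM))[x xx].
by exists (fcl M i.+1 u x); rewrite fmap_annim xx fcl_inc.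
Qed.

Lemma formal_delta_comp i (y : F M i.+1) : formal_delta (fmap g i.+1 y) 0.
Proof.
have [t [x ->]] := fcl_surj y; exists t, (Hmap (annim_map t) i.+1 x), 0; split.
- exact: lh_delta_comp.
- exact: fmap_annim.
- by rewrite raddf0.
Qed.

Lemma formal_delta_exactr i (y' : F M' i) : fmap f i y' = 0 ->
  exists y'', formal_delta (y'' : F M'' i.+1) y'.
Proof.
have [t [x' ->]] := fcl_surj y'; rewrite fmap_fcl => /fcl_eq0[u [tu x0]].
have [||x'' d] := lh_delta_exactr noethR (annim_short_exact u) (x' := Hmap (inc M' tu) i x').
- exact: sub_artinian.
- by rewrite -[RHS]x0; apply: lh_map_square => z; exact: val_inj.
exists (fcl M'' i.+1 u (Hmap (annim_in u) i.+1 x'')), u, x'', (Hmap (inc M' tu) i x').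
by split=> //; exact: fcl_up.
Qed.

Lemma formal_connecting i : exists d : {linear F M'' i.+1 -> F M' i}, [/\
  forall y, d y = 0 -> exists x, fmap g i.+1 x = y,
  forall x, d (fmap g i.+1 x) = 0 &
  forall z, fmap f i z = 0 -> exists y, d y = z].
Proof.
have lin a u v u' v' := @formal_delta_lin i a u v u' v'.
have [d dP] := linear_of_rel (@formal_delta_total i) lin (@formal_delta_fun0 i).
have uniq u v : formal_delta u v -> d u = v.
  by move=> uv; exact: (linear_rel_uniq lin (@formal_delta_fun0 i) (dP u) uv).
exists d; split=> [y dy|x|z /formal_delta_exactr[y yz]].
- by apply: formal_delta_exactl; rewrite -dy; exact: dP.
- by apply: uniq; exact: formal_delta_comp.
- by exists y; exact: uniq.
Qed.
End ShortExact.

(** For t >= 1 the submodule (0 :_M I^t) is all of [M], so the stage t = 1 maps onto the limit. *)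
Lemma formal_killed_noetherian M i : noetherian (R^o : lmodType R) ->
  maximal_ideal m -> artinian M ->
  (forall (a : R^o) (x : M), a \in I -> a *: x = 0) -> noetherian (F M i).
Proof.
move=> noethR m_max aM IM.
have nH : noetherian (H (submod_of (ann M 1)) i).
  by apply: lh_artinian_noetherian => //; exact: sub_artinian.
apply: (surj_noetherian (f := fcl M i 1)) nH => y.
have [t [x ->]] := fcl_surj y.
have sub u z : z \in ann M u -> idfun z \in ann M 1.
  move=> _; apply/annihilatedP => a /ideal_pow_sub1; exact: IM.
exists (Hmap (sub_map (@sub t)) i x).
rewrite (fcl_up (leq_maxl t 1)) (fcl_up (leq_maxr t 1)); congr (fcl _ _ _ _).
by apply/esym/lh_map_comp => z; exact: val_inj.
Qed.
End Formal.

(** * The induction *)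

Section PowerMaps.
Variable R : comPzRingType.
Implicit Types U V W B Q : lmodType R.

Lemma fst_is_linear U V : linear (fun x : U * V => x.1).
Proof. by []. Qed.
Definition fst_map U V : {linear (U * V)%type -> U} := pack_linear (@fst_is_linear U V).

Lemma prod_map_is_linear U V U' V' (f : {linear U -> U'}) (g : {linear V -> V'}) :
  linear (fun x : U * V => (f x.1, g x.2)).
Proof. by move=> a x y; congr pair; rewrite linearP. Qed.
Definition prod_map U V U' V' (f : {linear U -> U'}) (g : {linear V -> V'}) :
    {linear (U * V)%type -> (U' * V')%type} := pack_linear (prod_map_is_linear f g).

Fixpoint power_map U V (f : {linear U -> V}) n : {linear power U n -> power V n} :=
  match n return {linear power U n -> power V n} with
  | 0 => f
  | n'.+1 => prod_map f (power_map f n')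
  end.

Lemma power_sum_eq0 (T : eqType) U V W (q : {linear V -> W}) (h : T -> {linear V -> U}) t l :
  (forall t' v, t' \in t :: l -> q v = 0 -> h t' v = 0) ->
  forall x, power_map q (size l) x = 0 -> power_sum h t l x = 0.
Proof.
elim: l t => [|u l IH] t hq x; first by apply: hq; rewrite mem_head.
case: x => x y [qx qy]; rewrite -[LHS]/(h t x + power_sum h u l y).
rewrite (hq t x) ?mem_head // add0r; apply: IH qy => t' v t'l.
by apply: hq; rewrite in_cons t'l orbT.
Qed.

(* A submodule chain in the image of d is controlled by its images in B/IB and, since
   I kills the image of d, hence the kernel of q, by its trace on IB, read off in a
   power of Q. *)
Lemma killed_noeth_mod (T : eqType) U B Q (d : {linear U -> B}) (q : {linear B -> Q})
    (h : T -> {linear B -> B}) t l :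
  (forall z, q z = 0 -> exists y, d y = z) ->
  (forall t' y, t' \in t :: l -> h t' (d y) = 0) ->
  noetherian Q -> noeth_mod (immod (power_sum h t l)) -> noeth_mod (kermod d).
Proof.
move=> qd hd nQ nB S SS dS; set p := power_sum h t l in nB.
pose C n := imagemod d (S n).
have CC n : {subset C n <= C n.+1}.
  by move=> _ /imagemodP[x xS <-]; apply/imagemodP; exists x => //; exact: SS.
have [n _ /addmodP[x [y [xC yp <-]]]|x|n1 n1P] := nB (fun n => addmod (C n) (immod p)).
- by apply: rpredD; [exact/addmodl/CC | exact: addmodr].
- exact: addmodr.
have nP : noetherian (power Q (size l)) by apply: power_serre (@noetherian_serre R) nQ.
have [n|n2 n2P] := nP (fun n => imagemod (power_map q (size l)) (premod p (C n))).
  move=> _ /imagemodP[x xS <-]; apply/imagemodP; exists x => //.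
  by move: xS; rewrite !premodE; exact: CC.
exists (maxn n1 n2) => k; rewrite geq_max => /andP[n1k n2k] x xS.
have dx : d x \in C k by apply/imagemodP; exists x.
have /addmodP[y [_ [yC /immodP[b <-] xE]]] := n1P k n1k _ (addmodl (immod p) dx).
have bC : b \in premod p (C k).
  rewrite premodE (_ : p b = d x + -1 *: y); last by rewrite -xE scaleN1r addrC addKr.
  by rewrite rpredD // rpredZ //; exact: (chain_le CC n1k).
have : power_map q (size l) b \in imagemod (power_map q (size l)) (premod p (C k)).
  by apply/imagemodP; exists b.
rewrite n2P // => /imagemodP[b' b'C qb].
have pb : p b = p b'.
  apply/eqP; rewrite -subr_eq0 -linearB; apply/eqP.
  apply: (power_sum_eq0 (q := q)) => [t' v tl /qd[w <-]|]; first exact: hd.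
  by rewrite linearB qb subrr.
have /imagemodP[x' x'S dx'] : d x \in C (maxn n1 n2).
  rewrite -xE pb; apply: rpredD; first exact: (chain_le CC (leq_maxl _ _)).
  by apply: (chain_le CC (leq_maxr _ _)); rewrite -premodE.
rewrite -(subrK x' x); apply: rpredD => //; apply: (chain_le SS (leq0n _)).
by apply/dS/kermodP; rewrite linearB dx' subrr.
Qed.
End PowerMaps.

Section Main.
Variables (R : comPzRingType) (m I : ideal R).
Implicit Types M : lmodType R.
Local Notation F := (formal_local_homology m I).
Local Notation fmap := (@fmap R m I).
Hypothesis m_max : maximal_ideal m.
Hypothesis noethR : noetherian (R^o : lmodType R).

Lemma completion_ofP (a b c : R) :
  completion_of m (a * b + c) = completion_of m a * completion_of m b + completion_of m c.
Proof.
apply: completionP => s; rewrite -[LHS]/(quoring_pi _ (a * b + c)).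
by rewrite quoring_piD quoring_piM.
Qed.

(** Each summand is a projection followed by multiplication by an element of [I], which [fmap] turns
    into multiplication by its image in the completion. *)
Lemma fmap_power_sum M i (t : R^o) l : (forall a, a \in t :: l -> a \in I) ->
  forall x, fmap (power_sum (scalar M : R^o -> _) t l) i x \in ideal_smul I (F M i).
Proof.
elim: l t => [|u l IH] t lI x.
  rewrite fmap_scalar; apply: mem_span; exists t, x; split=> //.
  by apply: lI; rewrite mem_head.
rewrite (@fmap_lin _ m I _ _ _ (scalar M t \o fst_map M (power M (size l)))
  (power_sum (scalar M : R^o -> _) u l \o snd_map M (power M (size l))) 1) => [|z].
  rewrite scale1r; apply: rpredD.
    rewrite (fmap_comp (h := fst_map _ _) (h' := scalar M t)) // fmap_scalar.
    by apply: mem_span; eexists; eexists; split; last by []; apply: lI; rewrite mem_head.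
  rewrite (fmap_comp (h := snd_map _ _) (h' := power_sum (scalar M : R^o -> _) u l)) //.
  by apply: IH => a al; apply: lI; rewrite in_cons al orbT.
by rewrite scale1r.
Qed.

Lemma formal_power_noetherian M i n : artinian M ->
  noetherian (F M i) -> noetherian (F (power M n) i).
Proof.
move=> aM nM; elim: n => //= n IH.
have aP k : artinian (power M k) by apply: power_serre (@artinian_serre R) aM.
apply: (exact_noetherian (f := fmap (inl_map M (power M n)) i)
  (g := fmap (snd_map M (power M n)) i)) nM IH => v.
exact: (formal_exact (prod_short_exact M (power M n)) noethR aM (aP n.+1)).
Qed.

(** For fixed x the scalars a with a x in the image form an ideal of R, so it suffices to check the
    generators. *)
Lemma ideal_smul_sub_power_sum (B : lmodType (completion m)) (l : seq R^o) :
  {subset I <= spanl l} ->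
  {subset ideal_smul I B <=
    immod (power_sum (fun a : R^o => scalar B (completion_of m a)) 0 l)}.
Proof.
set p := power_sum _ _ _ => Il; apply: span_sub => _ [a [x [/Il al ->]]].
have TP : submod_prop [set a : R^o | completion_of m a *: x \in immod p].
  split=> [|b c d cP dP].
    have c0 : completion_of m 0 = 0 by apply: completionP => k; exact: raddf0.
    suff : completion_of m 0 *: x \in immod p by [].
    by rewrite c0 scale0r rpred0.
  suff : completion_of m (b * c + d) *: x \in immod p by [].
  by rewrite completion_ofP scalerDl -scalerA; apply: rpredD dP; exact: rpredZ.
suff sub : {subset spanl l <= pack_submod TP} by have /pack_submodP := sub a al.
apply: span_sub => {}a {}al; apply/(pack_submodP TP).
have [|e eP] := @power_sum_inj _ _ _ _ (fun a : R^o => scalar B (completion_of m a)) 0 l a.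
  by rewrite in_cons; apply/orP; right.
by apply/immodP; exists (e x); rewrite eP.
Qed.

(** * The exact sequences 0 -> K -> M^r -> IM -> 0 and 0 -> IM -> M -> M/IM -> 0 *)

Section Generators.
Variables (M : lmodType R) (l : seq R^o).
Hypothesis aM : artinian M.
Hypothesis lI : forall a, a \in (0 : R^o) :: l -> a \in I.
Hypothesis Il : {subset I <= spanl l}.
Local Notation P := (power M (size l)).

(** Its image is IM, called [N] below; [K] is the kernel of the induced map onto [N]. *)
Definition gen_map : {linear P -> M} := power_sum (scalar M : R^o -> _) 0 l.
Local Notation N := (submod_of (immod gen_map)).

Lemma gen_map_onto_subproof x : gen_map x \in immod gen_map.
Proof. by apply/immodP; exists x. Qed.

Lemma gen_map_onto_is_linear : linear (fun x : P => SubmodOf (gen_map_onto_subproof x) : N).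
Proof. by move=> a x y; apply: val_inj; rewrite /= linearP. Qed.
Definition gen_map_onto : {linear P -> N} := pack_linear gen_map_onto_is_linear.

Lemma gen_map_onto_surj (y : N) : exists x, gen_map_onto x = y.
Proof. by have /immodP[x xy] := valP y; exists x; exact: val_inj. Qed.

Local Notation K := (submod_of (kermod gen_map_onto)).
Let KPN := ker_short_exact gen_map_onto_surj.
Let NMQ := sub_short_exact (immod gen_map).

Let aP : artinian P.
Proof. exact: power_serre (@artinian_serre R) aM. Qed.
Let aN : artinian N. Proof. exact: sub_artinian. Qed.
Let aK : artinian K. Proof. exact: sub_artinian. Qed.
Let aQ : artinian (quotmod (immod gen_map)). Proof. exact: quot_artinian. Qed.

Lemma scalar_factor (a : R^o) : a \in (0 : R^o) :: l ->
  exists e : {linear M -> P}, forall x, gen_map (e x) = a *: x.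
Proof. exact: power_sum_inj. Qed.

Lemma generated_quotient_killed (a : R^o) (x : quotmod (immod gen_map)) :
  a \in I -> a *: x = 0.
Proof.
move=> /Il al; rewrite -(quotreprK x) -linearZZ; apply: quotpi0.
suff sub : {subset spanl l <= premod (scale_by (quotrepr x)) (immod gen_map)}.
  by have := sub a al; rewrite premodE.
apply: span_sub => b bl; rewrite premodE; have [|e eP] := @scalar_factor b.
  by rewrite in_cons; apply/orP; right.
by apply/immodP; exists (e (quotrepr x)); rewrite eP.
Qed.

Lemma formal_generated_quotient i : noetherian (F (quotmod (immod gen_map)) i).
Proof.
apply: formal_killed_noetherian => // a x; exact: generated_quotient_killed.
Qed.

(** F_i(IM) lies between F_(i+1)(M/IM) and F_i(M) in the long exact sequence. *)
Lemma formal_generated_noetherian i : noetherian (F M i) -> noetherian (F N i).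
Proof.
move=> nM; have [d [_ _ dP]] := formal_connecting m I NMQ noethR aM aQ i.
apply: (exact_noetherian (f := d) (g := fmap (val : {linear N -> M}) i)) => //.
exact: formal_generated_quotient.
Qed.

(** F_i(K) lies between F_(i+1)(IM) and F_i(M^r); passing from [M] to [K] therefore costs one
    degree. *)
Lemma formal_relations_noetherian i :
  noetherian (F M i) -> noetherian (F M i.+1) -> noetherian (F K i).
Proof.
move=> nM nM1; have [d [_ _ dP]] := formal_connecting m I KPN noethR aP aN i.
apply: (exact_noetherian (f := d) (g := fmap (val : {linear K -> P}) i)) => //.
  exact: formal_generated_noetherian.
exact: formal_power_noetherian.
Qed.

(** Multiplication by [a] on IM factors as IM -> M -> M^r -> IM through the coordinate of [a]. So
    the generators kill the cokernel of F_i(M^r) -> F_i(IM). *)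
Lemma smul_onto i (a : R^o) (y : F N i) : a \in (0 : R^o) :: l ->
  exists x, fmap gen_map_onto i x = completion_of m a *: y.
Proof.
move=> al; have [e eP] := scalar_factor al.
exists (fmap (e \o (val : {linear N -> M})) i y).
rewrite -fmap_scalar; apply/esym/fmap_comp => x.
by apply: val_inj; rewrite [RHS]eP.
Qed.

(** F_i(IM) -> F_i(M) -> F_i(M/IM) is exact with noetherian last term, and the composite F_i(M^r) ->
    F_i(M) has values in I F_i(M). *)
Lemma formal_reduction i :
  noeth_mod (immod (fmap gen_map_onto i)) -> noeth_mod (ideal_smul I (F M i)).
Proof.
move=> nN; apply: (exact_noeth_mod (f := fmap (val : {linear N -> M}) i)
  (g := fmap (quotpi (immod gen_map)) i)) nN _ _ => [v||_ /immodP[x <-]].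
- exact: (formal_exact NMQ noethR aN aM).
- exact: formal_generated_quotient.
rewrite -(fmap_comp (h'' := gen_map)) //; exact: fmap_power_sum.
Qed.

Lemma formal0_generated : noeth_mod (immod (fmap gen_map_onto 0)).
Proof.
apply: noeth_mod_full => y; apply/immodP.
exact: (formal0_surj KPN noethR aP).
Qed.

(** The image of F_(i+1)(M^r) contains ker d for the connecting map d to F_i(K). The generators kill
    im d, which contains the kernel of F_i(K) -> F_i(M^r), so [killed_noeth_mod] applies. *)
Lemma formalS_generated i : noetherian (F M i) ->
  noeth_mod (ideal_smul I (F K i)) -> noeth_mod (immod (fmap gen_map_onto i.+1)).
Proof.
move=> nM nK; have [d [dl dc dr]] := formal_connecting m I KPN noethR aP aN i.
apply: (@noeth_mod_sub _ _ (kermod d)) => [y /kermodP/dl[x xy]|].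
  by apply/immodP; exists x.
apply: (killed_noeth_mod (q := fmap (val : {linear K -> P}) i)
  (h := fun a : R^o => scalar (F K i) (completion_of m a)) (t := 0) (l := l) dr).
- by move=> a y al; have [x xy] := smul_onto y al; rewrite pack_linearE -linearZZ -xy dc.
- exact: formal_power_noetherian.
apply: noeth_mod_sub nK; exact: ideal_smul_sub_power_sum.
Qed.
End Generators.

(** Induction on s for all artinian [M] at once: the step to s + 1 uses the statement at s for the
    kernel [K], whose F_i are noetherian for i < s. *)
Lemma formal_quotient_noetherian s M : artinian M ->
  (forall i, (i < s)%N -> noetherian (F M i)) ->
  noeth_mod (ideal_smul I (F M s)).
Proof.
have [l lI Il'] := noetherian_fg I noethR.
have Il : {subset I <= spanl l} by move=> a; rewrite Il'.
have l0I (a : R^o) : a \in (0 : R^o) :: l -> a \in I.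
  by rewrite in_cons => /predU1P[->|/lI//]; exact: rpred0.
elim: s M => [|s IHs] M aM nM; apply: (formal_reduction aM l0I Il).
  exact: formal0_generated.
apply: formalS_generated => //; first exact: nM.
apply: IHs => [|i si].
  by apply: sub_artinian; exact: power_serre (@artinian_serre R) aM.
apply: formal_relations_noetherian => //; apply: nM => //.
exact: ltnW.
Qed.
End Main.

Theorem theorem3p5 (R : comNzRingType) (m I : ideal R) (M : lmodType R)
    (s : nat) :
  is_local m ->
  noetherian (R^o : lmodType R) ->
  artinian M ->
  (forall i : nat, (i < s)%N -> noetherian (formal_local_homology m I M i)) ->
  noetherian (quotmod (ideal_smul I (formal_local_homology m I M s))).
Proof.
move=> [m_max _] noethR aM nF; apply: noeth_mod_quot.
exact: formal_quotient_noetherian.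
Qed.
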